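(* Let $k\geq 0$ be a natural number and let $m\geq 1$ be a positive integer. For every computable (total) function $f$ on the natural numbers, the following three conditions are mutually equivalent: (1) $f$ is provably recursive in the formal system $TIR^{(m)}_{k}+Tr_{\Pi_{1}}$. (2) There is a $q<\omega$ such that $f$ is elementary recursive in the fast growing function $F_{\omega^{1+k}\cdot m+q}$. (3) There exist a vocabulary $\mathcal{F}$ of type $\mathcal{F}^{(m)}_{k}$, with precedence $<$, and a finite term rewriting system $R$ over $\mathcal{F}$ such that $R$ reduces under the lexicographic path order $<_{lpo}$ induced by $<$, and $f$ is elementary recursive in the derivation complexity function $dh_{R}(n)$.
   Context: **Vocabularies.** A vocabulary is a non-empty finite set $\mathcal{F}$ of function symbols, each $g\in\mathcal{F}$ having a fixed arity $ar(g)\in\omega$ (constants have arity $0$), together with a precedence $<$ on $\mathcal{F}$, i.e. an irreflexive and transitive relation (not necessarily linear). It is assumed that some $g\in\mathcal{F}$ has $ar(g)>1$. For $g\in\mathcal{F}$ put, recursively along $<$, $rk_{2}(g):=\max\{rk_{2}(h)+1 : h\in\mathcal{F},\ h<g,\ ar(h)>1\}$, where $\max\emptyset=0$. For $k\ge 0$ and $m\ge 1$, $\mathcal{F}$ (with $<$) is of type $\mathcal{F}^{(m)}_{k}$ if $\max\{ar(g): g\in\mathcal{F}\}=2+k$ and $\max\{rk_{2}(g)+1 : g\in\mathcal{F},\ ar(g)>1\}=m$. **Lexicographic path order.** For terms $s,t$ over $\mathcal{F}$ (possibly with variables), $s<_{lpo}t$ is defined recursively: $s<_{lpo}t$ holds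 iff $t=g(t_{0},\ldots,t_{n-1})$ for some $g\in\mathcal{F}$ and one of the following holds: (i) $s=t_{i}$ or $s<_{lpo}t_{i}$ for some $i<n$; (ii) $s=h(s_{0},\ldots,s_{l-1})$ with $h<g$ and $s_{j}<_{lpo}t$ for all $j<l$; (iii) $s=g(s_{0},\ldots,s_{n-1})$, $s_{j}<_{lpo}t$ for all $j<n$, and there is $i<n$ with $s_{j}=t_{j}$ for all $j<i$ and $s_{i}<_{lpo}t_{i}$. **Rewriting.** A finite term rewriting system $R$ over $\mathcal{F}$ is a finite set of rules $l\to r$, where $l,r$ are terms over $\mathcal{F}$ with variables, $l$ is not a variable, and every variable of $r$ occurs in $l$. $\to_{R}$ is the induced one-step rewrite relation (the closure of the rules under substitutions and contexts). $R$ reduces under $<_{lpo}$ if $r<_{lpo}l$ for every rule $l\to r$ of $R$. The derivation complexity function $dh_{R}(n)$ is the maximal length $N$ of a rewrite sequence $t_{0}\to_{R}t_{1}\to_{R}\cdots\to_{R}t_{N}$ of terms over $\mathcal{F}$ starting from a closed term $t_{0}$ of size at most $n$ (with $\max\emptyset=0$). **Formal systems.** $I\Sigma_{1}$ is the fragment of first-order arithmetic with induction restricted to $\Sigma_{1}$-formulas. $Tr_{\Pi_{1}}$ is the set of all true $\Pi_{1}$-sentences of arithmetic. Let $<_{lx}$ be the lexicographic ordering on $(1+k)$-tuples of natural numbers. Write $\vec{x}=(x_{0},\ldots,x_{k})$ and $\vec{y}=(y_{0},\ldots,y_{k})$. The rule $TIR[\omega^{1+k},\Pi_{2}]$ is: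 from $\forall\vec{x}\,[\forall\vec{y}<_{lx}\vec{x}\;A(\vec{y})\to A(\vec{x})]$ infer $\forall\vec{x}\,A(\vec{x})$, where $A$ is a $\Pi_{2}$-formula. $TIR^{(m)}_{k}+Tr_{\Pi_{1}}$ is the extension of $I\Sigma_{1}+Tr_{\Pi_{1}}$ in which this rule may be applied nestedly at most $m$ times. Precisely, the relations $TIR^{(m)}_{k}+Tr_{\Pi_{1}}\vdash B$ ($m\in\omega$) are generated inductively by: (a) if $I\Sigma_{1}+Tr_{\Pi_{1}}\vdash B$, then $TIR^{(m)}_{k}+Tr_{\Pi_{1}}\vdash B$ for every $m$; (b) if $A\in\Pi_{2}$ and $TIR^{(m)}_{k}+Tr_{\Pi_{1}}\vdash\forall\vec{x}\,[\forall\vec{y}<_{lx}\vec{x}\;A(\vec{y})\to A(\vec{x})]$, then $TIR^{(m+1)}_{k}+Tr_{\Pi_{1}}\vdash\forall\vec{x}\,A(\vec{x})$; (c) if $B$ follows logically from some formulas $\{C_{i}\}_{i}$ and $TIR^{(m)}_{k}+Tr_{\Pi_{1}}\vdash C_{i}$ for every $i$, then $TIR^{(m)}_{k}+Tr_{\Pi_{1}}\vdash B$. A function $f$ is provably recursive in such a system if there is a $\Sigma_{1}$-formula $\varphi(x,y)$ ($x$ possibly a tuple) defining the graph of $f$ in the standard model such that the system proves $\forall x\,\exists y\,\varphi(x,y)$. **Fast growing functions.** For ordinals $\alpha<\omega^{\omega}$: $F_{0}(x)=x+1$; $F_{\alpha+1}(x)=F_{\alpha}^{(x+1)}(x)$ (the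 $(x+1)$-fold iterate of $F_{\alpha}$ applied to $x$); and $F_{\lambda}(x)=F_{\lambda[x]}(x)$ for limit $\lambda$, with the standard fundamental sequences $\lambda[x]=\beta+\omega^{n}\cdot(x+1)$ when $\lambda=\beta+\omega^{n+1}$ in Cantor normal form. **Elementary recursive in.** A function is elementary recursive in $g$ if it belongs to the least class of functions that contains $g$, the constants, projections, successor, addition and truncated subtraction, and is closed under composition, bounded sums and bounded products. *)

(* Defs.v *)
From mathcomp Require Import all_boot.
From Stdlib Require List.

Set Implicit Arguments.
Unset Strict Implicit.
Unset Printing Implicit Defensive.

(* The total recursive functions, generated with minimization restricted to
   the regular case, i.e. to [h] whose zero is found on every input [v]. *)
Inductive computable : forall n, (n.-tuple nat -> nat) -> Prop :=
| comp_const n (c : nat) : computable (fun _ : n.-tuple nat => c)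
| comp_proj n (i : 'I_n) : computable (fun v : n.-tuple nat => tnth v i)
| comp_succ : computable (fun v : 1.-tuple nat => (thead v).+1)
| comp_comp n p (h : p.-tuple nat -> nat) (hs : 'I_p -> n.-tuple nat -> nat) :
    computable h -> (forall i, computable (hs i)) ->
    computable (fun v : n.-tuple nat => h [tuple hs i v | i < p])
| comp_primrec n (b : n.-tuple nat -> nat) (s : n.+2.-tuple nat -> nat) :
    computable b -> computable s ->
    computable (fun v : n.+1.-tuple nat =>
      iteri (thead v) (fun i r => s [tuple of i :: r :: behead_tuple v])
            (b (behead_tuple v)))
| comp_mu n (h : n.+1.-tuple nat -> nat) (f : n.-tuple nat -> nat) :
    computable h ->
    (forall v, h [tuple of f v :: v] = 0 /\
               forall i, i < f v -> h [tuple of i :: v] <> 0) ->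
    computable f
| comp_ext n (f g : n.-tuple nat -> nat) :
    f =1 g -> computable f -> computable g.

Inductive elementary_in (g : nat -> nat) :
    forall n, (n.-tuple nat -> nat) -> Prop :=
| elem_oracle : elementary_in g (fun v : 1.-tuple nat => g (thead v))
| elem_const n (c : nat) : elementary_in g (fun _ : n.-tuple nat => c)
| elem_proj n (i : 'I_n) : elementary_in g (fun v : n.-tuple nat => tnth v i)
| elem_succ : elementary_in g (fun v : 1.-tuple nat => (thead v).+1)
| elem_add : elementary_in g (fun v : 2.-tuple nat => tnth v ord0 + tnth v ord_max)
| elem_sub : elementary_in g (fun v : 2.-tuple nat => tnth v ord0 - tnth v ord_max)
| elem_comp n p (h : p.-tuple nat -> nat) (hs : 'I_p -> n.-tuple nat -> nat) :
    elementary_in g h -> (forall i, elementary_in g (hs i)) ->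
    elementary_in g (fun v : n.-tuple nat => h [tuple hs i v | i < p])
| elem_bsum n (h : n.+1.-tuple nat -> nat) :
    elementary_in g h ->
    elementary_in g (fun v : n.+1.-tuple nat =>
      \sum_(0 <= i < thead v) h [tuple of i :: behead_tuple v])
| elem_bprod n (h : n.+1.-tuple nat -> nat) :
    elementary_in g h ->
    elementary_in g (fun v : n.+1.-tuple nat =>
      \prod_(0 <= i < thead v) h [tuple of i :: behead_tuple v])
| elem_ext n (f f' : n.-tuple nat -> nat) :
    f =1 f' -> elementary_in g f -> elementary_in g f'.

(* An ordinal below omega^omega in Cantor normal form
   omega^n_1 + ... + omega^n_r, n_1 >= ... >= n_r, is the list of its
   exponents [:: n_1; ...; n_r]. *)
Definition cnf := seq nat.

Definition omega_pow_mul_add (n m q : nat) : cnf := nseq m n ++ nseq q 0.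

(* [fast_growing a G]: G is F_a. In the last clause the ordinal is the limit
   beta + omega^(n+1), whose x-th fundamental term is
   beta + omega^n * (x+1). *)
Inductive fast_growing : cnf -> (nat -> nat) -> Prop :=
| fast_zero : fast_growing [::] succn
| fast_succ a G :
    fast_growing a G ->
    fast_growing (rcons a 0) (fun x => iter x.+1 G x)
| fast_lim b n (G : nat -> nat -> nat) :
    (forall x, fast_growing (b ++ nseq x.+1 n) (G x)) ->
    fast_growing (rcons b n.+1) (fun x => G x x).

(* [prec h g] is h < g. Non-emptiness follows from [ar_gt1]. *)
Record vocabulary := Vocabulary {
  fsym :> finType;
  ar : fsym -> nat;
  prec : rel fsym;
  prec_irr : irreflexive prec;
  prec_trans : transitive prec;
  ar_gt1 : exists g, 1 < ar g }.

(* Recursion along [prec], run for #|F| rounds; [rk2E] is the intended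
   recursion equation. *)
Fixpoint rk2_rec (F : vocabulary) (n : nat) (g : F) : nat :=
  if n is n'.+1 then \max_(h : F | prec h g && (1 < ar h)) (rk2_rec n' h).+1
  else 0.

Definition rk2 (F : vocabulary) (g : F) : nat := rk2_rec #|F| g.

Lemma rk2_rec_stable (F : vocabulary) n (g : F) :
  #|[pred h | prec h g]| <= n -> rk2_rec n g = rk2_rec n.+1 g.
Proof.
elim: n g => [|n IHn] g.
  rewrite leqn0 => /eqP /card0_eq Hg /=; rewrite big_pred0 // => h.
  by move: (Hg h); rewrite inE => ->.
move=> Hg; rewrite [LHS]/= [RHS]/=; apply: eq_bigr => h /andP[lt_hg _].
congr (_.+1); rewrite (IHn h) //; rewrite -ltnS; apply: leq_trans Hg.
apply: proper_card; apply/properP; split.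
  by apply/subsetP => x; rewrite !inE => lt_xh; apply: prec_trans lt_xh lt_hg.
by exists h; rewrite inE // prec_irr.
Qed.

Lemma rk2E (F : vocabulary) (g : F) :
  rk2 g = \max_(h : F | prec h g && (1 < ar h)) (rk2 h).+1.
Proof. by rewrite {1}/rk2 rk2_rec_stable ?max_card. Qed.

Definition of_type (k m : nat) (F : vocabulary) : Prop :=
  \max_(g : F) ar g = 2 + k /\ \max_(g : F | 1 < ar g) (rk2 g).+1 = m.

Inductive term (F : vocabulary) : Type :=
| Var (x : nat)
| App (g : F) (ts : {ffun 'I_(ar g) -> term F}).
Arguments Var {F} x.
Arguments App {F} g ts.

Fixpoint term_size (F : vocabulary) (t : term F) : nat :=
  if t is App g ts then (\sum_(i < ar g) term_size (ts i)).+1 else 1.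

Fixpoint occurs (F : vocabulary) (x : nat) (t : term F) : Prop :=
  match t with
  | Var y => x = y
  | App g ts => exists i, occurs x (ts i)
  end.

Definition closed_term (F : vocabulary) (t : term F) : Prop :=
  forall x, ~ occurs x t.

Fixpoint term_subst (F : vocabulary) (s : nat -> term F) (t : term F) : term F :=
  match t with
  | Var x => s x
  | App g ts => App g [ffun i => term_subst s (ts i)]
  end.

Inductive lpo (F : vocabulary) : term F -> term F -> Prop :=
| lpo_arg g (ts : {ffun 'I_(ar g) -> term F}) i : lpo (ts i) (App g ts)
| lpo_sub g (ts : {ffun 'I_(ar g) -> term F}) s i :
    lpo s (ts i) -> lpo s (App g ts)
| lpo_prec h g (ss : {ffun 'I_(ar h) -> term F})
               (ts : {ffun 'I_(ar g) -> term F}) :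
    prec h g -> (forall j, lpo (ss j) (App g ts)) -> lpo (App h ss) (App g ts)
| lpo_lex g (ss ts : {ffun 'I_(ar g) -> term F}) (i : 'I_(ar g)) :
    (forall j, lpo (ss j) (App g ts)) ->
    (forall j : 'I_(ar g), j < i -> ss j = ts j) -> lpo (ss i) (ts i) ->
    lpo (App g ss) (App g ts).

(* A rule l -> r is the pair (l, r). *)
Definition rules (F : vocabulary) := seq (term F * term F).

Definition is_trs (F : vocabulary) (R : rules F) : Prop :=
  forall l r, List.In (l, r) R ->
    (forall x, l <> Var x) /\ (forall x, occurs x r -> occurs x l).

Definition reduces_lpo (F : vocabulary) (R : rules F) : Prop :=
  forall l r, List.In (l, r) R -> lpo r l.

Inductive rewrites (F : vocabulary) (R : rules F) : term F -> term F -> Prop :=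
| rewrites_rule l r s :
    List.In (l, r) R -> rewrites R (term_subst s l) (term_subst s r)
| rewrites_ctx g (ss ts : {ffun 'I_(ar g) -> term F}) i :
    rewrites R (ss i) (ts i) -> (forall j, j != i -> ss j = ts j) ->
    rewrites R (App g ss) (App g ts).

Definition derivation (F : vocabulary) (R : rules F) (n N : nat) : Prop :=
  exists t : nat -> term F,
    [/\ closed_term (t 0), term_size (t 0) <= n
      & forall i, i < N -> rewrites R (t i) (t i.+1)].

(* [is_dh R d]: for every n the maximum defining dh_R(n) exists and is d n,
   the maximum of the empty set being 0. *)
Definition is_dh (F : vocabulary) (R : rules F) (d : nat -> nat) : Prop :=
  forall n,
    (derivation R n (d n) /\ forall N, derivation R n N -> N <= d n) \/
    ((forall N, ~ derivation R n N) /\ d n = 0).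

(* The language is 0, S, +, *, =, <, with de Bruijn indices: the variable 0
   in the body of [All] is the bound one. *)
Inductive aterm : Type :=
| AVar of nat
| AZero
| ASucc of aterm
| AAdd of aterm & aterm
| AMul of aterm & aterm.

Inductive formula : Type :=
| Eq of aterm & aterm
| Lt of aterm & aterm
| Bot
| Imp of formula & formula
| All of formula.

Definition Neg A := Imp A Bot.
Definition And A B := Neg (Imp A (Neg B)).
Definition Or A B := Imp (Neg A) B.
Definition Ex A := Neg (All (Neg A)).

Fixpoint asubst (s : nat -> aterm) (t : aterm) : aterm :=
  match t with
  | AVar x => s x
  | AZero => AZero
  | ASucc u => ASucc (asubst s u)
  | AAdd u v => AAdd (asubst s u) (asubst s v)
  | AMul u v => AMul (asubst s u) (asubst s v)
  end.

Definition ashift : aterm -> aterm := asubst (fun x => AVar x.+1).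

Definition up (s : nat -> aterm) : nat -> aterm :=
  fun x => if x is y.+1 then ashift (s y) else AVar 0.

Fixpoint fsubst (s : nat -> aterm) (A : formula) : formula :=
  match A with
  | Eq t u => Eq (asubst s t) (asubst s u)
  | Lt t u => Lt (asubst s t) (asubst s u)
  | Bot => Bot
  | Imp B C => Imp (fsubst s B) (fsubst s C)
  | All B => All (fsubst (up s) B)
  end.

Definition fshift : formula -> formula := fsubst (fun x => AVar x.+1).

(* A[t] for the body A of a quantifier *)
Definition finst (t : aterm) : formula -> formula :=
  fsubst (fun x => if x is y.+1 then AVar y else t).

(* all free variables have index < n *)
Fixpoint abounded (n : nat) (t : aterm) : bool :=
  match t with
  | AVar x => x < n
  | AZero => true
  | ASucc u => abounded n u
  | AAdd u v | AMul u v => abounded n u && abounded n v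
  end.

Fixpoint fbounded (n : nat) (A : formula) : bool :=
  match A with
  | Eq t u | Lt t u => abounded n t && abounded n u
  | Bot => true
  | Imp B C => fbounded n B && fbounded n C
  | All B => fbounded n.+1 B
  end.

Definition sentence (A : formula) : bool := fbounded 0 A.

Fixpoint aeval (e : nat -> nat) (t : aterm) : nat :=
  match t with
  | AVar x => e x
  | AZero => 0
  | ASucc u => (aeval e u).+1
  | AAdd u v => aeval e u + aeval e v
  | AMul u v => aeval e u * aeval e v
  end.

Fixpoint sat (e : nat -> nat) (A : formula) : Prop :=
  match A with
  | Eq t u => aeval e t = aeval e u
  | Lt t u => aeval e t < aeval e u
  | Bot => False
  | Imp B C => sat e B -> sat e C
  | All B => forall a, sat (fun x => if x is y.+1 then e y else a) B
  end.

Inductive Delta0 : formula -> Prop :=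
| Delta0_eq t u : Delta0 (Eq t u)
| Delta0_lt t u : Delta0 (Lt t u)
| Delta0_bot : Delta0 Bot
| Delta0_imp A B : Delta0 A -> Delta0 B -> Delta0 (Imp A B)
| Delta0_ball t A : Delta0 A -> Delta0 (All (Imp (Lt (AVar 0) (ashift t)) A)).

Inductive Sigma1 : formula -> Prop :=
| Sigma1_Delta0 A : Delta0 A -> Sigma1 A
| Sigma1_ex A : Sigma1 A -> Sigma1 (Ex A).

Inductive Pi1 : formula -> Prop :=
| Pi1_Delta0 A : Delta0 A -> Pi1 A
| Pi1_all A : Pi1 A -> Pi1 (All A).

Inductive Pi2 : formula -> Prop :=
| Pi2_Sigma1 A : Sigma1 A -> Pi2 A
| Pi2_all A : Pi2 A -> Pi2 (All A).

(* Classical first-order logic with equality, as a Hilbert calculus. As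
   generalization applies to the members of T, their free variables are read
   as universally quantified. *)
Inductive derives (T : formula -> Prop) : formula -> Prop :=
| d_ax A : T A -> derives T A
| d_mp A B : derives T (Imp A B) -> derives T A -> derives T B
| d_gen A : derives T A -> derives T (All A)
| d_K A B : derives T (Imp A (Imp B A))
| d_S A B C : derives T
    (Imp (Imp A (Imp B C)) (Imp (Imp A B) (Imp A C)))
| d_dne A : derives T (Imp (Neg (Neg A)) A)
| d_inst A t : derives T (Imp (All A) (finst t A))
| d_dist A B : derives T (Imp (All (Imp (fshift A) B)) (Imp A (All B)))
| d_refl t : derives T (Eq t t)
| d_leibniz A t u : derives T (Imp (Eq t u) (Imp (finst t A) (finst u A))).

Inductive ISigma1 : formula -> Prop :=
| ax_succ_neq0 : ISigma1 (Neg (Eq (ASucc (AVar 0)) AZero))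
| ax_succ_inj :
    ISigma1 (Imp (Eq (ASucc (AVar 0)) (ASucc (AVar 1))) (Eq (AVar 0) (AVar 1)))
| ax_add0 : ISigma1 (Eq (AAdd (AVar 0) AZero) (AVar 0))
| ax_addS : ISigma1 (Eq (AAdd (AVar 0) (ASucc (AVar 1)))
                        (ASucc (AAdd (AVar 0) (AVar 1))))
| ax_mul0 : ISigma1 (Eq (AMul (AVar 0) AZero) AZero)
| ax_mulS : ISigma1 (Eq (AMul (AVar 0) (ASucc (AVar 1)))
                        (AAdd (AMul (AVar 0) (AVar 1)) (AVar 0)))
| ax_lt_ex :
    ISigma1 (Imp (Lt (AVar 0) (AVar 1))
                 (Ex (Eq (AAdd (AVar 1) (ASucc (AVar 0))) (AVar 2))))
| ax_ex_lt :
    ISigma1 (Imp (Ex (Eq (AAdd (AVar 1) (ASucc (AVar 0))) (AVar 2)))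
                 (Lt (AVar 0) (AVar 1)))
| ax_ind A :
    Sigma1 A ->
    ISigma1 (Imp (finst AZero A)
              (Imp (All (Imp A (fsubst (fun x => if x is 0 then ASucc (AVar 0)
                                                 else AVar x) A)))
                   (All A))).

Definition TrPi1 (A : formula) : Prop :=
  [/\ Pi1 A, sentence A & forall e, sat e A].

Definition ISigma1_TrPi1 (A : formula) : Prop := ISigma1 A \/ TrPi1 A.

Definition Alls (n : nat) (A : formula) : formula := iter n All A.

(* (y_i, ..., y_(i+n-1)) <_lx (x_i, ..., x_(i+n-1)), where y_j is the variable
   j and x_j is the variable K + j *)
Fixpoint lex_lt (K i n : nat) : formula :=
  if n is n'.+1 then
    Or (Lt (AVar i) (AVar (K + i)))
       (And (Eq (AVar i) (AVar (K + i))) (lex_lt K i.+1 n'))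
  else Bot.

(* forall x, [(forall y <_lx x, A(y)) -> A(x)] for K-tuples x, y. The
   variables i < K of A stand for x_i, the other free variables of A are
   parameters; below the quantifiers on y the latter, like x, move up by K. *)
Definition progressive (K : nat) (A : formula) : formula :=
  Alls K (Imp (Alls K (Imp (lex_lt K 0 K)
                 (fsubst (fun x => if x < K then AVar x else AVar (K + x)) A)))
              A).

(* [TIR k m B]: TIR_k^(m) + Tr_Pi1 proves B *)
Inductive TIR (k : nat) : nat -> formula -> Prop :=
| TIR_base m B : derives ISigma1_TrPi1 B -> TIR k m B
| TIR_rule m A :
    Pi2 A -> TIR k m (progressive k.+1 A) -> TIR k m.+1 (Alls k.+1 A)
| TIR_logic m (C : formula -> Prop) B :
    derives C B -> (forall A, C A -> TIR k m A) -> TIR k m B.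

(* In the formula A(x,y) the output y is the variable 0 and the input x_i is
   the variable i+1. *)
Definition provably_recursive (prv : formula -> Prop) (n : nat)
    (f : n.-tuple nat -> nat) : Prop :=
  exists A : formula,
    [/\ Sigma1 A, fbounded n.+1 A,
        forall (v : n.-tuple nat) (y : nat),
          sat (fun x => nth 0 (y :: v) x) A <-> f v = y
      & prv (Alls n (Ex A))].

(* Main.v *)
Require Import Defs.
From mathcomp Require Import all_boot zify.
From Stdlib Require Import Classical ClassicalEpsilon FunctionalExtensionality
  PropExtensionality.

(** Why the three conditions agree.

    Ordinals are replaced by operators: [jump d] turns F_b into
    F_(b + omega^d), and [Fmq k m q] is F_(omega^(1+k) * m + q). The pivot is
    condition (2); the other two are compared with it.

    From (1) to (2). Provable formulas are interpreted by forcing. A condition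
    is a sequence of intervals, for infinitely many indices, each eventually
    long enough for every finite iterate of given base functions; it stands for
    a cut in a nonstandard model. Bounded formulas are absolute, so true Pi1
    sentences are forced, and Sigma1 induction is forced because an interval
    can be cut into more pieces than there are values to be decided
    ([forced_induction]). If the base functions grow like F_(omega^(1+k) * m),
    the theorems of TIR with [m] nested rules are forced ([forced_TIR]): an
    instance of the rule that fails on a long interval fails at a
    lexicographically smaller point on an interval still long enough for the
    points below it, and there is no infinite descent ([descent],
    [forced_rule]). Hence a provable forall-exists statement has witnesses
    below some [Fmq k m q] ([TIR_witness]), and a bounded search for them is
    elementary in this function ([elementary_of_graph]).

    From (2) to (1). Relations generated inductively are defined by bounded
    formulas saying that a finite table of justified facts exists ([table]).
    This gives a bounded definition of the graph of [Fmq k m q], relative to a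
    bound for the table, and of every function elementary in it
    ([elementary_bounded_graph]). By completeness of the calculus
    ([derives_complete]) it suffices to show totality in every model of TIR;
    there the needed facts are true bounded statements, except that tables for
    long computations exist, which is proved by Sigma1 induction and, for each
    multiple of omega^(1+k), by one nesting of the rule ([TIR_total_at]).

    From (2) to (3). The recursion defining the hierarchy is written as rewrite
    rules, with one symbol of arity [k + 2] for each multiple of omega^(1+k).
    Since numerals may shrink one by one, large values are long derivations
    ([trs_dh_lower]), and values of [Fmq k m q] are found by a search bounded
    by derivation lengths ([elementary_in_dh]).

    From (3) to (1). Terms are given values such that every reduction step
    under the path order lowers the value: a symbol is interpreted by iterating
    a bound for the smaller symbols along the lexicographic order of its
    arguments ([rewrites_value]). Values exceed codes of terms, and for closed
    terms they are bounded by [Fmq k m q] of the size for some [q]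
    ([lpo_measure]), so that the derivation complexity has a bounded definition
    by tables and is elementary in [Fmq k m q] ([elementary_dh]). This is (2),
    hence (1). *)

Set Implicit Arguments.
Unset Strict Implicit.
Unset Printing Implicit Defensive.

(** * Fast growing functions as iterated operators *)

(** If [G] is [F_b] then [jump d G] is [F_(b + omega^d)]; thus ordinals below
    omega^omega need never be handled as such. *)
Fixpoint jump (d : nat) (G : nat -> nat) (x : nat) : nat :=
  if d is d'.+1 then iter x.+1 (jump d') G x else iter x.+1 G x.

Definition jumps (a : cnf) (G : nat -> nat) : nat -> nat :=
  foldl (fun H d => jump d H) G a.

Lemma jumps_rcons a d G : jumps (rcons a d) G = jump d (jumps a G).
Proof. by rewrite /jumps foldl_rcons. Qed.

Lemma jumps_nseq c d G : jumps (nseq c d) G = iter c (jump d) G.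
Proof. by elim: c G => //= c IHc G; rewrite IHc -iterSr. Qed.

Lemma jumps_cat a b G : jumps (a ++ b) G = jumps b (jumps a G).
Proof. by rewrite /jumps foldl_cat. Qed.

Lemma fast_growing_jump d b :
  fast_growing b (jumps b succn) ->
  fast_growing (rcons b d) (jumps (rcons b d) succn).
Proof.
elim: d b => [|d IHd] b Hb; rewrite jumps_rcons; first exact: fast_succ.
apply: (@fast_lim b d (fun x => iter x.+1 (jump d) (jumps b succn))) => x.
rewrite -jumps_nseq -jumps_cat; elim: x.+1 => [|c IHc]; first by rewrite cats0.
by rewrite -[c.+1]addn1 nseqD catA cats1; apply: IHd.
Qed.

Lemma fast_growing_jumps a : fast_growing a (jumps a succn).
Proof.
elim/last_ind: a => [|a d IHa]; first exact: fast_zero.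
exact: fast_growing_jump.
Qed.

Lemma fast_growing_uniq a G : fast_growing a G -> G =1 jumps a succn.
Proof.
elim=> {a G} [//|a G _ IHG x|b d G _ IHG x].
  rewrite jumps_rcons /=; by rewrite (functional_extensionality _ _ IHG).
by rewrite IHG jumps_rcons jumps_cat jumps_nseq.
Qed.

(** On these functions the operators [jump d] are monotone and increase
    values. *)
Definition nice (G : nat -> nat) : Prop :=
  (forall x, x < G x) /\ {homo G : x y / x <= y}.

Lemma nice_succ : nice succn.
Proof. by split=> // x y; rewrite ltnS. Qed.

Lemma nice_ge G x : nice G -> x <= G x.
Proof. by case=> HG _; apply: ltnW. Qed.

Lemma iter_ge G n x : nice G -> x <= iter n G x.
Proof.
move=> HG; elim: n => //= n IHn; exact: leq_trans IHn (nice_ge _ HG).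
Qed.

Lemma iter_ge_add G n x : nice G -> x + n <= iter n G x.
Proof.
move=> HG; elim: n => [|n IHn]; first by rewrite addn0.
by rewrite addnS /=; apply: leq_ltn_trans IHn (HG.1 _).
Qed.

Lemma iter_homo G n : nice G -> {homo iter n G : x y / x <= y}.
Proof. by move=> HG x y le_xy; elim: n => //= n; apply: HG.2. Qed.

Lemma iter_leq G n p x : nice G -> n <= p -> iter n G x <= iter p G x.
Proof. by move=> HG /subnKC <-; rewrite addnC iterD; apply: iter_ge. Qed.

Lemma iter_le G H n x y :
  nice H -> (forall z, G z <= H z) -> x <= y -> iter n G x <= iter n H y.
Proof.
move=> HH le_GH le_xy; elim: n => //= n IHn.
exact: leq_trans (le_GH _) (HH.2 _ _ IHn).
Qed.

(** The three facts are proved together, since each needs the others for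
    smaller [d]. *)
Lemma jump_facts d :
  [/\ forall G, nice G -> nice (jump d G),
      forall G x, nice G -> G x <= jump d G x
    & forall G H, nice G -> nice H -> (forall x, G x <= H x) ->
        forall x, jump d G x <= jump d H x].
Proof.
elim: d => [|d [IHn IHg IHm]].
  split=> [G HG|G x HG|G H HG HH le x].
  - split=> [x|x y le_xy] /=; first exact: leq_ltn_trans (iter_ge _ _ HG) (HG.1 _).
    apply: leq_trans (iter_homo x.+1 HG le_xy) _.
    exact: (@iter_leq G x.+1 y.+1).
  - exact: (@iter_leq G 1 x.+1).
  - exact: (@iter_le G H x.+1).
have itn G n : nice G -> nice (iter n (jump d) G) by move=> HG; elim: n => //= n; apply: IHn.
have itl G n p x : nice G -> n <= p -> iter n (jump d) G x <= iter p (jump d) G x.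
  move=> HG; elim: p => [|p IHp]; first by case: n.
  rewrite leq_eqVlt => /orP[/eqP -> //|/IHp]; move/leq_trans; apply=> /=.
  exact: IHg (itn _ _ HG).
have itm G H n : nice G -> nice H -> (forall x, G x <= H x) ->
    forall x, iter n (jump d) G x <= iter n (jump d) H x.
  by move=> HG HH le; elim: n => //= n IHit; apply: IHm => //; apply: itn.
split=> [G HG|G x HG|G H HG HH le x].
- split=> [x|x y le_xy]; first exact: (itn _ x.+1 HG).1.
  apply: leq_trans (itl _ _ _ y HG (le_xy : x.+1 <= y.+1)).
  exact: (itn _ x.+1 HG).2.
- exact: (itl G 0 x.+1).
- exact: (itm G H x.+1).
Qed.

Lemma nice_jump d G : nice G -> nice (jump d G).
Proof. by case: (jump_facts d) => H _ _; apply: H. Qed.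

Lemma jump_ge d G x : nice G -> G x <= jump d G x.
Proof. by case: (jump_facts d) => _ H _; apply: H. Qed.

Lemma jump_mono d G H : nice G -> nice H -> (forall x, G x <= H x) ->
  forall x, jump d G x <= jump d H x.
Proof. by case: (jump_facts d) => _ _; apply. Qed.

Lemma nice_iter_jump n d G : nice G -> nice (iter n (jump d) G).
Proof. by move=> HG; elim: n => //= n; apply: nice_jump. Qed.

Lemma iter_jump_leq n p d G x :
  nice G -> n <= p -> iter n (jump d) G x <= iter p (jump d) G x.
Proof.
move=> HG; elim: p => [|p IHp]; first by case: n.
rewrite leq_eqVlt => /orP[/eqP -> //|/IHp]; move/leq_trans; apply=> /=.
exact/jump_ge/nice_iter_jump.
Qed.

Lemma iter_jump_mono n d G H : nice G -> nice H -> (forall x, G x <= H x) ->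
  forall x, iter n (jump d) G x <= iter n (jump d) H x.
Proof.
move=> HG HH le; elim: n => //= n IHn.
by apply: jump_mono => //; apply: nice_iter_jump.
Qed.

Arguments jump : simpl never.

(** [vjump xs G] is [F_(b + o(xs))] for [G = F_b], where the vector
    [xs = (x_1, ..., x_d)] stands for
    o(xs) = omega^(d-1) * x_1 + ... + omega^0 * x_d. *)
Fixpoint vjump (xs : seq nat) (G : nat -> nat) : nat -> nat :=
  if xs is x :: xs' then vjump xs' (iter x (jump (size xs')) G) else G.

Lemma nice_vjump xs G : nice G -> nice (vjump xs G).
Proof. by elim: xs G => //= x xs IHxs G HG; apply/IHxs/nice_iter_jump. Qed.

Lemma vjump_ge xs G x : nice G -> G x <= vjump xs G x.
Proof.
elim: xs G => //= y xs IHxs G HG.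
apply: leq_trans (IHxs _ (nice_iter_jump _ _ HG)).
exact: (@iter_jump_leq 0 y).
Qed.

Lemma vjump_nseq0 d G : vjump (nseq d 0) G = G.
Proof. by elim: d. Qed.

Lemma vjump_rcons xs x G :
  vjump (rcons xs x) G = iter x (jump 0) (vjump (rcons xs 0) G).
Proof. by elim: xs G => //= y xs IHxs G; rewrite IHxs !size_rcons. Qed.

(** An ordinal below omega^d with coefficients at most [n] lies below the
    [n]-th term of the fundamental sequence of omega^d. *)
Lemma vjump_le_jump xs G n :
  nice G -> all (leq^~ n) xs -> vjump xs G n <= jump (size xs) G n.
Proof.
elim: xs G => [|x xs IHxs] G HG /=; first by move=> _; apply: (jump_ge 0).
case/andP=> le_xn Hxs; apply: leq_trans (IHxs _ (nice_iter_jump _ _ HG) Hxs) _.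
by rewrite -iterS -[jump _ _ _]/(iter n.+1 (jump (size xs)) G n) iter_jump_leq.
Qed.

Fixpoint lexlt (ys xs : seq nat) : bool :=
  match ys, xs with
  | y :: ys', x :: xs' => (y < x) || (y == x) && lexlt ys' xs'
  | _, _ => false
  end.

(** The function F_a need not be monotone in [a], but it is at arguments that
    bound the coefficients of the smaller ordinal: by [vjump_le_jump] the part
    after the first difference is then absorbed. *)
Lemma vjump_lexlt ys xs G n :
  nice G -> size ys = size xs -> all (leq^~ n) ys -> lexlt ys xs ->
  vjump ys G n <= vjump xs G n.
Proof.
elim: ys xs G => [|y ys IHys] [|x xs] G HG //= [eq_s] /andP[le_yn Hys].
case/orP=> [lt_yx|/andP[/eqP <- lt_ys]]; last first.
  by rewrite eq_s; apply: IHys => //; apply: nice_iter_jump.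
apply: leq_trans (vjump_le_jump (nice_iter_jump _ _ HG) Hys) _.
rewrite -iterS eq_s; apply: leq_trans (vjump_ge _ _ (nice_iter_jump _ _ HG)).
exact: iter_jump_leq.
Qed.

Lemma lexlt_wf d (P : seq nat -> Prop) :
  (forall xs, size xs = d -> (forall ys, size ys = d -> lexlt ys xs -> P ys) -> P xs) ->
  forall xs, size xs = d -> P xs.
Proof.
elim: d P => [|d IHd] P HP xs.
  by move=> Hs; apply: HP => // ys; case: ys xs Hs => // -[].
case: xs => // x xs [Hs]; elim/ltn_ind: x xs Hs => x IHx xs Hs.
apply: (IHd (fun xs => P (x :: xs))) Hs => {}xs Hs IHxs; apply: HP => /=.
  by rewrite Hs.
case=> // y ys [Hys] /orP[lt_yx|/andP[/eqP -> lt]]; first exact: IHx.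
exact: IHxs.
Qed.

(** The function F_(omega^(1+k) * m + q). *)
Definition Fmq (k m q : nat) : nat -> nat :=
  iter q (jump 0) (iter m (jump k.+1) succn).

Lemma Fmq_jumps k m q : Fmq k m q = jumps (omega_pow_mul_add (1 + k) m q) succn.
Proof. by rewrite /omega_pow_mul_add jumps_cat !jumps_nseq. Qed.

Lemma nice_Fmq k m q : nice (Fmq k m q).
Proof. exact/nice_iter_jump/nice_iter_jump/nice_succ. Qed.

Lemma Fmq_leq k m m' q q' x : m <= m' -> q <= q' -> Fmq k m q x <= Fmq k m' q' x.
Proof.
move=> le_m le_q; apply: leq_trans (iter_jump_leq _ _ _ le_q); last first.
  exact/nice_iter_jump/nice_succ.
apply: iter_jump_mono => [||y]; try exact/nice_iter_jump/nice_succ.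
exact/iter_jump_leq/le_m/nice_succ.
Qed.

(** * Syntax and truth of arithmetical formulas *)

(** The definition of truth extends environments by a [match] on the index,
    which is convertible to [scons]. *)
Definition scons T (u : T) (e : nat -> T) : nat -> T :=
  fun x => if x is y.+1 then e y else u.

Fixpoint lcons T (us : seq T) (e : nat -> T) : nat -> T :=
  if us is u :: us' then scons u (lcons us' e) else e.

(** Nested quantifiers bind their variables in reverse order, so quantified
    tuples are taken apart at their last entry. *)
Lemma lcons_rcons T (us : seq T) u e : lcons (rcons us u) e = lcons us (scons u e).
Proof. by elim: us => //= v us ->. Qed.

Lemma lcons_cat T (us vs : seq T) e : lcons (us ++ vs) e = lcons us (lcons vs e).
Proof. by elim: us => //= v us ->. Qed.

Lemma lcons_nth T (x0 : T) us e x :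
  lcons us e x = if x < size us then nth x0 us x else e (x - size us).
Proof.
elim: us x => [|u us IHus] [|x] //=.
Qed.

Lemma scons_eta T (e : nat -> T) : scons (e 0) (fun x => e x.+1) = e.
Proof. by apply: functional_extensionality => -[]. Qed.

Lemma lcons_eta T (e : nat -> T) n : lcons (mkseq e n) (fun x => e (n + x)) = e.
Proof.
apply: functional_extensionality => x; rewrite (lcons_nth (e 0)) size_mkseq.
case: ltnP => [lt_xn|le_nx]; first by rewrite nth_mkseq.
by rewrite subnKC.
Qed.

Lemma eq_asubst s s' t : s =1 s' -> asubst s t = asubst s' t.
Proof. by move=> /functional_extensionality ->. Qed.

Lemma asubst_comp s s' t : asubst s (asubst s' t) = asubst (fun x => asubst s (s' x)) t.
Proof. by elim: t => //= [t ->|t -> u ->|t -> u ->]. Qed.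

Lemma asubst_id t : asubst AVar t = t.
Proof. by elim: t => //= [t ->|t -> u ->|t -> u ->]. Qed.

Lemma up_comp s s' : up (fun x => asubst s (s' x)) = fun x => asubst (up s) (up s' x).
Proof.
apply: functional_extensionality => -[|x] //=.
by rewrite /ashift !asubst_comp; apply: eq_asubst => y.
Qed.

Lemma up_id : up AVar = AVar.
Proof. by apply: functional_extensionality => -[]. Qed.

Lemma fsubst_comp s s' A : fsubst s (fsubst s' A) = fsubst (fun x => asubst s (s' x)) A.
Proof.
elim: A s s' => //= [t u|t u|A IHA B IHB|A IHA] s s'; rewrite ?asubst_comp //.
  by rewrite IHA IHB.
by rewrite IHA up_comp.
Qed.

Lemma fsubst_id A : fsubst AVar A = A.
Proof.
elim: A => //= [t u|t u|A -> B -> //|A IHA]; rewrite ?asubst_id //.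
by rewrite up_id IHA.
Qed.

Lemma aeval_subst e s t : aeval e (asubst s t) = aeval (fun x => aeval e (s x)) t.
Proof. by elim: t => //= [t ->|t -> u ->|t -> u ->]. Qed.

Lemma aeval_up e a s :
  (fun x => aeval (scons a e) (up s x)) = scons a (fun x => aeval e (s x)).
Proof. by apply: functional_extensionality => -[|x] //=; rewrite /ashift aeval_subst. Qed.

Lemma sat_subst e s A : sat e (fsubst s A) <-> sat (fun x => aeval e (s x)) A.
Proof.
elim: A e s => //= [t u|t u|A IHA B IHB|A IHA] e s; rewrite ?aeval_subst //.
  by rewrite IHA IHB.
split=> H a; move: (H a); rewrite -/(scons a e) -/(scons a (fun x => aeval e (s x)));
  by rewrite IHA aeval_up.
Qed.

Lemma abounded_leq n p t : n <= p -> abounded n t -> abounded p t.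
Proof.
move=> le; elim: t => //= [x|t IHt u IHu|t IHt u IHu].
- by move/leq_trans; apply.
- by case/andP=> /IHt -> /IHu.
- by case/andP=> /IHt -> /IHu.
Qed.

Lemma fbounded_leq n p A : n <= p -> fbounded n A -> fbounded p A.
Proof.
elim: A n p => //= [t u|t u|A IHA B IHB|A IHA] n p le.
- by case/andP=> /(abounded_leq le) -> /(abounded_leq le).
- by case/andP=> /(abounded_leq le) -> /(abounded_leq le).
- by case/andP=> /IHA -> // /IHB ->.
- exact: IHA.
Qed.

Lemma abounded_exists t : exists n, abounded n t.
Proof.
elim: t => /= [x||//|t [n Hn] u [p Hp]|t [n Hn] u [p Hp]]; first by exists x.+1.
- by exists 0.
- exists (maxn n p); rewrite (abounded_leq _ Hn) ?leq_maxl //.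
  exact: abounded_leq (leq_maxr _ _) Hp.
- exists (maxn n p); rewrite (abounded_leq _ Hn) ?leq_maxl //.
  exact: abounded_leq (leq_maxr _ _) Hp.
Qed.

Lemma fbounded_exists A : exists n, fbounded n A.
Proof.
elim: A => /= [t u|t u||A [n Hn] B [p Hp]|A [n Hn]].
- have [[n Hn] [p Hp]] := (abounded_exists t, abounded_exists u).
  exists (maxn n p); rewrite (abounded_leq _ Hn) ?leq_maxl //.
  exact: abounded_leq (leq_maxr _ _) Hp.
- have [[n Hn] [p Hp]] := (abounded_exists t, abounded_exists u).
  exists (maxn n p); rewrite (abounded_leq _ Hn) ?leq_maxl //.
  exact: abounded_leq (leq_maxr _ _) Hp.
- by exists 0.
- exists (maxn n p); rewrite (fbounded_leq _ Hn) ?leq_maxl //.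
  exact: fbounded_leq (leq_maxr _ _) Hp.
- by exists n; apply: fbounded_leq Hn.
Qed.

Lemma asubst_bounded n s s' t :
  abounded n t -> (forall x, x < n -> s x = s' x) -> asubst s t = asubst s' t.
Proof.
move=> Hb eq_s; elim: t Hb => //= [t IHt Ht|t IHt u IHu|t IHt u IHu].
- by rewrite IHt.
- by case/andP=> /IHt -> /IHu ->.
- by case/andP=> /IHt -> /IHu ->.
Qed.

Lemma fsubst_bounded n s s' A :
  fbounded n A -> (forall x, x < n -> s x = s' x) -> fsubst s A = fsubst s' A.
Proof.
elim: A n s s' => //= [t u|t u|A IHA B IHB|A IHA] n s s'.
- by case/andP=> Ht Hu eq; rewrite !(asubst_bounded _ eq).
- by case/andP=> Ht Hu eq; rewrite !(asubst_bounded _ eq).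
- by case/andP=> HA HB eq; rewrite (IHA _ _ _ HA eq) (IHB _ _ _ HB eq).
- move=> HA eq; congr All; apply: (IHA _ _ _ HA) => -[|x] //= lt_xn.
  by rewrite eq.
Qed.

Lemma aeval_bounded n e e' t :
  abounded n t -> (forall x, x < n -> e x = e' x) -> aeval e t = aeval e' t.
Proof.
move=> Hb eq_e; elim: t Hb => //= [t IHt Ht|t IHt u IHu|t IHt u IHu].
- by rewrite IHt.
- by case/andP=> /IHt -> /IHu ->.
- by case/andP=> /IHt -> /IHu ->.
Qed.

Lemma sat_bounded n e e' A :
  fbounded n A -> (forall x, x < n -> e x = e' x) -> sat e A <-> sat e' A.
Proof.
elim: A n e e' => //= [t u|t u|A IHA B IHB|A IHA] n e e'.
- by case/andP=> Ht Hu eq; rewrite !(aeval_bounded _ eq).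
- by case/andP=> Ht Hu eq; rewrite !(aeval_bounded _ eq).
- by case/andP=> HA HB eq; rewrite (IHA _ _ _ HA eq) (IHB _ _ _ HB eq).
- move=> HA eq; split=> H a; move: (H a).
    by rewrite (IHA n.+1 _ (scons a e') HA) // => -[|x] //=; apply: eq.
  by rewrite (IHA n.+1 (scons a e) (scons a e') HA) // => -[|x] //=; apply: eq.
Qed.

Lemma Delta0_subst s A : Delta0 A -> Delta0 (fsubst s A).
Proof.
move=> HA; elim: HA s => {A} /= [t u|t u||A B _ IHA _ IHB|t A _ IHA] s;
  try by constructor.
have -> : asubst (up s) (ashift t) = ashift (asubst s t).
  by rewrite /ashift !asubst_comp; apply: eq_asubst.
exact/Delta0_ball/IHA.
Qed.

Definition Exs (n : nat) (A : formula) : formula := iter n Ex A.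

Lemma Sigma1_shape A : Sigma1 A -> exists l, exists2 B, A = Exs l B & Delta0 B.
Proof.
elim=> {A} [A HA|A _ [l [B -> HB]]]; first by exists 0, A.
by exists l.+1, B.
Qed.

Lemma Sigma1_Exs l A : Delta0 A -> Sigma1 (Exs l A).
Proof. by move=> HA; elim: l => [|l IHl]; constructor. Qed.

Lemma Pi2_shape A : Pi2 A -> exists j, exists2 B, A = Alls j B & Sigma1 B.
Proof.
elim=> {A} [A HA|A _ [j [B -> HB]]]; first by exists 0, A.
by exists j.+1, B.
Qed.

Lemma sat_Ex e A : sat e (Ex A) <-> exists a, sat (scons a e) A.
Proof.
split=> [/= H|[a Ha] /= H]; last exact: (H a Ha).
by apply: NNPP => H'; apply: H => a Ha; apply: H'; exists a.
Qed.

Lemma sat_Exs e l A :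
  sat e (Exs l A) <-> exists2 ys, size ys = l & sat (lcons ys e) A.
Proof.
elim: l e => [|l IHl] e.
  by split=> [H|[ys /size0nil -> //]]; exists [::].
rewrite [Exs _ _]/(Ex (Exs l A)) sat_Ex; split=> [[a /IHl [ys <- H]]|[ys]].
  by exists (rcons ys a); rewrite ?size_rcons ?lcons_rcons.
case/lastP: ys => [//|ys a]; rewrite size_rcons lcons_rcons => -[Hs] H.
by exists a; apply/IHl; exists ys.
Qed.

Lemma sat_Alls e l A :
  sat e (Alls l A) <-> forall ys, size ys = l -> sat (lcons ys e) A.
Proof.
elim: l e => [|l IHl] e.
  by split=> [H ys /size0nil -> //|H]; apply: (H [::]).
rewrite -[Alls l.+1 A]/(All (Alls l A)) /=; split=> [H ys|H a].
  case/lastP: ys => [//|ys a]; rewrite size_rcons lcons_rcons => -[Hs].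
  by move: (H a); rewrite IHl; apply.
apply/IHl => ys Hs; rewrite -/(scons a e) -lcons_rcons.
by apply: H; rewrite size_rcons Hs.
Qed.

Lemma sat_Or e A B : sat e (Or A B) <-> sat e A \/ sat e B.
Proof.
split=> [/= H|[HA /= /(_ HA) //|HB] //].
by case: (classic (sat e A)) => HA; [left|right; apply: H].
Qed.

Lemma sat_And e A B : sat e (And A B) <-> sat e A /\ sat e B.
Proof.
split=> [/= H|[HA HB] /= /(_ HA HB) //].
by apply: NNPP => H'; apply: H => HA HB; apply: H'.
Qed.

Lemma Delta0_Or A B : Delta0 A -> Delta0 B -> Delta0 (Or A B).
Proof. by move=> HA HB; do !constructor. Qed.

Lemma Delta0_And A B : Delta0 A -> Delta0 B -> Delta0 (And A B).
Proof. by move=> HA HB; do !constructor. Qed.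

Lemma Delta0_lex_lt K i n : Delta0 (lex_lt K i n).
Proof.
elim: n i => [|n IHn] i /=; first by constructor.
by apply: Delta0_Or; [constructor|apply: Delta0_And; first by constructor].
Qed.

Lemma sat_lex_lt e K i n :
  sat e (lex_lt K i n) <->
  lexlt (mkseq (fun j => e (i + j)) n) (mkseq (fun j => e (K + (i + j))) n).
Proof.
elim: n i => [|n IHn] i //.
rewrite [lex_lt _ _ _]/(Or _ (And _ _)) sat_Or sat_And IHn.
rewrite /mkseq [iota 0 n.+1]/= -[1]addn0 iotaDl /= -!map_comp !addn0.
have eq_map (g : nat -> nat) : map (fun j => g (i.+1 + j)) (iota 0 n) =
    map ((fun j => g (i + j)) \o addn 1) (iota 0 n).
  by apply: eq_map => j /=; rewrite addnS.
rewrite (eq_map e) (eq_map (fun j => e (K + j))).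
split=> [[->//|[-> ->]]|/orP[->|/andP[/eqP -> ->]]]; rewrite ?eqxx ?orbT //.
  by left.
by right.
Qed.

(** * Forcing with families of large intervals *)

Definition ev (X : nat -> Prop) (P : nat -> Prop) : Prop :=
  exists N, forall i, N <= i -> X i -> P i.

Definition unbounded (X : nat -> Prop) : Prop := forall N, exists2 i, N <= i & X i.

Lemma ev_all (X P : nat -> Prop) : (forall i, X i -> P i) -> ev X P.
Proof. by move=> H; exists 0 => i _ /H. Qed.

Lemma ev_imp (X P Q : nat -> Prop) :
  (forall i, X i -> P i -> Q i) -> ev X P -> ev X Q.
Proof. by move=> H [N HN]; exists N => i /HN h Xi; apply: H (h Xi). Qed.

Lemma ev_and (X P Q : nat -> Prop) : ev X P -> ev X Q -> ev X (fun i => P i /\ Q i).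
Proof.
move=> [N HN] [M HM]; exists (maxn N M) => i; rewrite geq_max => /andP[/HN h1 /HM h2] Xi.
by split; [apply: h1|apply: h2].
Qed.

Lemma ev_sub (X Y P : nat -> Prop) : (forall i, Y i -> X i) -> ev X P -> ev Y P.
Proof. by move=> H [N HN]; exists N => i /HN h /H. Qed.

Lemma ev_ge (X : nat -> Prop) n : ev X (fun i => n <= i).
Proof. by exists n. Qed.

Lemma not_ev (X P : nat -> Prop) : ~ ev X P -> unbounded (fun i => X i /\ ~ P i).
Proof.
move=> H N; apply: NNPP => H'; apply: H; exists N => i le_Ni Xi.
by apply: NNPP => HP; apply: H'; exists i.
Qed.

Lemma ev_unbounded (X P : nat -> Prop) : ev X P -> unbounded X -> exists2 i, X i & P i.
Proof. by move=> [N HN] /(_ N) [i /HN h Xi]; exists i; last exact: h. Qed.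

Section Forcing.

Variables (G : nat -> nat -> nat) (nG : forall i, nice (G i)).

Let L q i := iter q (jump 0) (G i).

Let nL q i : nice (L q i).
Proof. exact: nice_iter_jump. Qed.

Lemma iter_jump_comp H p q r x : nice H -> 0 < x -> p < r -> q < r ->
  iter p (jump 0) H (iter q (jump 0) H x) <= iter r (jump 0) H x.
Proof.
move=> nH x_gt0 lt_pr lt_qr; have nI s : nice (iter s (jump 0) H) by apply: nice_iter_jump.
case: r lt_pr lt_qr => // r le_pr le_qr.
have step : iter 2 (iter r (jump 0) H) x <= iter r.+1 (jump 0) H x.
  exact: (@iter_leq _ 2 x.+1 x (nI r)).
apply: leq_trans step => /=.
apply: leq_trans ((nI p).2 _ _ (iter_jump_leq _ x nH (le_qr : q <= r))) _.
exact: iter_jump_leq.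
Qed.

Lemma iter_jump_mul H x y : nice H -> x * y <= iter 2 (jump 0) H (maxn x y).
Proof.
move=> nH; set m := maxn x y.
apply: (@leq_trans (m * m)); first by rewrite leq_mul ?leq_maxl ?leq_maxr.
suff H' n : n.+1 * m <= iter n (jump 0 H) m.
  by apply: leq_trans (H' m.+1); rewrite leq_mul // -addn2 leq_addr.
elim: n => [|n IHn]; first by rewrite mul1n.
rewrite mulSn [iter _ _ _]/=.
apply: leq_trans (iter_ge_add _ _ nH); rewrite addnC leq_add // ltnW // ltnS.
exact: iter_ge (nice_jump 0 nH).
Qed.

(** A condition lists, for the indices in [dom], intervals that are large for
    every finite iterate of the base functions; what is forced is the truth in
    a generic initial segment of a non-standard model that separates [lo] from
    [hi]. No such model has to be built. *)
Record cond := Cond {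
  dom : nat -> Prop;
  lo : nat -> nat;
  hi : nat -> nat;
  dom_unbounded : unbounded dom;
  lo_gt0 : forall i, dom i -> 0 < lo i;
  cond_large : forall q, ev dom (fun i => L q i (lo i) <= hi i) }.

Definition ext (q p : cond) : Prop :=
  (forall i, dom q i -> dom p i) /\
  ev (dom q) (fun i => lo p i <= lo q i /\ hi q i <= hi p i).

Lemma ext_refl p : ext p p.
Proof. by split=> //; apply: ev_all. Qed.

Lemma ext_trans q p r : ext r q -> ext q p -> ext r p.
Proof.
move=> [drq irq] [dqp iqp]; split=> [i /drq /dqp //|].
apply: ev_imp (ev_and irq (ev_sub drq iqp)) => i _ [[a b] [c d]].
by rewrite (leq_trans c) // (leq_trans b).
Qed.

(** A set of indices on which something fails infinitely often is the domain
    of a stronger condition; every counterexample below arises this way. *)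
Lemma restrict p (P : nat -> Prop) :
  unbounded (fun i => dom p i /\ P i) ->
  exists2 q, ext q p & (forall i, dom q i -> P i) /\ hi q = hi p.
Proof.
move=> Hu; pose X i := dom p i /\ P i.
have sX i : X i -> dom p i by case.
have l i : X i -> 0 < lo p i by move=> /sX /lo_gt0.
have c q : ev X (fun i => L q i (lo p i) <= hi p i) by apply: ev_sub sX (cond_large p q).
by exists (Cond Hu l c) => //; [split=> //; apply: ev_all|split=> // i []].
Qed.

(** The names for the elements of the initial segment: they stay below [hi],
    and they are closed under all finite iterates of the base functions. *)
Definition inJ p (u : nat -> nat) : Prop :=
  exists q, ev (dom p) (fun i => u i <= L q i (lo p i)).

Lemma inJ_ext q p u : ext q p -> inJ p u -> inJ q u.
Proof.
move=> [dqp iqp] [r Hr]; exists r; apply: ev_imp (ev_and iqp (ev_sub dqp Hr)).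
by move=> i _ [[le_l _] /leq_trans]; apply; apply: (nL r i).2.
Qed.

Lemma inJ_le p u v : ev (dom p) (fun i => u i <= v i) -> inJ p v -> inJ p u.
Proof.
move=> le [q Hq]; exists q; apply: ev_imp (ev_and le Hq) => i _ [].
exact: leq_trans.
Qed.

Lemma inJ_lo p : inJ p (lo p).
Proof. by exists 0; apply: ev_all => i _; apply: nice_ge. Qed.

Lemma inJ_const p c : inJ p (fun=> c).
Proof.
exists c; apply: ev_all => i di.
apply: leq_trans (_ : c <= G i (lo p i) + c) _; first exact: leq_addl.
rewrite /L; elim: c => [|c IHc]; first by rewrite addn0.
rewrite addnS; apply: leq_ltn_trans IHc _.
apply: leq_trans ((nL c i).1 _) _.
exact: iter_jump_comp (nG i) (lo_gt0 di) (ltnSn c) (ltnSn c).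
Qed.

Lemma inJ_iter p q u : inJ p u -> inJ p (fun i => L q i (u i)).
Proof.
move=> [r Hr]; exists (maxn q r).+1; apply: ev_imp Hr => i di le_u.
apply: leq_trans ((nL q i).2 _ _ le_u) _.
by apply: iter_jump_comp; rewrite ?(lo_gt0 di) ?ltnS ?leq_maxl ?leq_maxr.
Qed.

Lemma inJ_max p u v : inJ p u -> inJ p v -> inJ p (fun i => maxn (u i) (v i)).
Proof.
move=> [q Hq] [r Hr]; exists (maxn q r); apply: ev_imp (ev_and Hq Hr) => i _ [h1 h2].
rewrite geq_max (leq_trans h1) ?(leq_trans h2) //;
  by apply: iter_jump_leq; rewrite ?leq_maxl ?leq_maxr.
Qed.

Lemma inJ_succ p u : inJ p u -> inJ p (fun i => (u i).+1).
Proof. by move/(inJ_iter 0); apply: inJ_le; apply: ev_all => i _; apply: (nG i).1. Qed.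

Lemma inJ_mul p u v : inJ p u -> inJ p v -> inJ p (fun i => u i * v i).
Proof.
move=> Hu Hv; apply: inJ_le (inJ_iter 2 (inJ_max Hu Hv)).
by apply: ev_all => i _; apply: iter_jump_mul.
Qed.

Lemma inJ_add p u v : inJ p u -> inJ p v -> inJ p (fun i => u i + v i).
Proof.
move=> /inJ_succ Hu /inJ_succ Hv; apply: inJ_le (inJ_mul Hu Hv).
by apply: ev_all => i _; nia.
Qed.

Definition at_index (e : nat -> nat -> nat) (i : nat) : nat -> nat := fun x => e x i.

Lemma inJ_aeval p e t : (forall x, inJ p (e x)) -> inJ p (fun i => aeval (at_index e i) t).
Proof.
move=> He; elim: t => //= [|t|t IHt u IHu|t IHt u IHu].
- exact: inJ_const.
- exact: inJ_succ.
- exact: inJ_add.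
- exact: inJ_mul.
Qed.

Lemma inJ_scons p u (e : nat -> nat -> nat) :
  inJ p u -> (forall x, inJ p (e x)) -> forall x, inJ p (scons u e x).
Proof. by move=> Hu He [|x]; [apply: Hu|apply: He]. Qed.

Lemma at_index_scons u e i : at_index (scons u e) i = scons (u i) (at_index e i).
Proof. by apply: functional_extensionality => -[]. Qed.

Fixpoint forces (p : cond) (e : nat -> nat -> nat) (A : formula) : Prop :=
  match A with
  | Eq t u => ev (dom p) (fun i => aeval (at_index e i) t = aeval (at_index e i) u)
  | Lt t u => ev (dom p) (fun i => aeval (at_index e i) t < aeval (at_index e i) u)
  | Bot => False
  | Imp B C => forall q, ext q p -> forces q e B -> forces q e C
  | All B => forall q u, ext q p -> inJ q u -> forces q (scons u e) B
  end.

Lemma forces_ext q p e A : ext q p -> forces p e A -> forces q e A.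
Proof.
case: A => //= [t u|t u|B C|B] Hqp.
- by apply: ev_sub; case: Hqp.
- by apply: ev_sub; case: Hqp.
- by move=> H r Hrq; apply: H (ext_trans Hrq Hqp).
- by move=> H r u Hrq; apply: H (ext_trans Hrq Hqp).
Qed.

(** What is forced densely below [p] is forced by [p]; this validates double
    negation elimination. *)
Lemma forces_stable p e A :
  (forall q, ext q p -> exists2 r, ext r q & forces r e A) -> forces p e A.
Proof.
have atom (P : nat -> Prop) r :
    (forall q, ext q r -> exists2 s, ext s q & ev (dom s) P) -> ev (dom r) P.
  move=> H; apply: NNPP => /not_ev /restrict [q Hq [Hn _]].
  have [s Hs /ev_unbounded/(_ (dom_unbounded s)) [i di Pi]] := H _ Hq.
  by case: (Hn i) => //; apply: Hs.1.
elim: A p e => [t u|t u||B IHB C IHC|B IHB] p e H.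
- exact: atom.
- exact: atom.
- by have [r _ []] := H _ (ext_refl p).
- move=> q Hqp HB; apply: IHC => r Hrq.
  have [s Hsr HBC] := H _ (ext_trans Hrq Hqp); exists s => //.
  by apply: HBC (ext_refl s) _; apply: forces_ext HB; apply: ext_trans Hrq.
- move=> q u Hqp Hu; apply: IHB => r Hrq.
  have [s Hsr HB] := H _ (ext_trans Hrq Hqp); exists s => //.
  by apply: HB (ext_refl s) _; apply: inJ_ext Hu; apply: ext_trans Hrq.
Qed.

(** The contrapositive of [forces_stable]. *)
Lemma forces_not p e A : ~ forces p e A ->
  exists2 q, ext q p & forall r, ext r q -> ~ forces r e A.
Proof.
move=> H; apply: NNPP => H'; apply: H; apply: forces_stable => q Hq.
apply: NNPP => Hn; apply: H'; exists q => // r Hr HA; apply: Hn; by exists r.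
Qed.

Lemma ev_aeval p e e' t :
  (forall x, ev (dom p) (fun i => e x i = e' x i)) ->
  ev (dom p) (fun i => aeval (at_index e i) t = aeval (at_index e' i) t).
Proof.
move=> He; elim: t => //= [|t IHt|t IHt u IHu|t IHt u IHu].
- exact: ev_all.
- by apply: ev_imp IHt => i _ ->.
- by apply: ev_imp (ev_and IHt IHu) => i _ [-> ->].
- by apply: ev_imp (ev_and IHt IHu) => i _ [-> ->].
Qed.

Lemma forces_ev p e e' A : (forall x, ev (dom p) (fun i => e x i = e' x i)) ->
  forces p e A -> forces p e' A.
Proof.
elim: A p e e' => //= [t u|t u|B IHB C IHC|B IHB] p e e' He.
- move=> H; apply: ev_imp (ev_and H (ev_and (ev_aeval t He) (ev_aeval u He))).
  by move=> i _ [a [<- <-]].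
- move=> H; apply: ev_imp (ev_and H (ev_and (ev_aeval t He) (ev_aeval u He))).
  by move=> i _ [a [<- <-]].
- move=> H q Hq HB; have He' x := ev_sub Hq.1 (He x).
  apply: (IHC _ _ _ He'); apply: H (Hq) _; apply: IHB HB => x.
  by apply: ev_imp (He' x) => i _ ->.
- move=> H q u Hq Hu; apply: IHB (H q u Hq Hu) => -[|x] /=; first exact: ev_all.
  exact: ev_sub Hq.1 (He x).
Qed.

Definition names_subst (e : nat -> nat -> nat) (s : nat -> aterm) :=
  fun x i => aeval (at_index e i) (s x).

Lemma names_subst_up u e s : names_subst (scons u e) (up s) = scons u (names_subst e s).
Proof.
apply: functional_extensionality => -[|x] //=.
apply: functional_extensionality => i; rewrite /names_subst /= /ashift aeval_subst.
by congr aeval; apply: functional_extensionality.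
Qed.

Lemma forces_subst p e s A : forces p e (fsubst s A) <-> forces p (names_subst e s) A.
Proof.
elim: A p e s => //= [t u|t u|B IHB C IHC|B IHB] p e s.
- by split; apply: ev_imp => i _; rewrite !aeval_subst.
- by split; apply: ev_imp => i _; rewrite !aeval_subst.
- by split=> H q Hq /IHB HB; apply/IHC/H.
- split=> H q u Hq Hu; move: (H q u Hq Hu); rewrite IHB names_subst_up //.
Qed.

Lemma forces_inst p e t A : (forall x, inJ p (e x)) ->
  forces p e (finst t A) <-> forces p (scons (fun i => aeval (at_index e i) t) e) A.
Proof.
move=> He; rewrite /finst forces_subst.
by have -> // : names_subst e (fun x => if x is y.+1 then AVar y else t) =
  scons (fun i => aeval (at_index e i) t) e by apply: functional_extensionality => -[].
Qed.

Lemma forces_shift p u e A : forces p (scons u e) (fshift A) <-> forces p e A.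
Proof. exact: forces_subst. Qed.

Definition forced (A : formula) : Prop :=
  forall p e, (forall x, inJ p (e x)) -> forces p e A.

(** Forcing is a Kripke semantics, hence sound for intuitionistic logic, and
    by [forces_stable] sound for classical logic. *)
Lemma forced_derives C B : (forall A, C A -> forced A) -> derives C B -> forced B.
Proof.
move=> HC; elim=> {B} [A /HC //|A B _ IHAB _ IHA|A _ IHA|A B|A B D|A|A t|A B|t|A t u] p e He.
- exact: IHAB He _ (ext_refl p) (IHA _ _ He).
- by move=> q u Hq Hu; apply: IHA; apply: inJ_scons => // x; apply: inJ_ext (He x).
- by move=> q _ HA r Hr _; apply: forces_ext HA.
- move=> q _ H r Hr H' s Hs HA.
  exact: H (ext_trans Hs Hr) HA _ (ext_refl s) (H' _ Hs HA).
- move=> q Hq HA; apply: forces_stable => r Hr; apply: NNPP => Hn.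
  by apply: (HA r Hr) => s Hs Hf; apply: Hn; exists s.
- move=> q Hq HA; have He' x := inJ_ext Hq (He x).
  by apply/forces_inst => //; apply: HA (ext_refl q) _; apply: inJ_aeval.
- move=> q Hq H r Hr HA s u Hs Hu.
  apply: (H s u (ext_trans Hs Hr) Hu s (ext_refl s)).
  by apply/forces_shift; apply: forces_ext HA.
- exact: ev_all.
- move=> /= q Hq Htu r Hr; have He' x := inJ_ext (ext_trans Hr Hq) (He x).
  rewrite !forces_inst //; apply: forces_ev => -[|x] /=; last exact: ev_all.
  exact: ev_sub Hr.1 Htu.
Qed.

(** ** Bounded formulas are absolute *)

(** If a bounded formula fails at infinitely many indices, restricting the
    condition to these, with the failing witnesses as names, refutes it. *)
Lemma forces_Delta0 A p e : Delta0 A -> (forall x, inJ p (e x)) ->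
  forces p e A <-> ev (dom p) (fun i => sat (at_index e i) A).
Proof.
move=> HA; elim: HA p e => {A} [t u|t u||A B _ IHA _ IHB|t A _ IHA] p e He //=.
- by split=> // /ev_unbounded/(_ (dom_unbounded p)) [].
- split=> [H|H q Hq].
    apply: NNPP => /not_ev /restrict [q Hq [Hn _]].
    have He' x := inJ_ext Hq (He x).
    have HAf : forces q e A.
      apply/IHA => //; apply: ev_all => i /Hn Hs; apply: NNPP => H'.
      by apply: Hs => /H'.
    have /IHB [//|N HN] := H q Hq HAf.
    have [i le_Ni di] := dom_unbounded q N.
    by apply: (Hn i di) => _; apply: HN.
  have He' x := inJ_ext Hq (He x).
  rewrite IHA // IHB // => Hev; apply: ev_imp (ev_and (ev_sub Hq.1 H) Hev).
  by move=> i _ [h /h].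
- split=> [H|H q u Hq Hu r Hr].
    apply: NNPP => /not_ev /restrict [q Hq [Hn _]].
    have Hw i : exists a, dom q i ->
        a < aeval (at_index e i) t /\ ~ sat (scons a (at_index e i)) A.
      case: (classic (dom q i)) => [di|]; last by exists 0.
      apply: NNPP => H'; apply: (Hn i di) => a; rewrite /ashift aeval_subst /= => Ha.
      by apply: NNPP => Hs; apply: H'; exists a => _.
    pose u i := sval (constructive_indefinite_description _ (Hw i)).
    have Hu i : dom q i -> _ := svalP (constructive_indefinite_description _ (Hw i)).
    have Ju : inJ q u.
      apply: inJ_le (inJ_aeval t (fun x => inJ_ext Hq (He x))).
      by apply: ev_all => i /Hu [/ltnW].
    have Hev : ev (dom q) (fun i => sat (at_index (scons u e) i) A).
      apply/(IHA q (scons u e)); first by apply: inJ_scons => // x; apply: inJ_ext (He x).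
      apply: (H q u Hq Ju q (ext_refl q)); apply: ev_all => i /Hu [Hlt _].
      rewrite at_index_scons /ashift aeval_subst /=; exact: Hlt.
    have [i di] := ev_unbounded Hev (dom_unbounded q).
    by rewrite at_index_scons; case: (Hu i di).
  move=> Hlt; apply/IHA.
    by apply: inJ_scons => [|x]; [apply: inJ_ext Hu|apply: inJ_ext (ext_trans Hr Hq) (He x)].
  apply: ev_imp (ev_and (ev_sub (ext_trans Hr Hq).1 H) Hlt) => i _ [Hs].
  rewrite at_index_scons; exact: Hs.
Qed.

Lemma forces_Ex_intro p e A u : inJ p u -> forces p (scons u e) A -> forces p e (Ex A).
Proof.
move=> Hu HA q Hq Hn; apply: (Hn q u (ext_refl q) (inJ_ext Hq Hu) q (ext_refl q)).
exact: forces_ext HA.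
Qed.

Lemma forces_Ex_elim p e A : forces p e (Ex A) ->
  exists r u, [/\ ext r p, inJ r u & forces r (scons u e) A].
Proof.
move=> H; apply: NNPP => Hn; apply: (H p (ext_refl p)) => q u Hq Hu r Hr HA.
by apply: Hn; exists r, u; split=> //; [apply: ext_trans Hr Hq|apply: inJ_ext Hu].
Qed.

Definition witness (l c : nat) (e : nat -> nat) (B : formula) : Prop :=
  exists ys, [/\ size ys = l, all (leq^~ c) ys & sat (lcons ys e) B].

Lemma witness_leq l c c' e B : c <= c' -> witness l c e B -> witness l c' e B.
Proof.
move=> le [ys [Hs Ha HB]]; exists ys; split=> //; apply: sub_all Ha => y /=.
by move/leq_trans; apply.
Qed.

(** Names lie below the upper ends of their condition, so the witnesses of a
    forced existential statement do as well: otherwise restrict to the indices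
    where this fails. *)
Lemma forces_Exs_elim l B p e : Delta0 B -> (forall x, inJ p (e x)) ->
  forces p e (Exs l B) -> ev (dom p) (fun i => witness l (hi p i) (at_index e i) B).
Proof.
move=> HB; elim: l p e => [|l IHl] p e He.
  move/forces_Delta0 => H; apply: ev_imp (H HB He) => i _ Hs.
  by exists [::].
move=> H; apply: NNPP => /not_ev /restrict [q Hq [Hn Hhi]].
have /forces_Ex_elim [r [u [Hr Hu HrB]]] : forces q e (Exs l.+1 B) by apply: forces_ext H.
have He' x : inJ r (e x) by apply: inJ_ext (He x); apply: ext_trans Hr Hq.
have := IHl r _ (inJ_scons Hu He') HrB; case: Hu => s Hus Hev.
have [] := ev_unbounded (ev_and Hev (ev_and Hus (ev_and (cond_large r s) Hr.2)))
  (dom_unbounded r).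
move=> i di [[ys [Hsz Ha Hs]] [le1 [le2 [_ le3]]]]; apply: (Hn i (Hr.1 _ di)).
have le_hi : hi r i <= hi p i by rewrite -Hhi.
exists (rcons ys (u i)); split; rewrite ?size_rcons ?Hsz ?lcons_rcons -?at_index_scons //.
rewrite all_rcons (leq_trans le1 (leq_trans le2 le_hi)) /=.
by apply: sub_all Ha => y /= /leq_trans; apply.
Qed.

Lemma forces_Exs_intro l B p e w : Delta0 B -> (forall x, inJ p (e x)) -> inJ p w ->
  ev (dom p) (fun i => witness l (w i) (at_index e i) B) -> forces p e (Exs l B).
Proof.
move=> HB; elim: l p e => [|l IHl] p e He Hw Hev.
  by apply/forces_Delta0 => //; apply: ev_imp Hev => i _ [ys [/size0nil ->]].
have Hex i : exists a, witness l.+1 (w i) (at_index e i) B ->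
    a <= w i /\ witness l (w i) (scons a (at_index e i)) B.
  case: (classic (witness l.+1 (w i) (at_index e i) B)) => [|Hn]; last by exists 0.
  move=> [ys]; case/lastP: ys => [[]//|ys a]; rewrite size_rcons all_rcons lcons_rcons.
  by case=> -[Hs] /andP[Ha Hys] H; exists a; split=> //; exists ys.
pose u i := sval (constructive_indefinite_description _ (Hex i)).
have Hu i : _ -> _ := svalP (constructive_indefinite_description _ (Hex i)).
have Ju : inJ p u by apply: inJ_le Hw; apply: ev_imp Hev => i _ /Hu [].
apply: (forces_Ex_intro Ju); apply: IHl => //; first exact: inJ_scons.
by apply: ev_imp Hev => i _ /Hu [_]; rewrite at_index_scons.
Qed.

Lemma forced_Pi1 A : Pi1 A -> (forall e, sat e A) -> forced A.
Proof.
elim=> {A} [A HA|A _ IHA] Hs p e He; first by apply/forces_Delta0 => //; apply: ev_all.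
move=> q u Hq Hu; apply: IHA => [e'|x].
  by have := Hs (fun x => e' x.+1) (e' 0); rewrite -/(scons _ _) scons_eta.
by case: x => [|x] //=; apply: inJ_ext (He x).
Qed.
End Forcing.

(** * The theorems of the formal systems are forced *)

(** The pigeonhole principle: each of the [u + 1] statements gets its first
    witness in at most one of the [u + 2] intervals. *)
Lemma quiet_interval (P : nat -> nat -> Prop) (c : nat -> nat) u :
  {homo c : i j / i <= j} ->
  (forall x y v, x <= y -> P x v -> P y v) ->
  exists2 j, j <= u.+1 & forall v, v <= u -> P (c j.+1) v -> P (c j) v.
Proof.
move=> c_mono P_mono; apply: NNPP => Hn.
have Hv (j : 'I_u.+2) : exists v : 'I_u.+1, P (c j.+1) v /\ ~ P (c j) v.
  apply: NNPP => Hv; apply: Hn; exists j; first by rewrite -ltnS ltn_ord.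
  move=> v le_vu HP; apply: NNPP => HP'; apply: Hv.
  by exists (Ordinal (le_vu : v < u.+1)).
pose f j := sval (constructive_indefinite_description _ (Hv j)).
have Hf (j : 'I_u.+2) : P (c j.+1) (f j) /\ ~ P (c j) (f j).
  exact: svalP (constructive_indefinite_description _ (Hv j)).
suff: injective f by move/leq_card; rewrite !card_ord ltnn.
have neq (i j : 'I_u.+2) : i < j -> f i <> f j.
  move=> lt_ij eq_f; have [_] := Hf j; case: (Hf i) => Hi _; apply.
  by rewrite -eq_f; apply: P_mono Hi; apply: c_mono.
move=> i j eq_f; apply: val_inj; case: (ltngtP i j) => // /neq; first by case.
by move=> H; case: H.
Qed.

Lemma In_rcons T (us : seq T) u w : List.In w (rcons us u) <-> w = u \/ List.In w us.
Proof.
elim: us => [|v us IHus] /=; first by split=> [[->|//]|[->|//]]; left.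
by rewrite IHus; split=> [[->|[->|]]|[->|[->|]]]; tauto.
Qed.

Section Arithmetic.

Variables (G : nat -> nat -> nat) (nG : forall i, nice (G i)).

Let L q i := iter q (jump 0) (G i).

(** Suppose induction fails at [u]. Cut the interval of each index into
    [u + 2] consecutive pieces, each of which is still large, and pass to a
    piece on which no statement [A(v)], [v <= u], gets its first witness. There
    [A] is decided by witnesses below the lower end, hence equivalent to a
    bounded formula, for which induction holds at each index separately. *)
Lemma forced_induction A : Sigma1 A -> forced G
  (Imp (finst AZero A)
    (Imp (All (Imp A (fsubst (fun x => if x is 0 then ASucc (AVar 0) else AVar x) A)))
         (All A))).
Proof.
move=> /Sigma1_shape [l [B -> HB]] p0 e He0 p Hp0 H0 q Hqp Hstep r0 u Hr0 Hu0.
apply: NNPP => /(forces_not nG) [r Hr Hnot].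
have Hrp0 : ext r p0 by apply: ext_trans Hr _; apply: ext_trans Hr0 _; apply: ext_trans Hqp _.
have Hrp : ext r p by apply: ext_trans Hr _; apply: ext_trans Hr0 _.
have Hrq : ext r q by apply: ext_trans Hr _.
have He x := inJ_ext nG Hrp0 (He0 x).
have Hu := inJ_ext nG Hr Hu0.
pose W i c x := witness l c (scons x (at_index e i)) B.
have W_mono i x y v : x <= y -> W i x v -> W i y v by apply: witness_leq.
have nL q' i : nice (L q' i) by apply: nice_iter_jump.
(* [d i] is the largest order of growth below [i] for which the interval with
   index [i] is large; it tends to infinity. *)
pose largeb i d := L d i (lo r i) <= hi r i.
pose d i := \max_(j < i.+1 | largeb i j) j.
have d_inf c : ev (dom r) (fun i => c <= d i).
  apply: ev_imp (ev_and (ev_ge _ c) (cond_large r c)) => i _ [le_ci Hc].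
  exact: (@leq_bigmax_cond _ (fun j : 'I_i.+1 => largeb i j) (fun j => val j)
    (Ordinal (le_ci : c < i.+1)) Hc).
have d_large : ev (dom r) (fun i => L (d i) i (lo r i) <= hi r i).
  apply: ev_imp (cond_large r 0) => i _ Hc.
  have Hc' : largeb i (ord0 : 'I_i.+1) by [].
  have Hne : 0 < #|(fun j : 'I_i.+1 => largeb i j)| by apply/card_gt0P; exists ord0.
  by have [j Hj Ej] := eq_bigmax_cond (fun j : 'I_i.+1 => val j) Hne; rewrite /d Ej.
have [q0 Hq0] := Hu.
pose a i := (maxn (u i) (lo r i)).+1.
have Ja : inJ r a by apply/inJ_succ/inJ_max/inJ_lo.
have [q1 Hq1] := Ja.
(* The loss of 2 pays for the u + 2 pieces and for passing from lo to a. *)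
pose c i j := iter j (L (d i - 2) i) (a i).
have c_mono i : {homo c i : j j' / j <= j'} by move=> j j'; apply: iter_leq.
have Hj i : exists j, j <= (u i).+1 /\ (forall v, v <= u i -> W i (c i j.+1) v -> W i (c i j) v).
  have [j le_j H] := quiet_interval (u i) (@c_mono i) (@W_mono i).
  by exists j.
pose j i := sval (constructive_indefinite_description _ (Hj i)).
have Hji i : j i <= (u i).+1 /\ (forall v, v <= u i -> W i (c i (j i).+1) v -> W i (c i (j i)) v).
  exact: svalP (constructive_indefinite_description _ (Hj i)).
have le_ac i : a i <= c i (j i) by apply: (c_mono i 0).
have s_pos i : dom r i -> 0 < c i (j i) by move=> _; apply: leq_trans (le_ac i).
have s_large q' : ev (dom r) (fun i => L q' i (c i (j i)) <= c i (j i).+1).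
  apply: ev_imp (d_inf (q' + 2)) => i _ le_d.
  by apply: iter_jump_leq => //; rewrite leq_subRL ?(leq_trans _ le_d) ?leq_addl // addnC.
pose s := Cond (dom_unbounded r) s_pos s_large.
have Hsr : ext s r.
  split=> //; apply: ev_imp (ev_and (d_inf q1.+2) (ev_and d_large Hq1)) => i di [le_d [Hd le_a]].
  split; first by apply: leq_trans (le_ac i); apply: leqW; apply: leq_maxr.
  rewrite -[hi s i]/(c i (j i).+1).
  apply: leq_trans Hd; apply: leq_trans (c_mono i _ (a i).+1 _) _.
    by case: (Hji i) => le_j _; rewrite ltnS (leq_trans le_j) // /a ltnS leq_maxl.
  have d_gt1 : 1 < d i by apply: leq_trans le_d.
  have -> : c i (a i).+1 = L (d i).-1 i (a i).
    by rewrite /c /L -[(d i).-1]prednK -?subn1 ?subn_gt0 // -subnDA addn1.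
  have -> : d i = (d i).-1.+1 by rewrite prednK // ltnW.
  apply: leq_trans ((nL _ i).2 _ _ le_a) _.
  by apply: iter_jump_comp (nG i) (lo_gt0 di) _ _ => //; rewrite ltnS -ltnS prednK // ltnW.
have Hs p' : ext r p' -> ext s p' := ext_trans Hsr.
have Hes x := inJ_ext nG Hsr (He x).
have Jlo : inJ s (fun i => c i (j i)) := inJ_lo nG s.
have Hlow v : inJ s v -> ev (dom s) (fun i => v i <= u i) ->
    forces s (scons v e) (Exs l B) -> ev (dom s) (fun i => W i (c i (j i)) (v i)).
  move=> Jv le_v /(forces_Exs_elim nG HB (inJ_scons Jv Hes)) Hev.
  apply: ev_imp (ev_and Hev le_v) => i _ [HW le].
  by apply: (proj2 (Hji i) _ le); rewrite /W -at_index_scons.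
have Hint t v : ext t s -> inJ t v -> ev (dom t) (fun i => W i (c i (j i)) (v i)) ->
    forces t (scons v e) (Exs l B).
  move=> Ht Jv Hev.
  have Jlo' := inJ_ext nG Ht Jlo.
  apply: (forces_Exs_intro nG HB _ Jlo').
    by apply: inJ_scons => // x; apply: inJ_ext (Hes x).
  by apply: ev_imp Hev => i _; rewrite at_index_scons.
have W0 : ev (dom s) (fun i => W i (c i (j i)) 0).
  apply: (Hlow (fun=> 0)); [exact: inJ_const|exact: ev_all|].
  apply: forces_ext (Hs _ Hrp) _.
  exact: (proj1 (forces_inst AZero _ (fun x => inJ_ext nG Hp0 (He0 x))) H0).
have Wu : ev (dom s) (fun i => ~ W i (c i (j i)) (u i)).
  apply: NNPP => /not_ev /(restrict (p := s)) [t Ht [HWt _]].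
  apply: (Hnot t (ext_trans Ht Hsr)); apply: (Hint t u Ht).
    exact: inJ_ext (ext_trans Ht Hsr) Hu.
  by apply: ev_all => i /HWt /NNPP.
(* Index by index, w is the last point at which A holds. *)
have Hjump i : exists w, W i (c i (j i)) 0 -> ~ W i (c i (j i)) (u i) ->
    [/\ w < u i, W i (c i (j i)) w & ~ W i (c i (j i)) w.+1].
  apply: NNPP => Hn; have Hn' w : ~ (W i (c i (j i)) 0 -> ~ W i (c i (j i)) (u i) ->
      [/\ w < u i, W i (c i (j i)) w & ~ W i (c i (j i)) w.+1]).
    by move=> H; apply: Hn; exists w.
  have W0i : W i (c i (j i)) 0.
    by apply: NNPP => H; apply: (Hn' 0).
  have Wui : ~ W i (c i (j i)) (u i) by move=> H; apply: (Hn' 0).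
  apply: Wui; suff: forall w, w <= u i -> W i (c i (j i)) w by apply.
  elim=> // w IHw lt_wu; apply: NNPP => HS; apply: (Hn' w) => _ _.
  by split=> //; apply: IHw; apply: ltnW.
pose w i := sval (constructive_indefinite_description _ (Hjump i)).
have Hw i : W i (c i (j i)) 0 -> ~ W i (c i (j i)) (u i) ->
    [/\ w i < u i, W i (c i (j i)) (w i) & ~ W i (c i (j i)) (w i).+1].
  exact: svalP (constructive_indefinite_description _ (Hjump i)).
have Hwev := ev_imp (fun i _ h => Hw i (proj1 h) (proj2 h)) (ev_and W0 Wu).
have Jus := inJ_ext nG Hsr Hu.
have Jw : inJ s w by apply: inJ_le Jus; apply: ev_imp Hwev => i _ [/ltnW].
have := Hstep s w (Hs _ Hrq) Jw s (ext_refl s).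
have HwB : forces s (scons w e) (Exs l B) by apply: Hint (ext_refl s) Jw _; apply: ev_imp Hwev => i _ [].
move/(_ HwB).
move/forces_subst; have -> : names_subst (scons w e)
    (fun x => if x is 0 then ASucc (AVar 0) else AVar x) = scons (fun i => (w i).+1) e.
  by apply: functional_extensionality => -[].
move/(Hlow _ (inJ_succ nG Jw)) => Hev.
have /Hev Hev' : ev (dom s) (fun i => w i < u i) by apply: ev_imp Hwev => i _ [].
by have [i _ [HW []]] := ev_unbounded (ev_and Hev' Hwev) (dom_unbounded s).
Qed.

Lemma forced_ISigma1 A : ISigma1 A -> forced G A.
Proof.
have D0 B : Delta0 B -> (forall e, sat e B) -> forced G B.
  by move=> HB Hs p e He; apply/forces_Delta0 => //; apply: ev_all.
case=> {A} [||||||||A HA]; try by apply: D0; [do ?constructor|move=> e /=; lia].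
- move=> p e He q Hq Hlt; have He' x := inJ_ext nG Hq (He x).
  pose u i := e 1 i - (e 0 i).+1.
  have Ju : inJ q u by apply: inJ_le (He' 1); apply: ev_all => i _; apply: leq_subr.
  apply: (forces_Ex_intro nG (A := Eq (AAdd (AVar 1) (ASucc (AVar 0))) (AVar 2)) Ju).
  apply: ev_imp Hlt => i _ /=; rewrite /u /at_index /=; lia.
- move=> p e He q Hq HE; rewrite -/(forces q e (Lt (AVar 0) (AVar 1))).
  apply: (forces_stable nG) => r Hr.
  have /(forces_Ex_elim nG) [s [u [Hs _ H]]] : forces r e
    (Ex (Eq (AAdd (AVar 1) (ASucc (AVar 0))) (AVar 2))) by apply: forces_ext Hr _; exact: HE.
  by exists s => //; apply: ev_imp H => i _ /=; rewrite /at_index /=; lia.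
- exact: forced_induction.
Qed.

Lemma forced_base B : derives ISigma1_TrPi1 B -> forced G B.
Proof.
apply: (forced_derives nG) => A [/forced_ISigma1 //|[HA _ Hs]].
exact: forced_Pi1.
Qed.

Lemma forces_Alls_intro n (p : cond G) e A :
  (forall (q : cond G) us, ext q p -> size us = n -> (forall u, List.In u us -> inJ q u) ->
     forces q (lcons us e) A) -> forces p e (Alls n A).
Proof.
elim: n p e => [|n IHn] p e H; first by apply: (H p [::]) => //; apply: ext_refl.
rewrite -[Alls _ _]/(All (Alls n A)) => q u Hq Hu; apply: IHn => r us Hr Hs Hus.
rewrite -lcons_rcons; apply: H => [||w].
- exact: ext_trans Hr Hq.
- by rewrite size_rcons Hs.
by move/In_rcons => [->|/Hus //]; apply: inJ_ext Hu.
Qed.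

Lemma forces_Alls_elim n (p : cond G) e A us : forces p e (Alls n A) -> size us = n ->
  (forall u, List.In u us -> inJ p u) -> forces p (lcons us e) A.
Proof.
elim: n p e us => [|n IHn] p e us; first by move=> H /size0nil ->.
case/lastP: us => [//|us u]; rewrite size_rcons lcons_rcons => H [Hs] Hus.
apply: IHn => // [|w Hw]; last by apply: Hus; apply/In_rcons; right.
by apply: (H p u (ext_refl p)); apply: Hus; apply/In_rcons; left.
Qed.

Lemma inJ_bigmax (p : cond G) us : (forall u, List.In u us -> inJ p u) ->
  inJ p (fun i => \max_(u <- us) u i).
Proof.
elim: us => [|u us IHus] H.
  by apply: inJ_le (inJ_const nG p 0); apply: ev_all => i _; rewrite big_nil.
have Jus : inJ p (fun i => \max_(u <- us) u i) by apply: IHus => w Hw; apply: H; right.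
have Ju : inJ p u by apply: H; left.
by apply: inJ_le (inJ_max nG Ju Jus); apply: ev_all => i _; rewrite big_cons.
Qed.

Lemma inJ_lcons (p : cond G) us (e : nat -> nat -> nat) :
  (forall u, List.In u us -> inJ p u) -> (forall x, inJ p (e x)) ->
  forall x, inJ p (lcons us e x).
Proof.
elim: us => //= u us IHus Hus He; apply: inJ_scons; first by apply: Hus; left.
by apply: IHus => // w Hw; apply: Hus; right.
Qed.

End Arithmetic.

Lemma at_index_lcons us e i :
  at_index (lcons us e) i = lcons [seq u i | u <- us] (at_index e i).
Proof. by elim: us => //= u us <-; rewrite -at_index_scons. Qed.

Lemma all_bigmax (us : seq (nat -> nat)) i b :
  \max_(u <- us) u i <= b -> all (leq^~ b) [seq u i | u <- us].
Proof.
elim: us => //= u us IHus; rewrite big_cons geq_max => /andP[-> /IHus ->] //.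
Qed.

(** If o(xs) = l + n with [n] finite and [l] a limit or 0, this is the vector
    of l + (D * n + c): between ordinals that are successive for [xs] there is
    now room for [D] iterations. *)
Fixpoint scale (D c : nat) (xs : seq nat) : seq nat :=
  if xs is x :: xs' then
    if xs' is [::] then [:: D * x + c] else x :: scale D c xs'
  else [::].

Lemma size_scale D c xs : size (scale D c xs) = size xs.
Proof. by elim: xs => //= x [|y xs] //= ->. Qed.

Lemma all_scale D c xs b : 0 < D -> all (leq^~ b) xs -> all (leq^~ (D * b + c)) (scale D c xs).
Proof.
move=> D_gt0; elim: xs => //= x [|y xs] IHxs /andP[le_xb Hall]; first by rewrite /=; nia.
by rewrite [all _ _]/= IHxs // andbT; nia.
Qed.

Lemma vjump_scale D c c' xs G : 0 < size xs ->
  vjump (scale D (c + c') xs) G = iter c' (jump 0) (vjump (scale D c xs) G).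
Proof.
elim: xs G => // x [|y xs] IHxs G _; first by rewrite /= addnA (addnC (D * x + c)) iterD.
have E d : scale D d [:: x, y & xs] = x :: scale D d (y :: xs) by [].
have Ev zs F : vjump (x :: zs) F = vjump zs (iter x (jump (size zs)) F) by [].
by rewrite !E !Ev IHxs // !size_scale.
Qed.

Lemma scale_lexlt D ys xs : size ys = size xs -> lexlt ys xs ->
  lexlt (scale D D ys) (scale D 0 xs) \/ scale D D ys = scale D 0 xs.
Proof.
elim: ys xs => [|y ys IHys] [|x xs] //= [eq_s].
case: ys xs eq_s IHys => [|y' ys] [|x' xs] //= eq_s IHys.
  rewrite andbF orbF addn0 => lt_yx; case: (ltngtP (D * y + D) (D * x)).
  - by left.
  - by move=> lt; exfalso; nia.
  - by move=> ->; right.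
case/orP=> [->|/andP[/eqP -> lt]]; first by left.
rewrite ltnn eqxx /=; case: (IHys (x' :: xs) eq_s lt) => h; first by left; exact: h.
by right; congr cons; exact: h.
Qed.

(** The iterations freed by passing to a smaller vector keep the interval
    large; the argument on the right bounds the entries of the scaled vector. *)
Lemma vjump_descent H D ys xs a : nice H -> size ys = size xs -> 0 < size xs ->
  lexlt ys xs -> 0 < D <= a -> all (leq^~ a) ys ->
  iter D (jump 0) (vjump (scale D 0 ys) H) a <= vjump (scale D 0 xs) H (a * a.+1).
Proof.
move=> nH eq_s s_gt0 lt_yx /andP[D_gt0 le_Da] Hys.
rewrite -vjump_scale ?eq_s // add0n.
have le_n : a <= a * a.+1 by nia.
apply: leq_trans ((nice_vjump _ nH).2 _ _ le_n) _.
have [lt|->//] := scale_lexlt D eq_s lt_yx.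
apply: vjump_lexlt => //; first by rewrite !size_scale.
by apply: sub_all (all_scale D D_gt0 Hys) => y /=; nia.
Qed.

Lemma names_subst_trunc (e : nat -> nat -> nat) N :
  names_subst e (fun x => if x < N then AVar x else AZero) =
  fun x i => if x < N then e x i else 0.
Proof.
apply: functional_extensionality => x; apply: functional_extensionality => i.
by rewrite /names_subst; case: ifP.
Qed.

Lemma In_map T U (f : T -> U) s u : List.In u [seq f t | t <- s] -> exists t, u = f t.
Proof. by elim: s => //= t s IHs [<-|//]; exists t. Qed.

Section Rule.

Variables (k m j l : nat) (B : formula).
Hypothesis HB : Delta0 B.
Let K := k.+1.
Let A := Alls j (Exs l B).
Let H := Fmq k m 0.

Let nH : nice H.
Proof. exact: nice_Fmq. Qed.

Hypothesis prem : forall G, (forall i, nice (G i)) -> (forall i x, H x <= G i x) ->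
  forced G (progressive K A).

(** The premise of the rule is only available in the forced sense, so the
    conclusion is attacked through its refutations on finite intervals: all
    data lie below [a], and no witness below [b]. *)
Let fails (e : nat -> nat) (xs : seq nat) (a b : nat) : Prop :=
  [/\ size xs = K, all (leq^~ a) xs, forall x, e x <= a &
      exists zs, [/\ size zs = j, all (leq^~ a) zs &
        ~ witness l b (lcons zs (lcons xs e)) B]].

(** The interval is still large enough for as many steps down in the
    lexicographic order as the point [xs] admits. *)
Let bad D e xs a b : Prop :=
  [/\ fails e xs a b, D <= a & iter D (jump 0) (vjump (scale D 0 xs) H) a <= b].

(** If not, intervals refuting the claim for larger and larger [D] would form
    a condition that does not force progressiveness. *)
Lemma descent : exists2 D, 0 < D & forall e xs a b, bad D e xs a b ->
  exists ys a' b', lexlt ys xs /\ bad D e ys a' b'.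
Proof.
apply: NNPP => Hn.
have Hc i : exists c : (nat -> nat) * seq nat * nat * nat,
    bad i.+1 c.1.1.1 c.1.1.2 c.1.2 c.2 /\
    forall ys a' b', lexlt ys c.1.1.2 -> ~ bad i.+1 c.1.1.1 ys a' b'.
  apply: NNPP => Hn'; apply: Hn; exists i.+1 => // e xs a b Hbad.
  apply: NNPP => Hn2; apply: Hn'; exists (e, xs, a, b); split=> // ys a' b' lt Hbad'.
  by apply: Hn2; exists ys, a', b'.
pose c i := sval (constructive_indefinite_description _ (Hc i)).
have Hc' i : bad i.+1 (c i).1.1.1 (c i).1.1.2 (c i).1.2 (c i).2 /\
    forall ys a' b', lexlt ys (c i).1.1.2 -> ~ bad i.+1 (c i).1.1.1 ys a' b'.
  exact: svalP (constructive_indefinite_description _ (Hc i)).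
move: Hc'; set e := fun i => (c i).1.1.1; set xs := fun i => (c i).1.1.2.
set a := fun i => (c i).1.2; set b := fun i => (c i).2 => Hc'.
have [Hbad Hmin] : (forall i, bad i.+1 (e i) (xs i) (a i) (b i)) /\
    (forall i ys a' b', lexlt ys (xs i) -> ~ bad i.+1 (e i) ys a' b').
  by split=> i; case: (Hc' i).
pose G i := vjump (scale i.+1 0 (xs i)) H.
have nG i : nice (G i) by apply: nice_vjump.
have leG i x : H x <= G i x by apply: vjump_ge.
have Xu : unbounded (fun=> True) by move=> N; exists N.
have lo0 i : True -> 0 < a i by move=> _; case: (Hbad i) => _ /(leq_trans _) ->.
have large q : ev (fun=> True) (fun i => iter q (jump 0) (G i) (a i) <= b i).
  exists q => i le_qi _; case: (Hbad i) => _ _; apply: leq_trans.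
  exact/iter_jump_leq/leqW.
(* At index i, p is the interval refuting the claim for D = i + 1. *)
pose p := Cond Xu lo0 large.
pose X : seq (nat -> nat) := [seq (fun i => nth 0 (xs i) t) | t <- iota 0 K].
have X_at i : [seq u i | u <- X] = xs i.
  rewrite /X -map_comp; have [[<- _ _ _] _ _] := Hbad i.
  exact: mkseq_nth.
have bounded_J (u : nat -> nat) : (forall i, u i <= a i) -> inJ p u.
  by move=> Hu; apply: inJ_le (inJ_lo nG p); apply: ev_all => i _; apply: Hu.
have JX u : List.In u X -> inJ p u.
  move=> Hin; have [t ->] := In_map Hin; apply: bounded_J => i.
  have [[Hs Hall _ _] _ _] := Hbad i; have Hx := allP Hall.
  case: (ltnP t (size (xs i))) => [lt_t|?]; last by rewrite nth_default.
  exact/Hx/mem_nth.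
pose E (x i : nat) := e i x.
have JE x : inJ p (E x) by apply: bounded_J => i; have [[_ _ /(_ x)]] := Hbad i.
have sX : size X = K by rewrite size_map size_iota.
clearbody X.
have := forces_Alls_elim (prem nG leG JE) sX JX => /= Himp.
have [Hant|] := classic (forces p (lcons X E)
    (Alls K (Imp (lex_lt K 0 K) (fsubst (fun x => if x < K then AVar x else AVar (K + x)) A)))).
  have HA := Himp p (ext_refl p) Hant.
  have Hz i : exists zs, [/\ size zs = j, all (leq^~ (a i)) zs &
        ~ witness l (b i) (lcons zs (lcons (xs i) (e i))) B] by case: (Hbad i) => -[].
  pose zs i := sval (constructive_indefinite_description _ (Hz i)).
  have Hzs i : [/\ size (zs i) = j, all (leq^~ (a i)) (zs i) &
        ~ witness l (b i) (lcons (zs i) (lcons (xs i) (e i))) B].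
    exact: svalP (constructive_indefinite_description _ (Hz i)).
  pose Z : seq (nat -> nat) := [seq (fun i => nth 0 (zs i) t) | t <- iota 0 j].
  have Z_at i : [seq u i | u <- Z] = zs i.
    by rewrite /Z -map_comp; have [<- _ _] := Hzs i; apply: mkseq_nth.
  have JZ u : List.In u Z -> inJ p u.
    move=> Hin; have [t ->] := In_map Hin; apply: bounded_J => i.
    have [_ Hall _] := Hzs i; have Hx := allP Hall.
    case: (ltnP t (size (zs i))) => [lt_t|?]; last by rewrite nth_default.
    exact/Hx/mem_nth.
  have sZ : size Z = j by rewrite size_map size_iota.
  have HJ := inJ_lcons JZ (inJ_lcons JX JE).
  have := forces_Exs_elim nG HB HJ (forces_Alls_elim HA sZ JZ).
  move=> /ev_unbounded /(_ (dom_unbounded p)) [i _].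
  by rewrite !at_index_lcons X_at Z_at; case: (Hzs i).
move=> Hnf; apply: Hnf; apply: (forces_Alls_intro nG) => q Y Hq sY JY r Hr Hlex.
apply/forces_subst.
have -> : names_subst (lcons Y (lcons X E)) (fun x => if x < K then AVar x else AVar (K + x))
    = lcons Y E.
  apply: functional_extensionality => x; apply: functional_extensionality => i.
  rewrite /names_subst !(lcons_nth (fun=> 0)) sY; case: ltnP => /= [lt_x|le_x].
    by rewrite /at_index (lcons_nth (fun=> 0)) sY lt_x.
  rewrite /at_index !(lcons_nth (fun=> 0)) sY sX.
  have -> : (K + x < K) = false by lia.
  by rewrite addKn ltnNge le_x.
apply: (forces_Alls_intro nG) => s Z Hs sZ JZ; apply: NNPP => Hnf.
have Hsp : ext s p := ext_trans Hs (ext_trans Hr Hq).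
have JY' u : List.In u Y -> inJ s u.
  by move=> /JY; apply: inJ_ext => //; apply: ext_trans Hr.
have JE' x : inJ s (E x) := inJ_ext nG Hsp (JE x).
have JX' u : List.In u X -> inJ s u by move=> /JX; apply: inJ_ext.
(* An interval inside the given one on which a smaller point is refuted. *)
pose a' i := maxn (lo s i) (maxn (\max_(u <- Y) u i) (\max_(u <- Z) u i)).
have Ja' : inJ s a'.
  by apply: (inJ_max nG (inJ_lo nG s)); apply: (inJ_max nG); apply: (inJ_bigmax nG).
pose b' i := G i (a' i * (a' i).+1).
have Jb' : inJ s b' := inJ_iter nG 0 (inJ_mul nG Ja' (inJ_succ nG Ja')).
have Hnw : ~ ev (dom s) (fun i => witness l (b' i)
    (at_index (lcons Z (lcons Y E)) i) B).
  by move=> Hev; apply: Hnf; apply: forces_Exs_intro Jb' Hev => //; do 2 apply: inJ_lcons => //.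
have Hlex' : ev (dom s) (fun i => sat (at_index (lcons Y (lcons X E)) i) (lex_lt K 0 K)).
  apply/(forces_Delta0 nG); first exact: Delta0_lex_lt.
    by apply: inJ_lcons => //; apply: inJ_lcons.
  apply: forces_ext Hs _; exact: Hlex.
have Hun := not_ev Hnw.
have [N HN] := ev_and Hlex' Hsp.2.
have [i le_Ni [di Hw]] := Hun N.
have [lex_i [lo_i hi_i]] := HN i le_Ni di.
have [[sxs Hxs He _] le_ia _] := Hbad i.
have le_aa' : a i <= a' i by apply: leq_trans lo_i (leq_maxl _ _).
have aY : all (leq^~ (a' i)) [seq u i | u <- Y].
  by apply: all_bigmax; rewrite /a' !leq_max leqnn orbT.
have aZ : all (leq^~ (a' i)) [seq u i | u <- Z].
  by apply: all_bigmax; rewrite /a' !leq_max leqnn !orbT.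
have lt_yx : lexlt [seq u i | u <- Y] (xs i).
  move/sat_lex_lt: lex_i; rewrite !at_index_lcons X_at.
  set ss := mkseq _ _; set ts := mkseq _ _.
  suff [-> ->] : ss = [seq u i | u <- Y] /\ ts = xs i by [].
  rewrite /ss /ts; split; apply: (@eq_from_nth _ 0); rewrite size_mkseq ?size_map ?sY //.
  - move=> t lt_t; rewrite nth_mkseq // add0n (lcons_nth 0) size_map sY lt_t //.
  - move=> t lt_t; rewrite nth_mkseq // add0n (lcons_nth 0) size_map sY.
    by rewrite -ltn_subRL subnn ltn0 addKn (lcons_nth 0) sxs lt_t.
apply: (Hmin i _ (a' i) (b' i) lt_yx); split.
- split; rewrite ?size_map ?sY //; first by move=> x; apply: leq_trans (He x) le_aa'.
  exists [seq u i | u <- Z]; split; rewrite ?size_map ?sZ // => Hw'; apply: Hw.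
  by rewrite !at_index_lcons; exact: Hw'.
- exact: leq_trans le_ia le_aa'.
- by apply: vjump_descent; rewrite ?size_map ?sY ?sxs //= (leq_trans le_ia).
Qed.

(** A condition that does not force the conclusion contains an interval that
    starts a descent as in [descent], but the lexicographic order is
    well-founded. Since [vjump xs H] grows more slowly than [jump k.+1 H], one
    step of the hierarchy by omega^(1+k) pays for the rule. *)
Lemma forced_rule G : (forall i, nice (G i)) ->
  (forall i x, Fmq k m.+1 0 x <= G i x) -> forced G (Alls K A).
Proof.
move=> nG leG p E0 JE0; have [N HN] := fbounded_exists (Alls K A).
pose E x i := if x < N then E0 x i else 0.
have <- : fsubst (fun x => if x < N then AVar x else AZero) (Alls K A) = Alls K A.
  by rewrite -[RHS]fsubst_id; apply: fsubst_bounded HN _ => x ->.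
rewrite forces_subst // names_subst_trunc -/E.
have JE x : inJ p (E x).
  by rewrite /E; case: ltnP => _; [apply: JE0|apply: inJ_const].
have [D D_gt0 Hdesc] := descent.
have no_bad e xs a b : ~ bad D e xs a b.
  move=> Hbad; have sxs : size xs = K by case: Hbad => -[].
  move: xs sxs a b Hbad; apply: lexlt_wf => xs sxs IHxs a b /Hdesc [ys [a' [b' [lt Hys]]]].
  by apply: (IHxs ys _ lt a' b' Hys); case: Hys => -[].
apply: (forces_Alls_intro nG) => q X Hq sX JX; apply: (forces_Alls_intro nG) => s Z Hs sZ JZ.
apply: NNPP => Hnf; have Hsp := ext_trans Hs Hq.
have JX' u : List.In u X -> inJ s u by move=> /JX; apply: inJ_ext.
have JE' x : inJ s (E x) := inJ_ext nG Hsp (JE x).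
pose es := [seq E x | x <- iota 0 N].
have Jes u : List.In u es -> inJ s u by move=> Hin; have [x ->] := In_map Hin.
pose a i := maxn (maxn D (\max_(u <- es) u i)) (maxn (\max_(u <- X) u i) (\max_(u <- Z) u i)).
have Ja : inJ s a.
  apply: (inJ_max nG); apply: (inJ_max nG); try exact: (inJ_bigmax nG).
  exact: inJ_const.
pose b i := G i (D * a i + D).
have Jb : inJ s b.
  apply: (inJ_iter nG 0); apply: (inJ_add nG); last exact: inJ_const.
  by apply: (inJ_mul nG) => //; apply: inJ_const.
have /not_ev Hun : ~ ev (dom s) (fun i => witness l (b i) (at_index (lcons Z (lcons X E)) i) B).
  by move=> Hev; apply: Hnf; apply: forces_Exs_intro Jb Hev => //; do 2 apply: inJ_lcons => //.
have [i _ [di Hw]] := Hun 0.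
have aX : all (leq^~ (a i)) [seq u i | u <- X].
  by apply: all_bigmax; rewrite /a !leq_max leqnn !orbT.
apply: (no_bad (at_index E i) [seq u i | u <- X] (a i) (b i)); split.
- split; rewrite ?size_map //.
    move=> x; rewrite /at_index; case: (ltnP x N) => [lt_x|le_x]; last first.
      by rewrite /E ltnNge le_x.
    rewrite /a; apply: leq_trans (leq_maxl _ _); apply: leq_trans (leq_maxr _ _).
    rewrite /es big_map (bigD1_seq x) ?leq_maxl ?mem_iota ?iota_uniq //.
  exists [seq u i | u <- Z]; split; rewrite ?size_map //.
    by apply: all_bigmax; rewrite /a !leq_max leqnn !orbT.
  by move=> Hw'; apply: Hw; rewrite !at_index_lcons.
- by rewrite /a !leq_max leqnn.
- rewrite -vjump_scale ?size_map ?sX // add0n /b.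
  have le_n : a i <= D * a i + D by nia.
  apply: leq_trans ((nice_vjump _ nH).2 _ _ le_n) _; apply: leq_trans (leG i _).
  apply: leq_trans (vjump_le_jump nH (all_scale D D_gt0 aX)) _.
  by rewrite size_scale size_map sX.
Qed.

End Rule.

(** By [forced_rule], each nesting of the rule is paid for by one step of
    omega^(1+k) in the base functions. *)
Theorem forced_TIR k m B : TIR k m B ->
  forall G, (forall i, nice (G i)) -> (forall i x, Fmq k m 0 x <= G i x) -> forced G B.
Proof.
elim=> {m B} [m B HB|m A /Pi2_shape [j [_ -> /Sigma1_shape [l [B -> HB]]]] _ IH|m C B HB _ IHC] G nG leG.
- exact: forced_base.
- exact: (forced_rule HB IH).
- by apply: (forced_derives nG) HB => A HA; apply: IHC.
Qed.

(** Were there arguments without witnesses below [Fmq k m q] for every [q], the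
    intervals from these arguments up to the bounds would form a condition
    contradicting [forced_TIR]. *)
Lemma TIR_witness k m n l B : Delta0 B -> TIR k m (Alls n (Exs l B)) ->
  exists q, forall v, size v = n ->
    witness l (Fmq k m q (sumn v).+1) (lcons v (fun=> 0)) B.
Proof.
move=> HB HT; apply: NNPP => Hn.
have Hv q : exists v, size v = n /\
    ~ witness l (Fmq k m q (sumn v).+1) (lcons v (fun=> 0)) B.
  apply: NNPP => Hn'; apply: Hn; exists q => v sv; apply: NNPP => Hw.
  by apply: Hn'; exists v.
pose v q := sval (constructive_indefinite_description _ (Hv q)).
have Hvq q : size (v q) = n /\
    ~ witness l (Fmq k m q (sumn (v q)).+1) (lcons (v q) (fun=> 0)) B.
  exact: svalP (constructive_indefinite_description _ (Hv q)).
pose G (i : nat) := Fmq k m 0.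
have nG i : nice (G i) by apply: nice_Fmq.
have Xu : unbounded (fun=> True) by move=> N; exists N.
have lo0 i : True -> 0 < (sumn (v i)).+1 by [].
have large q : ev (fun=> True) (fun i => iter q (jump 0) (G i) (sumn (v i)).+1 <=
    Fmq k m i (sumn (v i)).+1).
  by exists q => i le_qi _; apply: iter_jump_leq le_qi; apply: nG.
pose p := Cond Xu lo0 large.
pose V : seq (nat -> nat) := [seq (fun i => nth 0 (v i) t) | t <- iota 0 n].
have V_at i : [seq u i | u <- V] = v i.
  by rewrite /V -map_comp; have [<- _] := Hvq i; apply: mkseq_nth.
have JV u : List.In u V -> inJ p u.
  move=> Hin; have [t ->] := In_map Hin; apply: inJ_le (inJ_lo nG p).
  apply: ev_all => i _ /=; elim: (v i) t => [|x w IHw] [|t] //=.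
    by rewrite ltnW // ltnS leq_addr.
  by apply: leq_trans (IHw t) _; rewrite ltnS leq_addl.
have J0 (x : nat) : inJ p ((fun _ _ => 0) x) by apply: inJ_const.
have sV : size V = n by rewrite size_map size_iota.
have := forces_Alls_elim (forced_TIR HT nG (fun _ _ => leqnn _) J0) sV JV.
move/(forces_Exs_elim nG HB (inJ_lcons JV J0)).
move/ev_unbounded => /(_ (dom_unbounded p)) [i _]; rewrite at_index_lcons V_at.
by case: (Hvq i).
Qed.

(** * Bounded relations *)

(** Formulas are only written down through these two predicates: a relation on
    environments counts as bounded when some Delta0 formula defines it. *)
Definition D0 (P : (nat -> nat) -> Prop) : Prop :=
  exists2 A, Delta0 A & forall e, sat e A <-> P e.

Definition tm (f : (nat -> nat) -> nat) : Prop := exists t, forall e, aeval e t = f e.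

Lemma tm_var x : tm (fun e => e x).
Proof. by exists (AVar x). Qed.

Lemma tm_const c : tm (fun=> c).
Proof. by elim: c => [|c [t Ht]]; [exists AZero|exists (ASucc t) => e /=; rewrite Ht]. Qed.

Lemma tm_succ f : tm f -> tm (fun e => (f e).+1).
Proof. by move=> [t Ht]; exists (ASucc t) => e /=; rewrite Ht. Qed.

Lemma tm_add f g : tm f -> tm g -> tm (fun e => f e + g e).
Proof. by move=> [t Ht] [u Hu]; exists (AAdd t u) => e /=; rewrite Ht Hu. Qed.

Lemma tm_mul f g : tm f -> tm g -> tm (fun e => f e * g e).
Proof. by move=> [t Ht] [u Hu]; exists (AMul t u) => e /=; rewrite Ht Hu. Qed.

Lemma D0_ext P Q : (forall e, P e <-> Q e) -> D0 P -> D0 Q.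
Proof. by move=> H [A HA HP]; exists A => // e; rewrite HP. Qed.

Lemma D0_eq f g : tm f -> tm g -> D0 (fun e => f e = g e).
Proof.
by move=> [t Ht] [u Hu]; exists (Eq t u) => [|e /=]; [constructor|rewrite Ht Hu].
Qed.

Lemma D0_lt f g : tm f -> tm g -> D0 (fun e => f e < g e).
Proof.
by move=> [t Ht] [u Hu]; exists (Lt t u) => [|e /=]; [constructor|rewrite Ht Hu].
Qed.

Lemma D0_le f g : tm f -> tm g -> D0 (fun e => f e <= g e).
Proof. by move=> Hf Hg; apply: (D0_lt Hf (tm_succ Hg)). Qed.

Lemma D0_False : D0 (fun=> False).
Proof. by exists Bot; first constructor. Qed.

Lemma D0_imp P Q : D0 P -> D0 Q -> D0 (fun e => P e -> Q e).
Proof.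
move=> [A HA HP] [B HB HQ]; exists (Imp A B); first by constructor.
by move=> e /=; rewrite HP HQ.
Qed.

Lemma D0_not P : D0 P -> D0 (fun e => ~ P e).
Proof. by move=> HP; apply: (D0_imp HP D0_False). Qed.

Lemma D0_and P Q : D0 P -> D0 Q -> D0 (fun e => P e /\ Q e).
Proof.
move=> [A HA HP] [B HB HQ]; exists (And A B); first exact: Delta0_And.
by move=> e; rewrite sat_And HP HQ.
Qed.

Lemma D0_or P Q : D0 P -> D0 Q -> D0 (fun e => P e \/ Q e).
Proof.
move=> [A HA HP] [B HB HQ]; exists (Or A B); first exact: Delta0_Or.
by move=> e; rewrite sat_Or HP HQ.
Qed.

Lemma D0_const (P : Prop) : D0 (fun=> P).
Proof.
case: (classic P) => HP; last by apply: D0_ext D0_False.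
by exists (Imp Bot Bot); [do !constructor|move=> e /=; split].
Qed.

Lemma D0_ball b P : tm b -> D0 (fun e => P (e 0) (fun x => e x.+1)) ->
  D0 (fun e => forall a, a < b e -> P a e).
Proof.
move=> [t Ht] [A HA HP]; exists (All (Imp (Lt (AVar 0) (ashift t)) A)).
  exact: Delta0_ball.
move=> e /=; split=> H a; move: (H a); rewrite /ashift aeval_subst /= Ht => {}H /H.
  by rewrite HP.
by rewrite HP.
Qed.

Lemma D0_bex b P : tm b -> D0 (fun e => P (e 0) (fun x => e x.+1)) ->
  D0 (fun e => exists2 a, a < b e & P a e).
Proof.
move=> Hb HP; apply: D0_ext (D0_not (@D0_ball b (fun a e => ~ P a e) Hb (D0_not HP))) => e.
split=> [H|[a lt_a Ha] /(_ a lt_a) //].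
by apply: NNPP => Hn; apply: H => a lt_a Ha; apply: Hn; exists a.
Qed.

Lemma D0_balle b P : tm b -> D0 (fun e => P (e 0) (fun x => e x.+1)) ->
  D0 (fun e => forall a, a <= b e -> P a e).
Proof. by move=> /tm_succ; apply: D0_ball. Qed.

Lemma D0_bexle b P : tm b -> D0 (fun e => P (e 0) (fun x => e x.+1)) ->
  D0 (fun e => exists2 a, a <= b e & P a e).
Proof. by move=> /tm_succ; apply: D0_bex. Qed.

Lemma tm_subst f (s : (nat -> nat) -> nat -> nat) :
  tm f -> (forall x, tm (fun e => s e x)) -> tm (fun e => f (s e)).
Proof.
move=> [t Ht] Hs.
pose s' x := sval (constructive_indefinite_description _ (Hs x)).
have Hs' x e : aeval e (s' x) = s e x.
  exact: (svalP (constructive_indefinite_description _ (Hs x))).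
exists (asubst s' t) => e; rewrite aeval_subst Ht.
by congr f; apply: functional_extensionality => x; apply: Hs'.
Qed.

Lemma D0_subst P (s : (nat -> nat) -> nat -> nat) :
  D0 P -> (forall x, tm (fun e => s e x)) -> D0 (fun e => P (s e)).
Proof.
move=> [A HA HP] Hs.
pose s' x := sval (constructive_indefinite_description _ (Hs x)).
have Hs' x e : aeval e (s' x) = s e x.
  exact: (svalP (constructive_indefinite_description _ (Hs x))).
exists (fsubst s' A); first exact: Delta0_subst.
move=> e; rewrite sat_subst HP.
by have -> : (fun x => aeval e (s' x)) = s e by apply: functional_extensionality.
Qed.

Lemma D0_bexs l b P : tm b -> D0 P ->
  D0 (fun e => exists ys, [/\ size ys = l, all (leq^~ (b e)) ys & P (lcons ys e)]).
Proof.
move=> Hb HP; elim: l b Hb => [|l IHl] b Hb.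
  by apply: D0_ext HP => e; split=> [H|[ys [/size0nil ->]]]; first by exists [::].
have Hb' : tm (fun e => b (fun x => e x.+1)).
  by apply: tm_subst Hb _ => x; apply: tm_var.
apply: (@D0_ext (fun e => exists2 a, a <= b e &
  exists ys, [/\ size ys = l, all (leq^~ (b e)) ys & P (lcons ys (scons a e))])).
  move=> e; split=> [[a le_a [ys [sy Hy H]]]|[ys []]].
    by exists (rcons ys a); rewrite size_rcons all_rcons lcons_rcons sy le_a; split.
  case/lastP: ys => // ys a; rewrite size_rcons all_rcons lcons_rcons.
  by move=> [sy] /andP[le_a Hy] H; exists a => //; exists ys.
apply: (@D0_bexle b (fun a e => exists ys,
  [/\ size ys = l, all (leq^~ (b e)) ys & P (lcons ys (scons a e))])) => //.
apply: D0_ext (IHl _ Hb') => e; by rewrite scons_eta.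
Qed.

Lemma D0_sub P (ts : seq ((nat -> nat) -> nat)) : D0 P ->
  (forall t, List.In t ts -> tm t) -> D0 (fun e => P (nth 0 [seq t e | t <- ts])).
Proof.
move=> HP Hts; apply: (D0_subst (s := fun e => nth 0 [seq t e | t <- ts]) HP) => x.
have [le|lt] := leqP (size ts) x.
  suff -> : (fun e => nth 0 [seq t e | t <- ts] x) = (fun=> 0) by apply: tm_const.
  by apply: functional_extensionality => e; rewrite nth_default ?size_map.
suff -> : (fun e => nth 0 [seq t e | t <- ts] x) = nth (fun=> 0) ts x.
  apply: Hts; elim: ts x lt {HP} => //= t ts IHts [|x] lt; first by left.
  by right; apply: IHts.
by apply: functional_extensionality => e; rewrite (nth_map (fun=> 0)).
Qed.

(** The tactic [d0] shows that a relation written with bounded quantifiers is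
    bounded; [d0_user] is redefined when new terms and relations appear. *)
Ltac d0_user := fail.
Ltac d0_step :=
  first
  [ assumption | apply tm_var | apply tm_const | apply tm_succ | apply tm_add
  | apply tm_mul | d0_user
  | apply D0_and | apply D0_or | apply D0_not | apply D0_eq | apply D0_le | apply D0_lt
  | apply D0_balle | apply D0_bexle | apply D0_ball | apply D0_bex
  | apply D0_imp | apply D0_const ].
Ltac d0 := repeat (d0_step; cbv beta).

Ltac d0_in := let t := fresh in let H := fresh in
  intros t H; simpl in H; repeat (destruct H as [H|H]; [subst t; d0|]); try contradiction.

Lemma D0_dvdn f g : tm f -> tm g -> D0 (fun e => f e %| g e).
Proof.
move=> Hf Hg.
have H : D0 (fun e => exists2 a, a <= e 1 & e 1 = a * e 0) by d0.
have H' := D0_sub (ts := [:: f; g]) H; apply: D0_ext (H' _) => [e /=|]; last by d0_in.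
split=> [[a _ ->]|/dvdnP[a Ea]]; first exact: dvdn_mull.
have [f0|f_gt0] := posnP (f e); last by exists a => //; rewrite Ea leq_pmulr.
by exists 0; rewrite ?mul0n // Ea f0 muln0.
Qed.

(** * Coding finite sets by divisibility *)

(** The pair [(s, c)] codes the set of the [y] for which [(y + 1) * s + 1]
    divides [c]. Since only divisibility occurs, [b] bounds codes for all
    subsets of [[0, N]] as soon as it bounds a code for [[0, N]] itself. *)
Definition code_mem (s c y : nat) : Prop := (y.+1 * s).+1 %| c.

(** A bounded way to say that every subset of [[0, N]] has a code below [b],
    see [code_exists]. *)
Definition roomy (N b : nat) : Prop :=
  exists2 s, s <= b & exists2 c, c <= b &
    [/\ N <= b, 0 < s, 0 < c & forall i, i <= N -> i.+1 %| s /\ code_mem s c i].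

Lemma D0_code_mem s c y : tm s -> tm c -> tm y -> D0 (fun e => code_mem (s e) (c e) (y e)).
Proof. by move=> Hs Hc Hy; apply: D0_dvdn; d0. Qed.

Lemma D0_and4 P Q R S : D0 P -> D0 Q -> D0 R -> D0 S ->
  D0 (fun e => [/\ P e, Q e, R e & S e]).
Proof.
move=> HP HQ HR HS; apply: D0_ext (D0_and HP (D0_and HQ (D0_and HR HS))) => e.
by split=> [[a [b [c d]]]|[a b c d]].
Qed.

Lemma D0_and3 P Q R : D0 P -> D0 Q -> D0 R -> D0 (fun e => [/\ P e, Q e & R e]).
Proof.
move=> HP HQ HR; apply: D0_ext (D0_and HP (D0_and HQ HR)) => e.
by split=> [[a [b c]]|[a b c]].
Qed.

Ltac d0_user ::= first [apply D0_code_mem | apply D0_dvdn | apply D0_and3 | apply D0_and4].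

Lemma D0_roomy N b : tm N -> tm b -> D0 (fun e => roomy (N e) (b e)).
Proof.
move=> HN Hb; have H : D0 (fun e => roomy (e 0) (e 1)) by rewrite /roomy; d0.
have H' := D0_sub (ts := [:: N; b]) H; apply: H'; d0_in.
Qed.

(** A common divisor of two moduli is prime to [s] and divides [(y - x) * s];
    so it divides [y - x], which divides [s]. *)
Lemma coprime_moduli s N x y : (forall i, i <= N -> i.+1 %| s) ->
  x < y <= N -> coprime (x.+1 * s).+1 (y.+1 * s).+1.
Proof.
move=> Hs /andP[lt_xy le_yN]; set d := gcdn (x.+1 * s).+1 (y.+1 * s).+1.
have ds : coprime d s.
  rewrite /coprime -dvdn1; apply: (@dvdn_trans (gcdn (x.+1 * s).+1 s)).
    by rewrite dvdn_gcd dvdn_gcdr andbT (dvdn_trans (dvdn_gcdl _ _)) ?dvdn_gcdl.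
  by rewrite gcdnC -addn1 gcdnMDl gcdn1.
have dvd_d : d %| (y - x) * s.
  have -> : (y - x) * s = (y.+1 * s).+1 - (x.+1 * s).+1 by rewrite subSS -mulnBl subSS.
  by apply: dvdn_sub; rewrite ?dvdn_gcdl ?dvdn_gcdr.
have {}dvd_d : d %| y - x by rewrite -(Gauss_dvdl _ ds).
have dvd_s : y - x %| s by rewrite -[y - x]prednK ?subn_gt0 //; apply: Hs; lia.
rewrite /coprime -/d; move: ds; rewrite /coprime; suff -> : gcdn d s = d by [].
by apply/gcdn_idPl; apply: dvdn_trans dvd_d dvd_s.
Qed.

(** The moduli of the members multiply to a divisor of [c]. *)
Lemma code_exists N b (P : nat -> Prop) : roomy N b ->
  exists s c, [/\ s <= b, c <= b & forall y, y <= N -> code_mem s c y <-> P y].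
Proof.
move=> [s le_s [c le_c [_ s_gt0 c_gt0 Hsc]]]; exists s.
have Hs i : i <= N -> i.+1 %| s by move=> /Hsc [].
pose p y : bool := excluded_middle_informative (P y).
have pP y : p y <-> P y by rewrite /p; case: (excluded_middle_informative (P y)).
pose f y := (y.+1 * s).+1.
pose c' n := \prod_(0 <= y < n | p y) f y.
have cop n y : n <= y -> y <= N -> coprime (c' n) (f y).
  move=> le_n le_y; rewrite /c' big_seq_cond; elim/big_rec: _ => [|x z /andP[Hx _] Hz].
    exact: coprime1n.
  rewrite coprimeMl Hz andbT; apply: (@coprime_moduli _ N) => //.
  by move: Hx; rewrite mem_index_iota; lia.
have dvd_c n : n <= N.+1 -> c' n %| c.
  elim: n => [|n IHn] lt_n; first by rewrite /c' big_geq ?dvd1n.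
  rewrite /c' big_mkcond big_nat_recr //= -big_mkcond -/(c' n).
  case: (p n); last by rewrite muln1 IHn // ltnW.
  rewrite Gauss_dvd ?cop // IHn 1?ltnW //; exact: (Hsc n _).2.
exists (c' N.+1); split=> // [|y le_y].
  by apply: leq_trans le_c; apply: dvdn_leq => //; apply: dvd_c.
rewrite -pP /code_mem -/(f y); split=> [Hd|py].
  apply: contraTT Hd => npy; rewrite /c'.
  have : coprime (\prod_(0 <= x < N.+1 | p x) f x) (f y).
    rewrite big_seq_cond; elim/big_rec: _ => [|x z /andP[Hx px] Hz]; first exact: coprime1n.
    rewrite coprimeMl Hz andbT; move: Hx; rewrite mem_index_iota => Hx.
    case: (ltngtP x y) => [lt|lt|eq]; last by rewrite -eq px in npy.
      by apply: (@coprime_moduli _ N) => //; rewrite lt.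
    by rewrite coprime_sym; apply: (@coprime_moduli _ N) => //; rewrite lt; lia.
  rewrite coprime_sym => Hc; apply/negP => Hd; move: Hc.
  rewrite /coprime (gcdn_idPl Hd) /f; nia.
have Hy : y \in index_iota 0 N.+1 by rewrite mem_index_iota.
have Hy' : y \in [seq x <- index_iota 0 N.+1 | p x] by rewrite mem_filter Hy andbT; exact: py.
by rewrite /c' -big_filter (bigD1_seq y Hy') ?filter_uniq ?iota_uniq //= dvdn_mulr.
Qed.

Lemma roomy_leq N M b b' : M <= N -> b <= b' -> roomy N b -> roomy M b'.
Proof.
move=> le_MN le_b [s le_s [c le_c [le_N s0 c0 H]]]; exists s; first exact: leq_trans le_b.
exists c; first exact: leq_trans le_b.
by split=> //; [lia|move=> i le_i; apply: H; lia].
Qed.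

Definition room (N : nat) : nat :=
  N + N.+1`! + \prod_(0 <= y < N.+1) (y.+1 * N.+1`!).+1.

Lemma roomy_room N : roomy N (room N).
Proof.
exists N.+1`!; first by rewrite /room; lia.
exists (\prod_(0 <= y < N.+1) (y.+1 * N.+1`!).+1); first by rewrite /room; lia.
split; [by rewrite /room; lia|exact: fact_gt0|exact: prodn_gt0|move=> i le_i].
split; first by apply: dvdn_fact.
rewrite /code_mem (bigD1_seq i) ?iota_uniq ?mem_index_iota //=.
exact: dvdn_mulr.
Qed.

(** Bounded definitions of inductively generated relations: [J S x] says that
    [x] is justified by the members of [S], and [x] holds if it belongs to a
    finite set, coded below [b], all of whose members are justified by members. *)
Definition table (J : (nat -> Prop) -> nat -> Prop) (b x : nat) : Prop :=
  exists2 N, N <= b & exists2 s, s <= b & exists2 c, c <= b &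
    (x <= N /\ code_mem s c x) /\
    forall y, y <= N -> code_mem s c y -> J (fun z => z <= N /\ code_mem s c z) y.

Lemma table_sound J (P : nat -> Prop) b x :
  (forall S : nat -> Prop, (forall y, S y -> J S y) -> forall y, S y -> P y) ->
  table J b x -> P x.
Proof.
move=> H [N _ [s _ [c _ [Hx Hy]]]]; apply: (H (fun z => z <= N /\ code_mem s c z)) => //.
by move=> y [le_y Hm]; apply: Hy.
Qed.

Lemma table_complete (J : (nat -> Prop) -> nat -> Prop) (P : nat -> Prop) N b x :
  roomy N b -> x <= N -> P x ->
  (forall y, y <= N -> P y -> J (fun z => z <= N /\ P z) y) -> table J b x.
Proof.
move=> HN le_x Px HJ; have [s [c [le_s le_c Hm]]] := code_exists P HN.
exists N; first by case: HN => s' _ [c' _ []].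
exists s => //; exists c => //; split; first by split=> //; apply/Hm.
move=> y le_y /Hm -/(_ le_y) Py.
suff -> : (fun z => z <= N /\ code_mem s c z) = (fun z => z <= N /\ P z) by apply: HJ.
apply: functional_extensionality => z; apply: propositional_extensionality.
by split=> -[le_z H]; split=> //; apply/Hm.
Qed.

Lemma D0_table (J : (nat -> nat) -> nat -> (nat -> Prop) -> nat -> Prop) b x :
  tm b -> tm x ->
  D0 (fun e => J (fun i => e (i + 4)) (b (fun i => e (i + 4))) (fun z => z <= e 3 /\ code_mem (e 2) (e 1) z) (e 0)) ->
  D0 (fun e => table (J e (b e)) (b e) (x e)).
Proof.
move=> Hb Hx HJ; rewrite /table.
have sh f n : tm f -> tm (fun e => f (fun i => e (i + n))).
  by move=> Hf; apply: tm_subst Hf _ => i; apply: tm_var.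
apply: (@D0_bexle b (fun N e => exists2 s, s <= b e & exists2 c, c <= b e &
    (x e <= N /\ code_mem s c (x e)) /\
    forall y, y <= N -> code_mem s c y ->
      J e (b e) (fun z => z <= N /\ code_mem s c z) y)) => //.
have Hb1 := sh _ 1 Hb; have Hb2 := sh _ 2 Hb; have Hx3 := sh _ 3 Hx.
have E n (e : nat -> nat) : (fun i => e (i + n).+1) = (fun i => e (i + n.+1)).
  by apply: functional_extensionality => i; rewrite addnS.
have E1 (e : nat -> nat) : (fun i => e i.+1) = (fun i => e (i + 1)).
  by apply: functional_extensionality => i; rewrite addn1.
apply: (@D0_bexle (fun e => b (fun i => e i.+1)) (fun s e => exists2 c, c <= b (fun i => e i.+1) &
    (x (fun i => e i.+1) <= e 0 /\ code_mem s c (x (fun i => e i.+1))) /\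
    forall y, y <= e 0 -> code_mem s c y ->
      J (fun i => e i.+1) (b (fun i => e i.+1)) (fun z => z <= e 0 /\ code_mem s c z) y)).
  by apply: tm_subst Hb _ => i; apply: tm_var.
apply: (@D0_bexle (fun e => b (fun i => e i.+2)) (fun c e =>
    (x (fun i => e i.+2) <= e 1 /\ code_mem (e 0) c (x (fun i => e i.+2))) /\
    forall y, y <= e 1 -> code_mem (e 0) c y ->
      J (fun i => e i.+2) (b (fun i => e i.+2)) (fun z => z <= e 1 /\ code_mem (e 0) c z) y)).
  by apply: tm_subst Hb _ => i; apply: tm_var.
have Hx' : tm (fun e => x (fun i => e i.+3)) by apply: tm_subst Hx _ => i; apply: tm_var.
apply: D0_and; first by d0.
apply: (@D0_balle (fun e => e 2) (fun y e => code_mem (e 1) (e 0) y ->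
      J (fun i => e i.+3) (b (fun i => e i.+3)) (fun z => z <= e 2 /\ code_mem (e 1) (e 0) z) y)); first by d0.
apply: D0_imp; first by d0.
have E4 (e : nat -> nat) : (fun i => e i.+4) = (fun i => e (i + 4)).
  by apply: functional_extensionality => i; rewrite addn4.
by apply: D0_ext HJ => e; rewrite E4.
Qed.

(** * Functions bounded by a finite iterate of a fast growing function *)

(** Closed under composition, the arithmetical operations and iteration, hence
    suited to bound the room that computations need. *)
Definition dominated (G E : nat -> nat) : Prop :=
  exists q, forall x, E x <= iter q (jump 0) G x.+1.

Section Dominated.

Variables (G : nat -> nat) (nG : nice G).

Let nI q : nice (iter q (jump 0) G).
Proof. exact: nice_iter_jump. Qed.

Lemma dominated_le E E' : (forall x, E x <= E' x) -> dominated G E' -> dominated G E.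
Proof. by move=> le [q Hq]; exists q => x; apply: leq_trans (Hq x). Qed.

Lemma dominated_self : dominated G G.
Proof. by exists 0 => x; apply: nG.2; apply: leqnSn. Qed.

Lemma dominated_iter q : dominated G (iter q (jump 0) G).
Proof. by exists q => x; apply: (nI q).2; apply: leqnSn. Qed.

Lemma dominated_id : dominated G id.
Proof. by apply: dominated_le dominated_self => x; apply: nice_ge. Qed.

Lemma dominated_comp E E' : dominated G E -> dominated G E' -> dominated G (fun x => E (E' x)).
Proof.
move=> [q Hq] [r Hr]; exists (maxn q r.+1).+1 => x.
apply: leq_trans (Hq _) _; apply: (@leq_trans (iter q (jump 0) G (iter r.+1 (jump 0) G x.+1))).
  apply: (nI q).2; apply: leq_ltn_trans (Hr x) _.
  by apply: leq_trans ((nI r).1 _) _; apply: iter_jump_comp.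
by apply: iter_jump_comp; rewrite ?ltnS ?leq_maxl ?leq_maxr.
Qed.

Lemma dominated_const c : dominated G (fun=> c).
Proof.
elim: c => [|c IHc]; first by exists 0.
have H : dominated G succn by apply: dominated_le dominated_self => x; apply: nG.1.
exact: dominated_comp H IHc.
Qed.

Lemma dominated_max E E' : dominated G E -> dominated G E' ->
  dominated G (fun x => maxn (E x) (E' x)).
Proof.
move=> [q Hq] [r Hr]; exists (maxn q r) => x; rewrite geq_max.
by rewrite (leq_trans (Hq x)) ?(leq_trans (Hr x)) ?iter_jump_leq ?leq_maxl ?leq_maxr.
Qed.

Lemma dominated_mul E E' : dominated G E -> dominated G E' -> dominated G (fun x => E x * E' x).
Proof.
move=> HE HE'; apply: dominated_le (dominated_comp (dominated_iter 2) (dominated_max HE HE')).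
by move=> x; apply: iter_jump_mul.
Qed.

Lemma dominated_succ E : dominated G E -> dominated G (fun x => (E x).+1).
Proof.
have H : dominated G succn by apply: dominated_le dominated_self => x; apply: nG.1.
exact: dominated_comp H.
Qed.

Lemma dominated_add E E' : dominated G E -> dominated G E' -> dominated G (fun x => E x + E' x).
Proof.
move=> /dominated_succ HE /dominated_succ HE'; apply: dominated_le (dominated_mul HE HE').
by move=> x; nia.
Qed.

Lemma dominated_iterate E E' : dominated G E -> dominated G E' ->
  dominated G (fun x => iter (E' x) E (E' x)).
Proof.
move=> HE HE'; suff H : dominated G (fun x => iter x E x) by apply: dominated_comp H HE'.
case: HE => q Hq; pose H := iter q (jump 0) G.
have nH : nice H := nI q.
have it n x : (iter n E x).+1 <= iter (n + n) H x.+1.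
  elim: n => // n IHn; rewrite addnS addSn /=.
  by apply: leq_ltn_trans (Hq _) _; apply: leq_ltn_trans (nH.2 _ _ IHn) (nH.1 _).
have HJ : dominated G (fun x => jump 0 H (x + x).+1).
  have HJ' := dominated_iter q.+1; apply: (@dominated_comp (jump 0 H) (fun x => (x + x).+1)) => //.
  by apply: dominated_succ; apply: dominated_add; apply: dominated_id.
apply: dominated_le HJ => x; apply: ltnW; apply: leq_trans (it x x) _.
apply: leq_trans (iter_homo _ nH (_ : x.+1 <= (x + x).+1)) _; first by lia.
by apply: (@iter_leq H (x + x) (x + x).+2) => //; lia.
Qed.

Lemma dominated_exp E E' : dominated G E -> dominated G E' -> dominated G (fun x => E x ^ E' x).
Proof.
move=> HE HE'; pose M x := (E x + E' x).+2.
have HM : dominated G M by apply/dominated_succ/dominated_succ/dominated_add.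
have Hsq : dominated G (fun y => y * y) by apply: dominated_mul; apply: dominated_id.
apply: dominated_le (dominated_iterate Hsq HM) => x.
apply: (@leq_trans (M x ^ M x)).
  have leX a b n : a <= b -> a ^ n <= b ^ n.
    by move=> le; elim: n => // n IHn; rewrite !expnS leq_mul.
  apply: (@leq_trans (M x ^ E' x)); first by apply: leX; rewrite /M; lia.
  by rewrite leq_exp2l /M; lia.
suff H n y : 1 < y -> y ^ n <= iter n (fun z => z * z) y by apply: H.
move=> y_gt1; suff : y ^ n <= iter n (fun z => z * z) y /\ y <= iter n (fun z => z * z) y by case.
elim: n => [|n [IH1 IH2]]; first by rewrite expn0 /=; split=> //; apply: ltnW.
rewrite expnSr /=; split; first exact: leq_mul.
by apply: leq_trans (IH2) _; apply: leq_pmulr; apply: leq_trans IH2; apply: ltnW.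
Qed.

Lemma dominated_room E : dominated G E -> dominated G (fun x => room (E x)).
Proof.
move=> HE; suff H : dominated G room by apply: dominated_comp H HE.
have Hid := dominated_id.
have Hf : dominated G (fun N => N.+1`!).
  apply: dominated_le (dominated_exp (dominated_succ Hid) (dominated_succ Hid)) => N.
  have fact_exp n m : n <= m -> n`! <= m ^ n; last exact: fact_exp.
  by elim: n => // n IHn lt_n; rewrite factS expnS leq_mul // IHn // ltnW.
have Hp : dominated G (fun N => ((N.+1 * N.+1`!).+1) ^ N.+1).
  apply: dominated_exp; last exact: dominated_succ.
  by apply: dominated_succ; apply: dominated_mul => //; apply: dominated_succ.
apply: dominated_le (dominated_add (dominated_add Hid Hf) Hp) => N; rewrite /room leq_add2l.
apply: (@leq_trans (\prod_(0 <= y < N.+1) (N.+1 * N.+1`!).+1)).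
  rewrite !big_mkord; apply: leq_prod => i _; rewrite ltnS leq_mul2r; apply/orP; right.
  exact: ltn_ord.
by rewrite prod_nat_const_nat subn0.
Qed.

End Dominated.

(** * Elementary functions *)

Lemma elementary_in_trans (g g' : nat -> nat) :
  elementary_in g' (fun v : 1.-tuple nat => g (thead v)) ->
  forall n (f : n.-tuple nat -> nat), elementary_in g f -> elementary_in g' f.
Proof.
move=> Hg n f; elim=> {n f}
  [|n c|n i||||n p h hs _ IHh _ IHhs|n h _ IHh|n h _ IHh|n f f' E _ IHf].
- exact: Hg.
- exact: elem_const.
- exact: elem_proj.
- exact: elem_succ.
- exact: elem_add.
- exact: elem_sub.
- exact: elem_comp.
- exact: elem_bsum.
- exact: elem_bprod.
- exact: elem_ext E IHf.
Qed.

(** Functions of argument lists of any length avoid the bookkeeping of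
    arities. *)
Definition elemf (g : nat -> nat) (f : seq nat -> nat) : Prop :=
  forall n, elementary_in g (fun v : n.-tuple nat => f v).

Section Elementary.

Variable g : nat -> nat.

Lemma elemf_ext f f' : f =1 f' -> elemf g f -> elemf g f'.
Proof. by move=> E H n; apply: elem_ext (H n) => v. Qed.

Lemma elemf_const c : elemf g (fun=> c).
Proof. by move=> n; apply: elem_const. Qed.

Lemma elemf_nth x : elemf g (fun s => nth 0 s x).
Proof.
move=> n; have [le|lt] := leqP n x.
  by apply: elem_ext (elem_const g n 0) => v; rewrite nth_default ?size_tuple.
by apply: elem_ext (elem_proj g (Ordinal lt)) => v; rewrite (tnth_nth 0).
Qed.

Lemma elementary_app n p (F : p.-tuple nat -> nat) (f : n.-tuple nat -> p.-tuple nat) :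
  elementary_in g F -> (forall i, elementary_in g (fun v => tnth (f v) i)) ->
  elementary_in g (fun v => F (f v)).
Proof.
move=> HF Hf; apply: elem_ext (elem_comp HF Hf) => v; congr F.
by apply: eq_from_tnth => i; rewrite tnth_mktuple.
Qed.

Lemma elemf_comp F (hs : seq (seq nat -> nat)) : elemf g F ->
  (forall h, List.In h hs -> elemf g h) -> elemf g (fun s => F [seq h s | h <- hs]).
Proof.
move=> HF Hhs n.
apply: (@elementary_app n (size hs) (fun v => F v) (fun v => map_tuple (fun h => h (val v)) (in_tuple hs))) => //.
move=> i; have Hi : elemf g (nth (fun=> 0) hs i).
  apply: Hhs; case: i => i /=; elim: hs i {HF} => //= h hs IHhs [|i] lt_i; first by left.
  by right; apply: IHhs.
by apply: elem_ext (Hi n) => v; rewrite (tnth_nth 0) (nth_map (fun=> 0)).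
Qed.

Lemma elemf_oracle f : elemf g f -> elemf g (fun s => g (f s)).
Proof.
move=> Hf n; apply: (@elementary_app n 1 (fun v => g (thead v)) (fun v => [tuple f v])).
  exact: elem_oracle.
by move=> i; apply: elem_ext (Hf n) => v; rewrite (tnth_nth 0) ord1.
Qed.

Lemma elemf_succ f : elemf g f -> elemf g (fun s => (f s).+1).
Proof.
move=> Hf n; apply: (@elementary_app n 1 (fun v => (thead v).+1) (fun v => [tuple f v])).
  exact: elem_succ.
by move=> i; apply: elem_ext (Hf n) => v; rewrite (tnth_nth 0) ord1.
Qed.

Lemma elementary_app2 n (F : 2.-tuple nat -> nat) f h : elementary_in g F ->
  elemf g f -> elemf g h -> elementary_in g (fun v : n.-tuple nat => F [tuple f v; h v]).
Proof.
move=> HF Hf Hh; apply: (@elementary_app n 2 F (fun v => [tuple f v; h v])) => //.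
case=> [[|[|i]] Hi]; last by [].
- exact: elem_ext (Hf n).
- exact: elem_ext (Hh n).
Qed.

Lemma elemf_add f h : elemf g f -> elemf g h -> elemf g (fun s => f s + h s).
Proof.
move=> Hf Hh n; apply: elem_ext (elementary_app2 n (elem_add g) Hf Hh) => v.
by rewrite !(tnth_nth 0).
Qed.

Lemma elemf_sub f h : elemf g f -> elemf g h -> elemf g (fun s => f s - h s).
Proof.
move=> Hf Hh n; apply: elem_ext (elementary_app2 n (elem_sub g) Hf Hh) => v.
by rewrite !(tnth_nth 0).
Qed.

Lemma elementary_cons n (F : n.+1.-tuple nat -> nat) b :
  elementary_in g F -> elemf g b ->
  elementary_in g (fun v : n.-tuple nat => F [tuple of b v :: v]).
Proof.
move=> HF Hb; apply: (@elementary_app n n.+1 F (fun v => [tuple of b v :: v])) => //.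
move=> i; case: (unliftP ord0 i) => [j|] ->.
  by apply: elem_ext (elem_proj g j) => v; rewrite tnthS.
by apply: elem_ext (Hb n) => v; rewrite tnth0.
Qed.

Lemma elemf_sum b f : elemf g b -> elemf g f ->
  elemf g (fun s => \sum_(0 <= i < b s) f (i :: s)).
Proof.
move=> Hb Hf n; have := elementary_cons (elem_bsum (Hf n.+1)) Hb.
apply: elem_ext => v; rewrite theadE; apply: eq_bigr => i _ /=.
by congr f; congr cons; rewrite -[RHS]/(behead (b v :: v)).
Qed.

Lemma elemf_prod b f : elemf g b -> elemf g f ->
  elemf g (fun s => \prod_(0 <= i < b s) f (i :: s)).
Proof.
move=> Hb Hf n; have := elementary_cons (elem_bprod (Hf n.+1)) Hb.
by apply: elem_ext => v; rewrite theadE; apply: eq_bigr => i _ /=.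
Qed.

Lemma elemf_mul f h : elemf g f -> elemf g h -> elemf g (fun s => f s * h s).
Proof.
move=> Hf Hh.
have H : elemf g (fun s => \sum_(0 <= i < nth 0 s 0) nth 0 (i :: s) 2).
  by apply: (@elemf_sum (fun s => nth 0 s 0) (fun s => nth 0 s 2)); apply: elemf_nth.
apply: elemf_ext (elemf_comp (hs := [:: f; h]) H _) => [s|]; last by move=> ? [<-|[<-|[]]].
by rewrite /= sum_nat_const_nat subn0.
Qed.

Lemma elemf_aeval t : elemf g (fun s => aeval (nth 0 s) t).
Proof.
elim: t => [x||t IHt|t IHt u IHu|t IHt u IHu] /=.
- exact: elemf_nth.
- exact: elemf_const.
- exact: elemf_succ.
- exact: elemf_add.
- exact: elemf_mul.
Qed.

Lemma nth_scons a s : nth 0 (a :: s) = scons a (nth 0 s).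
Proof. by apply: functional_extensionality => -[]. Qed.

(** A bounded quantifier becomes a bounded product of characteristic
    functions. *)
Lemma elemf_Delta0 A : Delta0 A -> exists chi : seq nat -> bool,
  elemf g (fun s => chi s) /\ forall s, chi s <-> sat (nth 0 s) A.
Proof.
elim=> {A} [t u|t u||A B _ [chi [Hc Ec]] _ [chi' [Hc' Ec']]|t A _ [chi [Hc Ec]]].
- exists (fun s => aeval (nth 0 s) t == aeval (nth 0 s) u); split; last first.
    by move=> s; split=> /eqP.
  have H : elemf g (fun s => 1 - ((aeval (nth 0 s) t - aeval (nth 0 s) u) +
      (aeval (nth 0 s) u - aeval (nth 0 s) t))).
    apply: elemf_sub (elemf_const 1) _.
    by apply: elemf_add; apply: elemf_sub; apply: elemf_aeval.
  by apply: elemf_ext H => s; case: (ltngtP (aeval (nth 0 s) t)) => /=; lia.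
- exists (fun s => aeval (nth 0 s) t < aeval (nth 0 s) u); split => //.
  have H : elemf g (fun s => 1 - ((aeval (nth 0 s) t).+1 - aeval (nth 0 s) u)).
    apply: elemf_sub (elemf_const 1) _.
    by apply: elemf_sub; [apply: elemf_succ|]; apply: elemf_aeval.
  by apply: elemf_ext H => s; case: leqP => /=; lia.
- by exists (fun=> false); split; [apply: elemf_const|].
- exists (fun s => chi s ==> chi' s); split; last first.
    move=> s; rewrite -[sat _ _]/(sat (nth 0 s) A -> sat (nth 0 s) B) -Ec -Ec'.
    by split=> [/implyP|/implyP].
  have H : elemf g (fun s => 1 - (chi s - chi' s)).
    by apply: elemf_sub (elemf_const 1) _; apply: elemf_sub.
  by apply: elemf_ext H => s; case: (chi s); case: (chi' s).
- pose f s := \prod_(0 <= a < aeval (nth 0 s) t) (chi (a :: s) : nat).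
  have f01 s : f s = (f s == 1).
    suff : f s <= 1 by case: (f s) => [|[|]].
    rewrite /f; elim/big_rec: _ => // a x _ le; case: (chi _); by rewrite ?mul0n ?mul1n.
  exists (fun s => f s == 1); split.
    have : elemf g f by apply: (@elemf_prod (fun s => aeval (nth 0 s) t) (fun s => chi s)) => //; apply: elemf_aeval.
    by apply: elemf_ext => s; apply: f01.
  move=> s /=; rewrite /f; split=> [/eqP Hp a|Hs].
    rewrite /ashift aeval_subst /= => lt_a; rewrite -/(scons a (nth 0 s)) -nth_scons -Ec.
    move: Hp; rewrite (bigD1_seq a) ?iota_uniq ?mem_index_iota //=.
    by case: (chi _).
  apply/eqP; rewrite big_seq big1 // => a; rewrite mem_index_iota => lt_a.
  have /Ec -> // : sat (nth 0 (a :: s)) A.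
  by rewrite nth_scons; apply: Hs; rewrite /ashift aeval_subst.
Qed.

Lemma elemf_D0 P : D0 P -> exists chi : seq nat -> bool,
  elemf g (fun s => chi s) /\ forall s, chi s <-> P (nth 0 s).
Proof.
by move=> [A /elemf_Delta0 [chi [Hc Ec]] HP]; exists chi; split=> // s; rewrite Ec HP.
Qed.

(** The value is found by a bounded search, as a bounded sum of which a single
    summand survives. The variable 1 of [P] is the bound, so that it can also
    bound the quantifiers of [P]. *)
Lemma elementary_of_graph n (f : n.-tuple nat -> nat) (P : (nat -> nat) -> Prop) bd :
  D0 P -> elemf g bd ->
  (forall v : n.-tuple nat, f v <= bd v) ->
  (forall (v : n.-tuple nat) y, P (scons y (scons (bd v) (nth 0 v))) <-> y = f v) ->
  elementary_in g f.
Proof.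
move=> /elemf_D0 [chi [Hc Ec]] Hbd le_f HP.
have H1 : elemf g (fun s => \sum_(0 <= y < (nth 0 s 0).+1) chi (y :: s) * nth 0 (y :: s) 0).
  apply: (@elemf_sum (fun s => (nth 0 s 0).+1) (fun s => chi s * nth 0 s 0)).
    exact/elemf_succ/elemf_nth.
  by apply: elemf_mul => //; apply: elemf_nth.
apply: elem_ext (elementary_cons (H1 n.+1) Hbd) => v /=.
rewrite (bigD1_seq (f v)) ?iota_uniq ?mem_index_iota ?ltnS ?le_f //=.
have chiP y : chi [:: y, bd v & v] <-> y = f v by rewrite Ec !nth_scons HP.
rewrite (proj2 (chiP (f v)) erefl) mul1n big1 ?addn0 // => y /eqP ne.
by case E : (chi _) => //; case: ne; apply/chiP.
Qed.

End Elementary.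

(** The variable 1, which [B] skips, is left for the bound on the witnesses. *)
Lemma D0_witness l B b : Delta0 B -> tm b ->
  D0 (fun e => exists ys, [/\ size ys = l, all (leq^~ (b e)) ys &
      sat (lcons ys (scons (e 0) (fun x => e x.+2))) B]).
Proof.
move=> HB Hb; have H : D0 (fun e => sat e B) by exists B.
pose sub (e : nat -> nat) x := if x < l then e x else if x == l then e l else e x.+1.
have H' : D0 (fun e => sat (sub e) B).
  apply: D0_subst H _ => x; rewrite /sub; case: (x < l); first exact: tm_var.
  by case: (x == l); apply: tm_var.
apply: D0_ext (D0_bexs l Hb H') => e; split=> -[ys [sy Hy Hs]]; exists ys; split=> //;
  move: Hs; congr sat; apply: functional_extensionality => x; rewrite /sub;
  rewrite !(lcons_nth 0) sy; case: ltnP => // le; case: eqP => [->|/eqP ne];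
  rewrite ?ltnn ?subnn //; (have -> : (x.+1 < l) = false by lia);
  by case E : (x - l) => [|j] /=; [lia|congr e; lia].
Qed.

(** * Provably recursive functions are elementary *)

Lemma elemf_sumn g : elemf g sumn.
Proof.
have H p : elemf g (fun s => sumn (take p s)).
  elim: p => [|p IHp].
    by apply: elemf_ext (elemf_const g 0) => s; rewrite take0.
  apply: elemf_ext (elemf_add IHp (elemf_nth g p)) => s.
  have [le|lt] := leqP (size s) p.
    by rewrite nth_default // addn0 !take_oversize //; lia.
  by rewrite (take_nth 0) // sumn_rcons.
by move=> n; apply: elem_ext (H n n) => v; rewrite take_oversize ?size_tuple.
Qed.

Lemma nth_lcons s : nth 0 s = lcons s (fun=> 0).
Proof.
apply: functional_extensionality => x; rewrite (lcons_nth 0).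
by case: ltnP => // le; rewrite nth_default.
Qed.

(** Forcing bounds both the values and the witnesses of a provably recursive
    function, so its values can be found by a bounded search. *)
Theorem provably_recursive_elementary k m n (f : n.-tuple nat -> nat) :
  provably_recursive (TIR k m) f ->
  exists q G, fast_growing (omega_pow_mul_add (1 + k) m q) G /\ elementary_in G f.
Proof.
move=> [A [/Sigma1_shape [l [B -> HB]] _ HA HT]].
have [q Hq] : exists q, forall v, size v = n ->
    witness l.+1 (Fmq k m q (sumn v).+1) (lcons v (fun=> 0)) B by apply: TIR_witness.
exists q, (Fmq k m q); split; first by rewrite Fmq_jumps; apply: fast_growing_jumps.
pose bd v := Fmq k m q (sumn v).+1.
have Hbd : elemf (Fmq k m q) bd by apply/elemf_oracle/elemf_succ/elemf_sumn.
have Hf (v : n.-tuple nat) : exists ys, [/\ size ys = l, all (leq^~ (bd v)) (f v :: ys) &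
    sat (lcons ys (scons (f v) (nth 0 v))) B].
  have [ys] := Hq v (size_tuple v); case/lastP: ys => [[]//|ys y].
  rewrite size_rcons all_rcons lcons_rcons -nth_lcons => -[[sy] Hy Hs]; exists ys.
  suff <- : y = f v by [].
  by apply/esym/HA; rewrite nth_scons; apply/sat_Exs; exists ys.
apply: (elementary_of_graph (D0_witness l HB (tm_var 1)) Hbd) => v.
  by have [ys [_ /andP[]]] := Hf v.
move=> y; split=> [[ys [sy Hy Hs]]|->].
  by apply/esym/HA; rewrite nth_scons; apply/sat_Exs; exists ys.
by have [ys [sy /andP[_ Hy] Hs]] := Hf v; exists ys.
Qed.

(** * The graph of the fast growing functions is bounded *)

(** Any injective pairing given by a term of the language will do. *)
Definition pr (a b : nat) : nat := (a + b) * (a + b) + a.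

Lemma pr_inj a b a' b' : pr a b = pr a' b' -> a = a' /\ b = b'.
Proof. by rewrite /pr => H; case: (ltngtP (a + b) (a' + b')) => ?; nia. Qed.

Lemma pr_gel a b : a <= pr a b.
Proof. exact: leq_addl. Qed.

Lemma pr_ger a b : b <= pr a b.
Proof. by rewrite /pr; nia. Qed.

Lemma pr_mono a b a' b' : a <= a' -> b <= b' -> pr a b <= pr a' b'.
Proof. by move=> ? ?; rewrite /pr leq_add // leq_mul // leq_add. Qed.

Lemma tm_pr a b : tm a -> tm b -> tm (fun e => pr (a e) (b e)).
Proof. by move=> Ha Hb; apply: tm_add => //; apply: tm_mul; apply: tm_add. Qed.

Definition vcode (xs : seq nat) : nat := foldr pr 0 xs.

Lemma vcode_inj xs ys : size xs = size ys -> vcode xs = vcode ys -> xs = ys.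
Proof.
elim: xs ys => [|x xs IHxs] [|y ys] //= [eq_s] /pr_inj [-> eq_c].
by rewrite (IHxs ys).
Qed.

Lemma vcode_mono M xs : all (leq^~ M) xs -> vcode xs <= vcode (nseq (size xs) M).
Proof. by elim: xs => //= x xs IHxs /andP[le_x /IHxs]; apply: pr_mono. Qed.

(** [pdv xs z ys i]: the value at [z] of the function belonging to the vector
    [xs] is the [i]-fold iterate, at [z], of the function belonging to [ys]. *)
Fixpoint pdv (xs : seq nat) (z : nat) (ys : seq nat) (i : nat) : Prop :=
  match xs, ys with
  | x :: xs', y :: ys' =>
      x = y /\ pdv xs' z ys' i \/
      [/\ xs' = nseq (size xs') 0, x = y.+1 &
        if xs' is [::] then ys' = [::] /\ i = z.+1
        else ys' = z.+1 :: nseq (size xs').-1 0 /\ i = 1]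
  | _, _ => False
  end.

Lemma pdv_spec xs z ys i : pdv xs z ys i ->
  [/\ size ys = size xs, lexlt ys xs, i <= z.+1,
      forall M, all (leq^~ M) xs -> z < M -> all (leq^~ M) ys
    & forall G, vjump xs G z = iter i (vjump ys G) z].
Proof.
elim: xs ys => [|x xs IHxs] [|y ys] //= [[<- /IHxs [-> -> ? Hall HG]]|[Hxs -> Hcase]].
  rewrite ltnn eqxx; split=> // M /andP[-> /Hall]; exact.
case: xs Hxs Hcase {IHxs} => [_ [-> ->]|x' xs Hxs [-> ->]]; rewrite ltnSn.
  by split=> // M /andP[lt_yM _] _; rewrite ltnW.
split=> //=; first by rewrite size_nseq.
  move=> M /andP[lt_yM _] ->; rewrite ltnW //=.
  by apply/allP => w /nseqP [->].
move=> G; rewrite /= in Hxs; case: Hxs => -> ->.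
rewrite size_nseq /= ?size_nseq !vjump_nseq0; reflexivity.
Qed.

(** The recursion of the hierarchy applies to every vector but 0, for which
    [vjump] is the given function. *)
Lemma pdv_exists xs z : xs <> nseq (size xs) 0 -> exists ys i, pdv xs z ys i.
Proof.
elim: xs => [//|x xs IHxs] /= ne.
have [eq0|ne0] := classic (xs = nseq (size xs) 0).
  case: x ne => [|x] ne; first by case: ne; rewrite -eq0.
  case: xs eq0 {IHxs ne} => [|x' xs] eq0.
    by exists [:: x], z.+1; right.
  by exists [:: x, z.+1 & nseq (size xs) 0], 1; right.
by have [ys [i H]] := IHxs ne0; exists (x :: ys), i; left.
Qed.

(** [pdc] is [pdv] on codes of vectors of length [L], with quantifiers bounded
    by the codes; the auxiliary functions give the code of the entries after
    the one decreased and the number of iterations. *)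
Definition lim_code (L z : nat) : nat :=
  if L is L'.+1 then pr z.+1 (vcode (nseq L' 0)) else 0.

Definition lim_iter (L z : nat) : nat := if L is _.+1 then 1 else z.+1.

Fixpoint pdc (L X z Y i : nat) : Prop :=
  if L is L'.+1 then
    exists2 x, x <= X & exists2 X', X' <= X & exists2 y, y <= Y & exists2 Y', Y' <= Y &
      [/\ X = pr x X', Y = pr y Y' &
        x = y /\ pdc L' X' z Y' i \/
        [/\ X' = vcode (nseq L' 0), x = y.+1 &
          Y' = lim_code L' z /\ i = lim_iter L' z]]
  else False.

Lemma pdcP L X z Y i : pdc L X z Y i <->
  exists xs ys, [/\ size xs = L, X = vcode xs, Y = vcode ys & pdv xs z ys i].
Proof.
elim: L X Y => [|L IHL] X Y; first by split=> // -[xs [ys [/size0nil ->]]].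
split=> [[x _ [X' _ [y _ [Y' _ [-> -> H]]]]]|[[|x xs] [[|y ys] [//= sL -> ->]]]].
- case: H => [[<- /IHL [xs [ys [<- -> -> Hpd]]]]|[-> -> [HY Hi]]].
    by exists (x :: xs), (x :: ys); split=> //; left.
  case: L IHL HY Hi => [|L] _ -> ->.
    by exists [:: y.+1], [:: y]; split=> //; right.
  exists (y.+1 :: nseq L.+1 0), [:: y, z.+1 & nseq L 0].
  by split=> //=; rewrite ?size_nseq //; right; rewrite ?size_nseq.

case: sL => sL H; exists x; first exact: pr_gel.
exists (vcode xs); first exact: pr_ger.
exists y; first exact: pr_gel.
exists (vcode ys); first exact: pr_ger.
split=> //; case: H => [[-> Hpd]|[Hxs -> Hcase]].
  by left; split=> //; apply/IHL; exists xs, ys.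
right; split=> //; first by rewrite Hxs sL.
case: xs Hcase sL {Hxs} => [|x' xs] [-> ->] <- //.
Qed.

Ltac d0_user ::= first [apply D0_code_mem | apply D0_dvdn | apply D0_and3 | apply D0_and4 | apply tm_pr].

Lemma tm_lim_code L z : tm z -> tm (fun e => lim_code L (z e)).
Proof. by case: L => [|L] Hz; rewrite /lim_code; d0. Qed.

Lemma tm_lim_iter L z : tm z -> tm (fun e => lim_iter L (z e)).
Proof. by case: L => [|L] Hz; rewrite /lim_iter; d0. Qed.

Lemma D0_pdc L X z Y i : tm X -> tm z -> tm Y -> tm i ->
  D0 (fun e => pdc L (X e) (z e) (Y e) (i e)).
Proof.
move=> HX Hz HY Hi; have H : D0 (fun e => pdc L (e 0) (e 1) (e 2) (e 3)).
  elim: L {HX Hz HY Hi} => [|L IHL]; first exact: D0_False.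
  have Hc X' z' Y' i' : D0 (fun e => pdc L (e X') (e z') (e Y') (e i')).
    have H' := D0_sub (ts := [:: fun e => e X'; fun e => e z'; fun e => e Y'; fun e => e i']) IHL.
    by apply: H'; d0_in.
  simpl; repeat (first [apply Hc | apply tm_lim_code | apply tm_lim_iter | d0_step]; cbv beta).
have H' := D0_sub (ts := [:: X; z; Y; i]) H; apply: H'; d0_in.
Qed.

Definition tup (X i z y : nat) : nat := pr X (pr i (pr z y)).

Lemma tup_inj X i z y X' i' z' y' : tup X i z y = tup X' i' z' y' ->
  [/\ X = X', i = i', z = z' & y = y'].
Proof. by move=> /pr_inj [-> /pr_inj [-> /pr_inj [-> ->]]]. Qed.

Lemma tup_ge X i z y :
  [/\ X <= tup X i z y, i <= tup X i z y, z <= tup X i z y & y <= tup X i z y].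
Proof.
have H1 := pr_ger i (pr z y); have H2 := pr_ger X (pr i (pr z y)).
rewrite /tup pr_gel; split=> //; apply: leq_trans H2; first exact: pr_gel.
  exact: leq_trans (pr_gel _ _) H1.
exact: leq_trans (pr_ger _ _) H1.
Qed.

Lemma tm_tup X i z y : tm X -> tm i -> tm z -> tm y ->
  tm (fun e => tup (X e) (i e) (z e) (y e)).
Proof. by move=> *; do ! apply: tm_pr. Qed.

Ltac d0_user ::= first [apply D0_code_mem | apply D0_dvdn | apply D0_and3
  | apply D0_and4 | apply tm_tup | apply tm_pr | apply D0_pdc].

(** A fact [tup X i z y] says that the [i]-fold iterate at [z] of the function
    with code [X] is [y]; iterates are composed, and single applications are
    unfolded by [pdc]. *)
Definition fg_step (L b : nat) (S : nat -> Prop) (t : nat) : Prop :=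
  exists2 X, X <= t & exists2 i, i <= t & exists2 z, z <= t & exists2 y, y <= t &
    t = tup X i z y /\
    ((i = 0 /\ y = z) \/
     (exists2 i', i' < i & [/\ i = i'.+1, 0 < i' &
        exists2 y', y' <= y & S (tup X i' z y') /\ S (tup X 1 y' y)]) \/
     [/\ i = 1, X = vcode (nseq L 0) & y = z.+1] \/
     (i = 1 /\ exists2 Y, Y <= b & exists2 j, j <= z.+1 &
        pdc L X z Y j /\ S (tup Y j z y))).

Definition fg_graph (L X i z y b : nat) : Prop := table (fg_step L b) b (tup X i z y).

Lemma D0_fg_graph L X i z y b : tm X -> tm i -> tm z -> tm y -> tm b ->
  D0 (fun e => fg_graph L (X e) (i e) (z e) (y e) (b e)).
Proof.
move=> HX Hi Hz Hy Hb.
have H : D0 (fun e => table (fg_step L (e 0)) (e 0) (e 1)).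
  apply: (@D0_table (fun _ b => fg_step L b) (fun e => e 0) (fun e => e 1)); first by d0.
    by d0.
  by rewrite /fg_step; d0.
have H' := D0_sub (ts := [:: b; fun e => tup (X e) (i e) (z e) (y e)]) H.
by apply: H'; d0_in.
Qed.

(** Induction along the lexicographic order of the vectors, and for each of
    them on the number of iterations. *)
Lemma fg_graph_sound L xs i z y b : size xs = L ->
  fg_graph L (vcode xs) i z y b -> y = iter i (vjump xs succn) z.
Proof.
move=> sL; pose P t := forall xs i z y, size xs = L -> t = tup (vcode xs) i z y ->
  y = iter i (vjump xs succn) z.
suff H (S : nat -> Prop) : (forall t, S t -> fg_step L b S t) -> forall t, S t -> P t.
  by move=> /(table_sound (P := P) H); apply.
move=> HS; suff H ws : size ws = L -> forall j x w, S (tup (vcode ws) j x w) ->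
    w = iter j (vjump ws succn) x.
  by move=> t St ws j x w sws Et; apply: H => //; rewrite -Et.
move: ws; apply: lexlt_wf => ws sws IH; elim/ltn_ind => j IHj x w /HS.
case=> [_ _ [_ _ [_ _ [_ _ [/tup_inj [<- <- <- <-]]]]]].
case=> [[-> ->] //|[[j' lt_j [Ej j'_gt0 [y' _ [S1 S2]]]]|[[-> /vcode_inj E ->]|[-> [Y _ [j' _ [/pdcP]]]]]]].
- by rewrite Ej /= -(IHj _ lt_j _ _ S1) [LHS](IHj 1 _ _ _ S2) // Ej ltnS.
- by rewrite (E _) ?size_nseq // vjump_nseq0.
- move=> [xs' [ys [sxs E -> Hpd]]] Sy.
  have Exs : ws = xs' by apply: vcode_inj E; rewrite sws sxs.
  have [sys lt _ _ HG] := pdv_spec Hpd.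
  by rewrite /= Exs HG; apply: IH Sy; rewrite ?sys // Exs.
Qed.

Definition fg_cap (L M : nat) : nat := tup (vcode (nseq L M)) M M M.

(** Vectors, arguments and values in the recursion never exceed the value to be
    computed, so the true facts below [fg_cap L M] form a table. *)
Lemma fg_graph_complete L xs i z y b M : size xs = L ->
  all (leq^~ M) xs -> i <= M -> z <= M -> y <= M -> 0 < M ->
  roomy (fg_cap L M) b -> y = iter i (vjump xs succn) z ->
  fg_graph L (vcode xs) i z y b.
Proof.
move=> sL Hxs le_i le_z le_y M_gt0 Hb Hy.
pose P t := exists xs i z y, [/\ size xs = L, all (leq^~ M) xs, [/\ i <= M, z <= M & y <= M],
  t = tup (vcode xs) i z y & y = iter i (vjump xs succn) z].
have capP t : P t -> t <= fg_cap L M.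
  move=> [ws [j [x [w [sws Hws [? ? ?] -> _]]]]].
  by rewrite /fg_cap -sws; do ! apply: pr_mono => //; apply: vcode_mono.
have le_cap : fg_cap L M <= b by case: Hb => ? _ [? _ []].
have Pt : P (tup (vcode xs) i z y) by exists xs, i, z, y.
apply: (table_complete Hb (capP _ Pt) Pt) => t _.
move=> [ws [j [x [w [sws Hws [le_j le_x le_w] -> Ew]]]]].
have Hin u : P u -> u <= fg_cap L M /\ P u by move=> Pu; split=> //; apply: capP.
have [leX lei lez ley] := tup_ge (vcode ws) j x w.
exists (vcode ws) => //; exists j => //; exists x => //; exists w => //; split=> //.
have nv : nice (vjump ws succn) by apply/nice_vjump/nice_succ.
case: j le_j Ew {lei leX lez ley} => [|[|j]] le_j Ew; first by left.
- right; right; have [E0|ne0] := classic (ws = nseq (size ws) 0).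
    by left; split=> //; [rewrite E0 sws|rewrite Ew /= E0 vjump_nseq0].
  right; split=> //; have [ys [j Hpd]] := pdv_exists x ne0.
  have [sys lt le_jx Hall HG] := pdv_spec Hpd.
  have lt_xw : x < w by rewrite Ew; apply: nv.1.
  have PY : P (tup (vcode ys) j x w).
    exists ys, j, x, w; split=> //; first by rewrite sys.
    - by apply: Hall => //; apply: leq_trans le_w.
    - by split=> //; apply: leq_trans le_jx _; apply: leq_trans le_w.
    by rewrite Ew -HG.
  exists (vcode ys); last first.
    by exists j => //; split; [apply/pdcP; exists ws, ys|apply: Hin].
  apply: leq_trans le_cap; apply: leq_trans (capP _ PY).
  by have [] := tup_ge (vcode ys) j x w.
- right; left; exists j.+1 => //; split=> //.
  have le_yw : iter j.+1 (vjump ws succn) x <= w by rewrite Ew; apply: nice_ge.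
  exists (iter j.+1 (vjump ws succn) x) => //; split; apply: Hin.
    exists ws, j.+1, x, (iter j.+1 (vjump ws succn) x); split=> //.
    by split=> //; [apply: ltnW|apply: leq_trans le_w].
  exists ws, 1, (iter j.+1 (vjump ws succn) x), w; split=> //.
  by split=> //; apply: leq_trans le_w.
Qed.

Lemma tm_vcode_nseq L M : tm M -> tm (fun e => vcode (nseq L (M e))).
Proof. by move=> HM; elim: L => [|L IHL]; [apply: tm_const|apply: tm_pr]. Qed.

Lemma tm_fg_cap L M : tm M -> tm (fun e => fg_cap L (M e)).
Proof. by move=> HM; apply: tm_tup => //; apply: tm_vcode_nseq. Qed.

(** * Bounded graphs of elementary functions *)

(** The vector of omega^(1+k) * m + q for [vjump]. *)
Definition vmq (k m q : nat) : seq nat := m :: rcons (nseq k 0) q.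

Lemma size_vmq k m q : size (vmq k m q) = k.+2.
Proof. by rewrite /= size_rcons size_nseq. Qed.

Lemma vjump_vmq k m q : vjump (vmq k m q) succn = Fmq k m q.
Proof.
rewrite /= vjump_rcons size_rcons size_nseq /Fmq.
have -> : rcons (nseq k 0) 0 = nseq k.+1 0 by elim: k => //= k ->.
by rewrite vjump_nseq0.
Qed.

Lemma all_vmq k m q M : m <= M -> q <= M -> all (leq^~ M) (vmq k m q).
Proof.
by move=> le_m le_q; rewrite /= le_m all_rcons le_q /=; apply/allP => x /nseqP [->].
Qed.

Lemma D0_nth P (L : (nat -> nat) -> seq nat) : D0 P ->
  (forall x, tm (fun e => nth 0 (L e) x)) -> D0 (fun e => P (nth 0 (L e))).
Proof. exact: D0_subst. Qed.

Lemma tm_nth_cons f (L : (nat -> nat) -> seq nat) : tm f ->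
  (forall x, tm (fun e => nth 0 (L e) x)) -> forall x, tm (fun e => nth 0 (f e :: L e) x).
Proof. by move=> Hf HL [|x] //=. Qed.

Lemma tm_nth_mkseq (g : (nat -> nat) -> nat -> nat) n : (forall j, tm (fun e => g e j)) ->
  forall x, tm (fun e => nth 0 (mkseq (g e) n) x).
Proof.
move=> Hg x; have [le|lt] := leqP n x.
  suff -> : (fun e => nth 0 (mkseq (g e) n) x) = (fun=> 0) by apply: tm_const.
  by apply: functional_extensionality => e; rewrite nth_default ?size_mkseq.
suff -> : (fun e => nth 0 (mkseq (g e) n) x) = (fun e => g e x) by [].
by apply: functional_extensionality => e; rewrite nth_mkseq.
Qed.

Ltac tml := repeat first [apply tm_nth_cons; [solve [d0]|]];
  first [apply tm_nth_mkseq; intro; d0 | intro; apply tm_const].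

Section Dominated2.

Variables (G : nat -> nat) (nG : nice G).

Lemma dominated_pr E E' : dominated G E -> dominated G E' -> dominated G (fun x => pr (E x) (E' x)).
Proof.
move=> HE HE'; have HD : dominated G (fun x => E x + E' x) by apply: dominated_add.
by apply: dominated_add => //; apply: dominated_mul.
Qed.

Lemma dominated_fg_cap L E : dominated G E -> dominated G (fun x => fg_cap L (E x)).
Proof.
move=> HE; have Hv : dominated G (fun x => vcode (nseq L (E x))).
  by elim: L => [|L IHL]; [apply: dominated_const|apply: dominated_pr].
by do ! apply: dominated_pr.
Qed.

(** [f] has a bounded graph with one extra argument that has to be large: for
    it any value above the bound on the right will do. *)
Definition bounded_graph n (f : n.-tuple nat -> nat) : Prop :=
  exists P q, [/\ D0 P,
    forall (v : n.-tuple nat) y b, P (nth 0 [:: y, b & v]) -> y = f v,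
    forall (v : n.-tuple nat) b, iter q (jump 0) G (sumn v).+1 <= b ->
      P (nth 0 [:: f v, b & v])
  & forall v : n.-tuple nat, f v <= iter q (jump 0) G (sumn v).+1].

(** The bound on witnesses may be any dominated function. *)
Lemma bounded_graph_intro n (f : n.-tuple nat -> nat) P W : D0 P -> dominated G W ->
  (forall (v : n.-tuple nat) y b, P (nth 0 [:: y, b & v]) -> y = f v) ->
  (forall (v : n.-tuple nat) b, W (sumn v) <= b -> P (nth 0 [:: f v, b & v])) ->
  (forall v : n.-tuple nat, f v <= W (sumn v)) -> bounded_graph f.
Proof.
move=> HP [q Hq] Hs Hc Hle; exists P, q; split=> // v.
- by move=> b /(leq_trans (Hq _)); apply: Hc.
- exact: leq_trans (Hle v) (Hq _).
Qed.

Lemma D0_finall (I : finType) (Q : I -> (nat -> nat) -> Prop) :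
  (forall i, D0 (Q i)) -> D0 (fun e => forall i, Q i e).
Proof.
move=> HQ; suff H (s : seq I) : D0 (fun e => forall i, i \in s -> Q i e).
  by apply: D0_ext (H (enum I)) => e; split=> h i => [|_]; apply: h; rewrite mem_enum.
elim: s => [|i s IHs]; first by apply: D0_ext (D0_const True) => e.
apply: D0_ext (D0_and (HQ i) IHs) => e; split=> [[hi hs] j|h].
  by rewrite inE => /orP[/eqP ->|/hs].
by split=> [|j Hj]; apply: h; rewrite inE ?eqxx ?Hj ?orbT.
Qed.

Lemma nth_sumn (s : seq nat) i : nth 0 s i <= sumn s.
Proof.
elim: s i => [|x s IHs] [|i] //=; first exact: leq_addr.
exact: leq_trans (IHs i) (leq_addl _ _).
Qed.

Lemma bounded_graph_ext n (f f' : n.-tuple nat -> nat) :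
  f =1 f' -> bounded_graph f -> bounded_graph f'.
Proof. by move=> /functional_extensionality ->. Qed.

Lemma bounded_graph_comp n p (h : p.-tuple nat -> nat) (hs : 'I_p -> n.-tuple nat -> nat) :
  bounded_graph h -> (forall i, bounded_graph (hs i)) ->
  bounded_graph (fun v : n.-tuple nat => h [tuple hs i v | i < p]).
Proof.
move=> [P [q [HP Ps Pc Ple]]] Hhs.
pose R i := sval (constructive_indefinite_description _ (Hhs i)).
have HR i := svalP (constructive_indefinite_description _ (Hhs i)).
pose r i := sval (constructive_indefinite_description _ (HR i)).
have HRr i : [/\ D0 (R i),
    forall (v : n.-tuple nat) y b, R i (nth 0 [:: y, b & v]) -> y = hs i v,
    forall (v : n.-tuple nat) b, iter (r i) (jump 0) G (sumn v).+1 <= b ->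
      R i (nth 0 [:: hs i v, b & v])
  & forall v : n.-tuple nat, hs i v <= iter (r i) (jump 0) G (sumn v).+1].
  exact: (svalP (constructive_indefinite_description _ (HR i))).
pose w x := \max_(i < p) iter (r i) (jump 0) G x.+1.
have Dw : dominated G w.
  exists (\max_(i < p) r i) => x; apply/bigmax_leqP => i _; apply: iter_jump_leq => //.
  exact: leq_bigmax.
pose W x := maxn (w x) (iter q (jump 0) G (p * w x).+1).
have DW : dominated G W.
  apply: dominated_max => //.
  apply: (@dominated_comp _ nG (iter q (jump 0) G) (fun x => (p * w x).+1)).
    exact: dominated_iter.
  by apply: dominated_succ => //; apply: dominated_mul => //; apply: dominated_const.
have le_hs v i : hs i v <= w (sumn v).
  case: (HRr i) => _ _ _ /(_ v) /leq_trans; apply.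
  exact: (@leq_bigmax _ (fun i => iter (r i) (jump 0) G (sumn v).+1) i).
have le_sum v : sumn [tuple hs i v | i < p] <= p * w (sumn v).
  have suml (s : seq nat) c : all (leq^~ c) s -> sumn s <= size s * c.
    by elim: s => //= x s IHs /andP[le_x /IHs le_s]; rewrite mulSn leq_add.
  have := @suml [tuple hs i v | i < p] (w (sumn v)); rewrite size_tuple; apply.
  by apply/allP => x /tnthP [i ->]; rewrite tnth_mktuple.
pose Q e := P (nth 0 [:: e p, e p.+1 & mkseq e p]) /\
  forall i : 'I_p, R i (nth 0 [:: e i, e p.+1 & mkseq (fun j => e (p + j.+2)) n]).
have HQ : D0 Q.
  apply: D0_and.
    by apply: D0_nth => //; tml.
  by apply: D0_finall => i; case: (HRr i) => HRi _ _ _; apply: D0_nth => //; tml.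
have Q_at zs y b (v : n.-tuple nat) : size zs = p ->
    Q (lcons zs (nth 0 [:: y, b & v])) <->
    P (nth 0 [:: y, b & zs]) /\ forall i : 'I_p, R i (nth 0 [:: nth 0 zs i, b & v]).
  move=> sz; rewrite /Q; set e := lcons zs _.
  have -> : e p = y by rewrite /e (lcons_nth 0) sz ltnn subnn.
  have -> : e p.+1 = b by rewrite /e (lcons_nth 0) sz ltnNge leqnSn subSnn.
  have -> : mkseq e p = zs.
    apply: (@eq_from_nth _ 0); rewrite size_mkseq // => i lt_i.
    by rewrite nth_mkseq // /e (lcons_nth 0) sz lt_i.
  have -> : mkseq (fun j => e (p + j.+2)) n = v.
    apply: (@eq_from_nth _ 0); rewrite size_mkseq ?size_tuple // => i lt_i.
    rewrite nth_mkseq // /e (lcons_nth 0) sz; have -> : (p + i.+2 < p) = false by lia.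
    by rewrite addKn.
  have E (i : 'I_p) : e i = nth 0 zs i by rewrite /e (lcons_nth 0) sz ltn_ord.
  by split=> -[HPz HRz]; split=> // i; move: (HRz i); rewrite E.
apply: (bounded_graph_intro (D0_bexs p (tm_var 1) HQ) DW) => v.
- move=> y b [zs [sz _ /(Q_at _ _ _ _ sz) [HPz HRz]]].
  have Ezs : zs = [tuple hs i v | i < p].
    apply: (@eq_from_nth _ 0); rewrite sz ?size_tuple // => i lt_i.
    have [_ Hs _ _] := HRr (Ordinal lt_i).
    by rewrite (Hs _ _ _ (HRz (Ordinal lt_i))) -[RHS](tnth_nth 0 _ (Ordinal lt_i)) tnth_mktuple.
  by apply: (Ps _ _ b); rewrite -Ezs.
- move=> b; rewrite geq_max => /andP[le_w le_q].
  exists [tuple hs i v | i < p]; split; first exact: size_tuple.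
    by apply/allP => x /tnthP [i ->]; rewrite tnth_mktuple; apply: leq_trans le_w.
  apply/Q_at; first exact: size_tuple.
  split; first by apply: Pc; apply: leq_trans le_q; apply: (nice_iter_jump _ _ nG).2; apply: (le_sum v).
  move=> i; rewrite -tnth_nth tnth_mktuple; case: (HRr i) => _ _ Hc _; apply: Hc.
  apply: leq_trans le_w; exact: (@leq_bigmax _ (fun i => iter (r i) (jump 0) G (sumn v).+1) i).
- apply: leq_trans (Ple _) _; apply: leq_trans (leq_maxr _ _).
  by apply: (nice_iter_jump _ _ nG).2; apply: (le_sum v).
Qed.

(** ** Bounded sums and products *)

(** Sums and products differ only in the operation and in its bound. *)
Section BoundedBig.

Variables (idx : nat) (op : nat -> nat -> nat).
Hypothesis D0_op : tm (fun e => op (e 0) (e 1)).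
Hypothesis big_recr : forall F i,
  \big[op/idx]_(0 <= j < i.+1) F j = op (\big[op/idx]_(0 <= j < i) F j) (F i).
Hypothesis big_bound : forall F i w, (forall j, j < i -> F j <= w) ->
  \big[op/idx]_(0 <= j < i) F j <= idx + i * w + w.+1 ^ i.

Lemma bounded_graph_big n (h : n.+1.-tuple nat -> nat) : bounded_graph h ->
  bounded_graph (fun v : n.+1.-tuple nat =>
    \big[op/idx]_(0 <= i < thead v) h [tuple of i :: behead_tuple v]).
Proof.
move=> [P [q [HP Ps Pc Ple]]].
pose step (e : nat -> nat) (b : nat) (S : nat -> Prop) (t : nat) : Prop :=
  exists2 i, i <= t & exists2 r, r <= t & t = pr i r /\
   ((i = 0 /\ r = idx) \/
    exists2 i', i' < i & exists2 r', r' <= b & exists2 z, z <= b &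
      [/\ i = i'.+1, r = op r' z,
          P (nth 0 [:: z, b, i' & mkseq (fun j => e j.+3) n]) & S (pr i' r')]).
pose Q (e : nat -> nat) := table (step e (e 1)) (e 1) (pr (e 2) (e 0)).
have HQ : D0 Q.
  apply: (@D0_table step (fun e => e 1) (fun e => pr (e 2) (e 0))); [by d0|by d0|].
  have HP' a c d (g : nat -> nat) :
      D0 (fun e => P (nth 0 [:: e a, e c, e d & mkseq (fun j => e (g j)) n])).
    by apply: D0_nth => //; tml.
  have D0_op' r r' z : D0 (fun e => e r = op (e r') (e z)).
    apply: D0_eq; first exact: tm_var.
    apply: (tm_subst (s := fun e x => if x == 0 then e r' else e z) D0_op) => x.
    by case: (x == 0); apply: tm_var.
  by rewrite /step; repeat (first [apply HP' | apply D0_op' | d0_step]; cbv beta).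
have Q_at x y b (v : n.-tuple nat) : Q (nth 0 [:: y, b, x & v]) <->
    table (fun S t => exists2 i, i <= t & exists2 r, r <= t & t = pr i r /\
     ((i = 0 /\ r = idx) \/
      exists2 i', i' < i & exists2 r', r' <= b & exists2 z, z <= b &
        [/\ i = i'.+1, r = op r' z, P (nth 0 [:: z, b, i' & v]) & S (pr i' r')]))
      b (pr x y).
  rewrite /Q /step /=.
  have -> : mkseq (fun j => nth 0 v j) n = v.
    by rewrite -[X in mkseq _ X](size_tuple v) mkseq_nth.
  by [].
pose F (v : n.-tuple nat) i := h [tuple of i :: v].
pose partial v i := \big[op/idx]_(0 <= j < i) F v j.
pose w x := iter q (jump 0) G x.+1.
pose M x := idx + x * w x + (w x).+1 ^ x.
pose W x := room (pr x (M x)) + w x.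
have Dw : dominated G w by exists q.
have DM : dominated G M.
  apply: dominated_add => //; last by apply: dominated_exp => //; [apply: dominated_succ|apply: dominated_id].
  apply: dominated_add => //; first exact: dominated_const.
  by apply: dominated_mul => //; apply: dominated_id.
have DW : dominated G W.
  apply: dominated_add => //; apply: dominated_room => //; apply: dominated_pr => //.
  exact: dominated_id.
have w_mono x y : x <= y -> w x <= w y by move=> le; apply: (nice_iter_jump _ _ nG).2.
have F_le v i x : i <= x -> F v i <= w (x + sumn v).
  move=> le; apply: leq_trans (Ple _) _; apply: w_mono => /=; rewrite leq_add2r //.
have partial_le v i x : i <= x -> partial v i <= M (x + sumn v).
  move=> le; apply: leq_trans (big_bound (w := w (x + sumn v)) _) _.
    by move=> j lt_j; apply: F_le; apply: leq_trans le; apply: ltnW.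
  rewrite /M !leq_add // ?leq_mul ?leq_pexp2l //; apply: leq_trans le (leq_addr _ _).
have E (v : n.+1.-tuple nat) : exists x (u : n.-tuple nat), [/\ v = [tuple of x :: u],
    tval v = x :: u & \big[op/idx]_(0 <= i < thead v) h [tuple of i :: behead_tuple v] = partial u x].
  case/tupleP: v => x u; exists x, u; split=> //; rewrite theadE.
  by apply: eq_bigr => i _; congr h; apply: val_inj.
apply: (bounded_graph_intro HQ DW) => v; have [x [u [_ -> ->]]] := E v.
- move=> y b /Q_at Ht.
  apply: (@table_sound _ (fun t => forall i r, t = pr i r -> r = partial u i)
    _ _ _ Ht x y erefl) => S HS t St.
  move=> i; elim: i t St => [|i IHi] t /HS [i0 _ [r0 _ [-> Hc]]] r /pr_inj [Ei <-].
    by case: Hc => [[_ ->]|[i' lt_i]]; [rewrite /partial big_geq|move: lt_i; rewrite Ei].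
  case: Hc => [[E0]|[i' _ [r' _ [z _ [Ei' -> HPz HS']]]]]; first by rewrite E0 in Ei.
  move: Ei' HPz HS'; rewrite Ei => -[<-] HPz HS'.
  rewrite /partial big_recr; congr op; first exact: (IHi _ HS').
  exact: (Ps [tuple of i :: u] z b HPz).
- move=> b le_b; apply/Q_at; rewrite [sumn _]/= in le_b.
  pose N := pr (x + sumn u) (M (x + sumn u)).
  have HN : roomy N b.
    by apply: roomy_leq (roomy_room N) => //; apply: leq_trans le_b; apply: leq_addr.
  have le_bw : w (x + sumn u) <= b by apply: leq_trans le_b; apply: leq_addl.
  have le_bN : N <= b by case: HN => ? _ [? _ []].
  have capP i : i <= x -> pr i (partial u i) <= N.
    by move=> le; apply: pr_mono; [apply: leq_trans le (leq_addr _ _)|apply: partial_le].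
  apply: (@table_complete _ (fun t => exists2 i, i <= x & t = pr i (partial u i)) N) => //.
  + exact: capP.
  + by exists x.
  move=> t _ [i le_i ->]; exists i; first exact: pr_gel.
  exists (partial u i); first exact: pr_ger.
  split=> //; case: i le_i => [|i] lt_i; first by left; rewrite /partial big_geq.
  have le_i := ltnW lt_i.
  right; exists i => //; exists (partial u i).
    apply: leq_trans le_bN; apply: leq_trans (capP _ le_i); exact: pr_ger.
  exists (F u i); first by apply: leq_trans le_bw; apply: F_le.
  split; [by []|exact: big_recr| |].
    apply: (Pc [tuple of i :: u]); apply: leq_trans le_bw.
    by apply: (w_mono (i + sumn u)); rewrite leq_add2r.
  by split; [apply: capP|exists i].
- rewrite [sumn _]/= /W; apply: leq_trans (leq_addr _ _).
  apply: leq_trans (partial_le u x x (leqnn x)) _.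
  apply: leq_trans (pr_ger (x + sumn u) _) _.
  exact: leq_trans (leq_addr _ _) (leq_addr _ _).
Qed.

End BoundedBig.

Lemma prod_bound F i w : (forall j, j < i -> F j <= w) -> \prod_(0 <= j < i) F j <= w.+1 ^ i.
Proof.
elim: i => [|i IHi] HF; first by rewrite big_geq.
rewrite big_nat_recr //= expnSr leq_mul //; first by apply: IHi => j lt; apply: HF; apply: ltnW.
by apply: leqW; apply: HF.
Qed.

Lemma sum_bound F i w : (forall j, j < i -> F j <= w) -> \sum_(0 <= j < i) F j <= i * w.
Proof.
elim: i => [|i IHi] HF; first by rewrite big_geq.
rewrite big_nat_recr //= mulSnr leq_add //; first by apply: IHi => j lt; apply: HF; apply: ltnW.
exact: HF.
Qed.

Theorem elementary_bounded_graph g n (f : n.-tuple nat -> nat) :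
  bounded_graph (fun v : 1.-tuple nat => g (thead v)) -> elementary_in g f -> bounded_graph f.
Proof.
move=> Hg; elim=> {n f}
  [|n c|n i||||n p h hs _ IHh _ IHhs|n h _ IHh|n h _ IHh|n f f' E _ IHf].
- exact: Hg.
- apply: (@bounded_graph_intro _ _ (fun e => e 0 = c) (fun=> c)) => //; first by d0.
  exact: dominated_const.
- apply: (@bounded_graph_intro _ _ (fun e => e 0 = e i.+2) id) => //; first by d0.
  + exact: dominated_id.
  + by move=> v y b; rewrite /= (tnth_nth 0).
  + by move=> v b _; rewrite /= (tnth_nth 0).
  + by move=> v; rewrite (tnth_nth 0); apply: nth_sumn.
- apply: (@bounded_graph_intro _ _ (fun e => e 0 = (e 2).+1) succn).
  + by d0.
  + by apply: dominated_succ => //; apply: dominated_id.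
  + by move=> v y b; case/tupleP: v => x u; rewrite theadE.
  + by move=> v b; case/tupleP: v => x u; rewrite theadE.
  + by move=> v; case/tupleP: v => x u; rewrite theadE /=; lia.
- apply: (@bounded_graph_intro _ _ (fun e => e 0 = e 2 + e 3) id).
  + by d0.
  + exact: dominated_id.
  + by move=> v y b; rewrite !(tnth_nth 0).
  + by move=> v b _; rewrite /= !(tnth_nth 0).
  + by move=> v; rewrite !(tnth_nth 0); case: v => -[|x [|y []]] //= _; lia.
- apply: (@bounded_graph_intro _ _ (fun e => (e 2 <= e 3 /\ e 0 = 0) \/ e 2 = e 0 + e 3) id).
  + by d0.
  + exact: dominated_id.
  + by move=> v y b; rewrite !(tnth_nth 0) /=; lia.
  + by move=> v b _; rewrite /= !(tnth_nth 0) /=; lia.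
  + by move=> v; rewrite !(tnth_nth 0); case: v => -[|x [|y []]] //= _; lia.
- exact: bounded_graph_comp.
- apply: bounded_graph_big IHh => [|F i|F i w HF]; first by d0.
    by rewrite big_nat_recr.
  by apply: leq_trans (sum_bound HF) _; lia.
- apply: bounded_graph_big IHh => [|F i|F i w HF]; first by d0.
    by rewrite big_nat_recr.
  by apply: leq_trans (prod_bound HF) _; lia.
- exact: bounded_graph_ext E IHf.
Qed.
End Dominated2.

(** The exponent [q'] is free so that this applies over any of the functions
    [Fmq k m q']. *)
Lemma Fmq_bounded_graph k m q q' :
  bounded_graph (Fmq k m q') (fun v : 1.-tuple nat => Fmq k m q (thead v)).
Proof.
have nG := nice_Fmq k m q'.
pose P e := fg_graph k.+2 (vcode (vmq k m q)) 1 (e 2) (e 0) (e 1).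
pose W x := room (fg_cap k.+2 (m + q + x + Fmq k m q x).+1) + Fmq k m q x.
have DF : dominated (Fmq k m q') (Fmq k m q).
  exists q => x; rewrite /Fmq -iterD; apply: leq_trans (iter_jump_leq _ _ _ (leq_addr q' q)).
    by apply: (nice_Fmq k m q).2.
  exact/nice_iter_jump/nice_succ.
apply: (@bounded_graph_intro _ _ _ P W).
- by apply: D0_fg_graph; d0.
- apply: dominated_add => //; apply: dominated_room => //; apply: dominated_fg_cap => //.
  apply: dominated_succ => //; apply: dominated_add => //; apply: dominated_add => //.
    exact: dominated_const.
  exact: dominated_id.
- move=> v y b /(fg_graph_sound (size_vmq k m q)); rewrite vjump_vmq /= => ->.
  by case/tupleP: v => x u; rewrite theadE.
- move=> v b; case/tupleP: v => x u; rewrite (tuple0 u) theadE /= addn0 => le_b.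
  apply: (@fg_graph_complete k.+2 (vmq k m q) 1 x (Fmq k m q x) b (m + q + x + Fmq k m q x).+1).
  + exact: size_vmq.
  + by apply: all_vmq; lia.
  + by lia.
  + by lia.
  + by lia.
  + by [].
  + exact: (roomy_leq (leqnn _) (leq_trans (leq_addr _ _) le_b) (roomy_room _)).
  + by rewrite vjump_vmq.
- move=> v; case/tupleP: v => x u; rewrite (tuple0 u) theadE /= addn0 /W; lia.
Qed.

(** * Completeness of the calculus *)

(** Equality is interpreted by any relation: the theory under consideration
    contains the equality axioms. *)
Record model := Model {
  carrier :> Type;
  m_zero : carrier;
  m_succ : carrier -> carrier;
  m_add : carrier -> carrier -> carrier;
  m_mul : carrier -> carrier -> carrier;
  m_eq : carrier -> carrier -> Prop;
  m_lt : carrier -> carrier -> Prop }.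

Fixpoint meval (M : model) (e : nat -> M) (t : aterm) : M :=
  match t with
  | AVar x => e x
  | AZero => m_zero M
  | ASucc u => m_succ (meval e u)
  | AAdd u v => m_add (meval e u) (meval e v)
  | AMul u v => m_mul (meval e u) (meval e v)
  end.

Fixpoint msat (M : model) (e : nat -> M) (A : formula) : Prop :=
  match A with
  | Eq t u => m_eq (meval e t) (meval e u)
  | Lt t u => m_lt (meval e t) (meval e u)
  | Bot => False
  | Imp B C => msat e B -> msat e C
  | All B => forall a, msat (scons a e) B
  end.

Section Calculus.

Variable T : formula -> Prop.

Lemma d_weak A B : derives T A -> derives T (Imp B A).
Proof. exact: d_mp (d_K _ _ _). Qed.

Lemma d_comp A B C : derives T (Imp A B) -> derives T (Imp B C) -> derives T (Imp A C).
Proof. by move=> HAB HBC; apply: d_mp HAB; apply: d_mp (d_S _ _ _ _) (d_weak _ HBC). Qed.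

Lemma d_id A : derives T (Imp A A).
Proof. exact: d_mp (d_mp (d_S T A (Imp A A) A) (d_K _ _ _)) (d_K _ _ _). Qed.

(** Derivability from finitely many extra hypotheses; the last element of the
    list is the latest hypothesis. *)
Definition pv (H : seq formula) (A : formula) : Prop := derives T (foldr Imp A H).

Lemma pv_rcons H A B : pv (rcons H A) B <-> pv H (Imp A B).
Proof. by rewrite /pv foldr_rcons. Qed.

Lemma pv_derives H A : derives T A -> pv H A.
Proof. by move=> HA; elim: H => //= B H IH; apply: d_weak. Qed.

Lemma pv_mp H A B : pv H (Imp A B) -> pv H A -> pv H B.
Proof.
suff D : derives T (Imp (foldr Imp (Imp A B) H) (Imp (foldr Imp A H) (foldr Imp B H))).
  by move=> HAB HA; apply: d_mp HA; apply: d_mp HAB.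
elim: H => [|C H IH] /=; first exact: d_id.
by apply: d_comp (d_S _ _ _ _); apply: d_mp (d_S _ _ _ _) _; apply: d_weak.
Qed.

Lemma pv_weak H A B : pv H A -> pv (rcons H B) A.
Proof. by move=> HA; apply/pv_rcons; apply: pv_mp HA; apply/pv_derives/d_K. Qed.

Lemma pv_last H A : pv (rcons H A) A.
Proof. by apply/pv_rcons/pv_derives/d_id. Qed.

Lemma pv_dne H A : pv H (Neg (Neg A)) -> pv H A.
Proof. by apply: pv_mp; apply/pv_derives/d_dne. Qed.

Lemma pv_exfalso H A : pv H Bot -> pv H A.
Proof. by move=> HB; apply: pv_dne; apply: pv_mp HB; apply/pv_derives/d_K. Qed.

Lemma derives_Alls n A : derives T A -> derives T (Alls n A).
Proof. by move=> HA; elim: n => //= n IH; apply: d_gen. Qed.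

Lemma fsubst_Alls s n A : fsubst s (Alls n A) = Alls n (fsubst (iter n up s) A).
Proof. by elim: n s => //= n IH s; rewrite IH -iterSr. Qed.

Lemma iter_up n s x : iter n up s x =
  if x < n then AVar x else asubst (fun y => AVar (n + y)) (s (x - n)).
Proof.
elim: n x => [|n IH] x /=; first by rewrite subn0 asubst_id.
case: x => [|x] //=; rewrite IH subSS ltnS; case: ltnP => // _.
by rewrite /ashift asubst_comp; apply: eq_asubst.
Qed.

(** The axioms of [T] are universally valid, so derivability is closed under
    substitution. *)
Lemma derives_subst s A : derives T A -> derives T (fsubst s A).
Proof.
move=> HA; have [n Hn] := fbounded_exists A.
suff H : derives T (fsubst (fun x => if x < n then s x else AVar (x - n)) A).
  by rewrite (fsubst_bounded (s' := fun x => if x < n then s x else AVar (x - n)) Hn) // => x ->.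
move: (derives_Alls n HA) => {HA Hn}; elim: n s A => [|n IH] s A HA.
  by rewrite -[fsubst _ A]/(fsubst (fun x => AVar (x - 0)) A)
    (_ : (fun x => AVar (x - 0)) = AVar) ?fsubst_id //; apply: functional_extensionality => x; rewrite subn0.
have H1 : derives T (finst (s n) (Alls n A)) := d_mp (d_inst T (Alls n A) (s n)) HA.
pose s0 x := if x is y.+1 then AVar y else s n.
pose s1 x := if x < n then s x else AVar (x - n).
have {}H1 := IH s _ (eq_ind _ (derives T) H1 _ (fsubst_Alls s0 n A)).
rewrite fsubst_comp in H1; move: H1; congr (derives T (fsubst _ A)).
apply: functional_extensionality => x; rewrite iter_up ltnS.
case: (ltngtP x n) => [lt|lt|->] /=; first by rewrite lt.
  have -> : x - n = (x - n.+1).+1 by lia.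
  by rewrite /= ltnNge leq_addr /= addKn.
rewrite subnn /= asubst_comp -[RHS]asubst_id; apply: eq_asubst => y /=.
by rewrite ltnNge leq_addr /= addKn.
Qed.

Lemma fsubst_foldr s H A :
  fsubst s (foldr Imp A H) = foldr Imp (fsubst s A) (map (fsubst s) H).
Proof. by elim: H => //= B H ->. Qed.

(** A variable that does not occur in the hypotheses can be generalized: rename
    it to 0 and shift the others, then use [d_gen] and [d_dist]. *)
Lemma pv_fresh N H C : all (fbounded N) H -> fbounded N.+1 C ->
  pv H (finst (AVar N) C) -> pv H (All C).
Proof.
move=> HN CN HC.
pose s x := if x < N then AVar x.+1 else AVar 0.
have := d_gen (derives_subst s HC); rewrite fsubst_foldr.
have -> : map (fsubst s) H = map fshift H.
  elim: H HN {HC} => //= A H IH /andP[HA /IH ->]; congr cons.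
  by apply: fsubst_bounded HA _ => x; rewrite /s => ->.
have -> : fsubst s (finst (AVar N) C) = C.
  rewrite /finst fsubst_comp -[RHS]fsubst_id; apply: fsubst_bounded CN _ => -[|x] /=.
    by rewrite /s ltnn.
  by rewrite ltnS /s => ->.
apply: d_mp; elim: H {HN HC} => [|A H IH] /=; first exact: d_id.
apply: d_comp (d_dist _ _ _) _.
by apply: d_mp (d_S _ _ _ _) _; apply: d_weak.
Qed.

Fixpoint encode_term (t : aterm) : GenTree.tree nat :=
  match t with
  | AVar x => GenTree.Leaf x
  | AZero => GenTree.Node 0 [::]
  | ASucc u => GenTree.Node 1 [:: encode_term u]
  | AAdd u v => GenTree.Node 2 [:: encode_term u; encode_term v]
  | AMul u v => GenTree.Node 3 [:: encode_term u; encode_term v]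
  end.

Fixpoint decode_term (t : GenTree.tree nat) : aterm :=
  match t with
  | GenTree.Leaf x => AVar x
  | GenTree.Node 1 [:: u] => ASucc (decode_term u)
  | GenTree.Node 2 [:: u; v] => AAdd (decode_term u) (decode_term v)
  | GenTree.Node 3 [:: u; v] => AMul (decode_term u) (decode_term v)
  | _ => AZero
  end.

Lemma encode_termK : cancel encode_term decode_term.
Proof. by elim=> //= [t ->|t -> u ->|t -> u ->]. Qed.

Fixpoint encode (A : formula) : GenTree.tree nat :=
  match A with
  | Eq t u => GenTree.Node 0 [:: encode_term t; encode_term u]
  | Lt t u => GenTree.Node 1 [:: encode_term t; encode_term u]
  | Bot => GenTree.Node 2 [::]
  | Imp B C => GenTree.Node 3 [:: encode B; encode C]
  | All B => GenTree.Node 4 [:: encode B]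
  end.

Fixpoint decode (t : GenTree.tree nat) : formula :=
  match t with
  | GenTree.Node 0 [:: u; v] => Eq (decode_term u) (decode_term v)
  | GenTree.Node 1 [:: u; v] => Lt (decode_term u) (decode_term v)
  | GenTree.Node 3 [:: u; v] => Imp (decode u) (decode v)
  | GenTree.Node 4 [:: u] => All (decode u)
  | _ => Bot
  end.

Lemma encodeK : cancel encode decode.
Proof. by elim=> //= [t u|t u|A -> B ->|A ->]; rewrite ?encode_termK. Qed.

Definition nth_formula (n : nat) : formula :=
  if unpickle n is Some t then decode t else Bot.

Lemma nth_formula_onto A : exists n, nth_formula n = A.
Proof. by exists (pickle (encode A)); rewrite /nth_formula pickleK encodeK. Qed.

Lemma common_bound H A : exists N, all (fbounded N) H && fbounded N A.
Proof.
elim: H => [|B H [N /andP[HN AN]]] /=; first exact: fbounded_exists.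
have [p Bp] := fbounded_exists B; exists (maxn N p).
rewrite (fbounded_leq (leq_maxr _ _) Bp) (fbounded_leq (leq_maxl _ _) AN) andbT /=.
by apply: sub_all HN => C; apply/fbounded_leq/leq_maxl.
Qed.

Definition fresh H A : nat := sval (constructive_indefinite_description _ (common_bound H A)).

Lemma freshP H A : all (fbounded (fresh H A)) H /\ fbounded (fresh H A) A.
Proof.
exact/andP/(svalP (constructive_indefinite_description _ (common_bound H A))).
Qed.

(** One step of the construction: decide [A], and if a universal formula is
    refuted, give it a fresh variable as counterexample. *)
Definition extend (H : seq formula) (A : formula) : seq formula :=
  if excluded_middle_informative (pv (rcons H A) Bot) then
    if A is All C then rcons H (Neg (finst (AVar (fresh H A)) C)) else H
  else rcons H A.

Lemma extend_consistent H A : ~ pv H Bot -> ~ pv (extend H A) Bot.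
Proof.
move=> HB; rewrite /extend; case: excluded_middle_informative => [HA0|//] /=; have HA := proj1 (pv_rcons _ _ _) HA0.
case: A HA {HA0} => // C HA; set N := fresh _ _ => /pv_rcons /pv_dne HC; apply: HB.
have [HN CN] := freshP H (All C).
by apply: pv_mp HA _; apply: pv_fresh HC; last exact: CN.
Qed.

Lemma extend_pv H A B : pv H B -> pv (extend H A) B.
Proof.
move=> HB; rewrite /extend; case: excluded_middle_informative => [a|a] /=; last exact: pv_weak.
by case: A {a} => // C; apply: pv_weak.
Qed.

(** Henkin's construction: a theory that does not derive [B] has a maximal
    extension refuting [B] in which refuted universal formulas have
    counterexamples; its terms form a model. *)
Theorem derives_complete B :
  (forall M : model, (forall A, derives T A -> forall e : nat -> M, msat e A) ->
     forall e : nat -> M, msat e B) -> derives T B.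
Proof.
move=> HM; apply: NNPP => HB.
pose H n := iteri n (fun i H => extend H (nth_formula i)) [:: Neg B].
have HS n : H n.+1 = extend (H n) (nth_formula n) by [].
have cons n : ~ pv (H n) Bot.
  elim: n => [|n IH] /=; last exact: extend_consistent.
  by move=> /(d_mp (d_dne T B)).
have mono n p A : n <= p -> pv (H n) A -> pv (H p) A.
  move=> /subnKC <-; elim: (p - n) => [|d IH]; first by rewrite addn0.
  by move=> /IH; rewrite addnS /=; apply: extend_pv.
pose D A := exists n, pv (H n) A.
have D_mp A C : D (Imp A C) -> D A -> D C.
  move=> [n Hn] [p Hp]; exists (maxn n p).
  by apply: pv_mp (mono _ _ _ (leq_maxl _ _) Hn) (mono _ _ _ (leq_maxr _ _) Hp).
have D_der A : derives T A -> D A by move=> HA; exists 0; apply: pv_derives.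
have D_cons : ~ D Bot by move=> [n /cons].
have D_neg A : ~ D A -> D (Neg A).
  move=> HA; have [n En] := nth_formula_onto A.
  have := HS n; rewrite En /extend.
  case: excluded_middle_informative => [HN _|? E]; first by exists n; apply/pv_rcons.
  by case: HA; exists n.+1; rewrite E; apply: pv_last.
have D_imp A C : D (Imp A C) <-> (D A -> D C).
  split=> [HAC HA|HAC]; first exact: D_mp HAC HA.
  have [HA|/D_neg [n HA]] := classic (D A).
    by apply: D_mp (HAC HA); apply/D_der/d_K.
  exists n; apply/pv_rcons; apply: pv_exfalso; apply: pv_mp (pv_weak _ HA) (pv_last _ _).
have D_all C : D (All C) <-> forall t, D (finst t C).
  split=> [HC t|HC]; first by apply: D_mp HC; apply/D_der/d_inst.
  apply: NNPP => HN; have [n En] := nth_formula_onto (All C).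
  have := HS n; rewrite En /extend.
  case: excluded_middle_informative => [? E|? E].
    apply: D_cons; apply: D_mp (HC (AVar (fresh (H n) (All C)))).
    by exists n.+1; rewrite E; apply: pv_last.
  by apply: HN; exists n.+1; rewrite E; apply: pv_last.
pose M := Model AZero ASucc AAdd AMul (fun t u => D (Eq t u)) (fun t u => D (Lt t u)).
have evalE (e : nat -> M) t : meval e t = asubst e t.
  by elim: t => //= [t ->|t -> u ->|t -> u ->].
have satE A (e : nat -> M) : msat e A <-> D (fsubst e A).
  elim: A e => //= [t u|t u|A IHA C IHC|A IHA] e; rewrite ?evalE //.
    by rewrite IHA IHC D_imp.
  have E (t : aterm) : finst t (fsubst (up e) A) = fsubst (scons (t : M) e) A.
    rewrite /finst fsubst_comp; congr fsubst; apply: functional_extensionality => -[|x] //=.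
    by rewrite /ashift asubst_comp -[RHS]asubst_id; apply: eq_asubst.
  by rewrite D_all; split=> HA t; move: (HA t); rewrite IHA E.
have HB' : msat (M := M) AVar B.
  by apply: HM => A HA e; apply/satE/D_der/derives_subst.
move/satE: HB'; rewrite fsubst_id => HB'.
by apply: D_cons; apply: D_mp HB'; exists 0; apply: (pv_last [::]).
Qed.

End Calculus.

(** * Reasoning in models of the formal systems *)

(** The members of [TIR k m] are closed under deduction by [TIR_logic], so that
    provability can be shown by an argument in arbitrary models. *)
Lemma TIR_complete k m B :
  (forall M : model, (forall A, TIR k m A -> forall e : nat -> M, msat e A) ->
     forall e : nat -> M, msat e B) -> TIR k m B.
Proof.
move=> H; apply: (@TIR_logic _ _ (TIR k m)) => //; apply: derives_complete => M HM.
by apply: H => A HA; apply/HM/d_ax.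
Qed.

Definition bex (t : aterm) (A : formula) : formula :=
  Neg (All (Imp (Lt (AVar 0) (ashift t)) (Neg A))).

Fixpoint bexs (l : nat) (t : aterm) (A : formula) : formula :=
  if l is l'.+1 then bex t (bexs l' (ashift t) A) else A.

Lemma Delta0_bexs l t A : Delta0 A -> Delta0 (bexs l t A).
Proof. by move=> HA; elim: l t => //= l IHl t; do !constructor. Qed.

Lemma sat_bexs l t A e : sat e (bexs l t A) <->
  exists ys, [/\ size ys = l, all (fun y => y < aeval e t) ys & sat (lcons ys e) A].
Proof.
elim: l t e => [|l IHl] t e.
  by split=> [H|[ys [/size0nil -> //]]]; exists [::].
rewrite [bexs _ _ _]/(bex t (bexs l (ashift t) A)) /bex /=; split=> [H|[ys]].
  apply: NNPP => Hn; apply: H => a; rewrite /ashift aeval_subst => lt_a.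
  rewrite -/(scons a e) IHl => -[ys [sy Hy Hs]]; apply: Hn; exists (rcons ys a).
  rewrite size_rcons sy all_rcons lcons_rcons; split=> //; apply/andP; split=> //.
  by apply: sub_all Hy => y; rewrite /ashift aeval_subst.
case/lastP: ys => [[]//|ys a]; rewrite size_rcons all_rcons lcons_rcons.
move=> -[[sy] /andP[lt_a Hy] Hs] /(_ a); rewrite -/(scons a e); apply.
  by rewrite /ashift aeval_subst.
apply/IHl; exists ys; split=> //; apply: sub_all Hy => y.
by rewrite /ashift aeval_subst.
Qed.

(** The formula obtained from [D0] may have spurious free variables; they are
    set to zero. *)
Lemma D0_formula n P : D0 P -> (forall e, P e <-> P (nth 0 (mkseq e n))) ->
  exists A, [/\ Delta0 A, fbounded n A & forall e, sat e A <-> P e].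
Proof.
move=> [A HA HP] Hn; exists (fsubst (fun x => if x < n then AVar x else AZero) A).
split=> [||e]; first exact: Delta0_subst.
  have Hup p s : (forall x, abounded p (s x)) -> fbounded p (fsubst s A).
    elim: A p s {HA HP} => //= [t u|t u|B IHB C IHC|B IHB] p s Hs.
    - by rewrite !(_ : forall t, abounded p (asubst s t)) // => t'; elim: t' => //= ? -> ? ->.
    - by rewrite !(_ : forall t, abounded p (asubst s t)) // => t'; elim: t' => //= ? -> ? ->.
    - by rewrite IHB ?IHC.
    - apply: IHB => -[|x] //=; rewrite /ashift.
      by elim: (s x) (Hs x) => //= [t IHt u IHu|t IHt u IHu] /andP[/IHt -> /IHu].
  by apply: Hup => x; case: ifP.
rewrite sat_subst HP [X in _ <-> X]Hn.
suff -> : (fun x => aeval e (if x < n then AVar x else AZero)) = nth 0 (mkseq e n) by [].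
apply: functional_extensionality => x; case: ltnP => /= [lt|le]; first by rewrite nth_mkseq.
by rewrite nth_default // size_mkseq.
Qed.

Section Model.

Variable M : model.

Lemma meval_subst (e : nat -> M) s t : meval e (asubst s t) = meval (fun x => meval e (s x)) t.
Proof. by elim: t => //= [t ->|t -> u ->|t -> u ->]. Qed.

Lemma msat_subst (e : nat -> M) s A : msat e (fsubst s A) <-> msat (fun x => meval e (s x)) A.
Proof.
elim: A e s => //= [t u|t u|A IHA B IHB|A IHA] e s; rewrite ?meval_subst //.
  by rewrite IHA IHB.
have E a : (fun x => meval (scons a e) (up s x)) = scons a (fun x => meval e (s x)).
  by apply: functional_extensionality => -[|x] //=; rewrite /ashift meval_subst.
by split=> H a; move: (H a); rewrite IHA E.
Qed.

Lemma meval_bounded n (e e' : nat -> M) t :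
  abounded n t -> (forall x, x < n -> e x = e' x) -> meval e t = meval e' t.
Proof.
move=> Hb eq_e; elim: t Hb => //= [t IHt Ht|t IHt u IHu|t IHt u IHu].
- by rewrite IHt.
- by case/andP=> /IHt -> /IHu ->.
- by case/andP=> /IHt -> /IHu ->.
Qed.

Lemma msat_bounded n (e e' : nat -> M) A :
  fbounded n A -> (forall x, x < n -> e x = e' x) -> msat e A <-> msat e' A.
Proof.
elim: A n e e' => //= [t u|t u|A IHA B IHB|A IHA] n e e'.
- by case/andP=> Ht Hu eq; rewrite !(meval_bounded _ eq).
- by case/andP=> Ht Hu eq; rewrite !(meval_bounded _ eq).
- by case/andP=> HA HB eq; rewrite (IHA _ _ _ HA eq) (IHB _ _ _ HB eq).
- move=> HA eq; split=> H a; move: (H a).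
    by rewrite (IHA n.+1 _ (scons a e') HA) // => -[|x] //=; apply: eq.
  by rewrite (IHA n.+1 (scons a e) (scons a e') HA) // => -[|x] //=; apply: eq.
Qed.

Lemma msat_Ex (e : nat -> M) A : msat e (Ex A) <-> exists a, msat (scons a e) A.
Proof.
split=> [/= H|[a Ha] /= H]; last exact: (H a Ha).
by apply: NNPP => H'; apply: H => a Ha; apply: H'; exists a.
Qed.

Lemma msat_Exs (e : nat -> M) l A :
  msat e (Exs l A) <-> exists2 ys, size ys = l & msat (lcons ys e) A.
Proof.
elim: l e => [|l IHl] e.
  by split=> [H|[ys /size0nil -> //]]; exists [::].
rewrite [Exs _ _]/(Ex (Exs l A)) msat_Ex; split=> [[a /IHl [ys <- H]]|[ys]].
  by exists (rcons ys a); rewrite ?size_rcons ?lcons_rcons.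
case/lastP: ys => [//|ys a]; rewrite size_rcons lcons_rcons => -[Hs] H.
by exists a; apply/IHl; exists ys.
Qed.

Lemma msat_Alls (e : nat -> M) l A :
  msat e (Alls l A) <-> forall ys, size ys = l -> msat (lcons ys e) A.
Proof.
elim: l e => [|l IHl] e.
  by split=> [H ys /size0nil -> //|H]; apply: (H [::]).
rewrite -[Alls l.+1 A]/(All (Alls l A)) /=; split=> [H ys|H a].
  case/lastP: ys => [//|ys a]; rewrite size_rcons lcons_rcons => -[Hs].
  by move: (H a); rewrite IHl; apply.
apply/IHl => ys Hs; rewrite -lcons_rcons.
by apply: H; rewrite size_rcons Hs.
Qed.

Lemma msat_And (e : nat -> M) A B : msat e (And A B) <-> msat e A /\ msat e B.
Proof.
split=> [/= H|[HA HB] /= /(_ HA HB) //].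
by apply: NNPP => H'; apply: H => HA HB; apply: H'.
Qed.

Lemma msat_bexs (e : nat -> M) l t A : msat e (bexs l t A) ->
  exists ys, size ys = l /\ msat (lcons ys e) A.
Proof.
elim: l t e => [|l IHl] t e; first by exists [::].
rewrite [bexs _ _ _]/(bex t (bexs l (ashift t) A)) /bex /= => H.
apply: NNPP => Hn; apply: H => a _ /IHl [ys [sy Hs]]; apply: Hn.
by exists (rcons ys a); rewrite size_rcons sy lcons_rcons.
Qed.

(** The element list denoted by a list of terms, as an environment. *)
Definition menv (us : seq M) : nat -> M := lcons us (fun=> m_zero M).

Lemma menv_nth (e : nat -> M) ts :
  (fun x => meval e (nth AZero ts x)) = menv [seq meval e t | t <- ts].
Proof.
apply: functional_extensionality => x; rewrite /menv (lcons_nth (m_zero M)) size_map.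
by case: ltnP => [lt|le]; [rewrite (nth_map AZero)|rewrite nth_default].
Qed.

Definition vars (a n : nat) : seq aterm := [seq AVar x | x <- iota a n].

Lemma menv_vars us vs ws :
  [seq meval (menv (us ++ vs ++ ws)) t | t <- vars (size us) (size vs)] = vs.
Proof.
rewrite /vars -map_comp; apply: (@eq_from_nth _ (m_zero M)); first by rewrite size_map size_iota.
move=> i; rewrite size_map size_iota => lt_i.
rewrite (nth_map 0) ?size_iota //= nth_iota // /menv (lcons_nth (m_zero M)).
rewrite !size_cat ltn_add2l (leq_trans lt_i) ?leq_addr //.
by rewrite nth_cat ltnNge leq_addr /= addKn nth_cat lt_i.
Qed.

Hypothesis HM : forall A, derives ISigma1_TrPi1 A -> forall e : nat -> M, msat e A.

(** This is where the true Pi1 sentences are used: facts about the standard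
    model that are stated with bounded quantifiers need no proof in the
    formal system. *)
Lemma msat_true A : Delta0 A -> (forall e, sat e A) -> forall e : nat -> M, msat e A.
Proof.
move=> HA Hs e; have [n Hn] := fbounded_exists A.
have HT : TrPi1 (Alls n A).
  split=> [|| e']; last by apply/sat_Alls.
    elim: n {Hn} => [|n IHn]; first exact: Pi1_Delta0.
    exact: Pi1_all.
  rewrite /sentence; suff H p : fbounded (p + n) A -> fbounded p (Alls n A) by apply: H.
  elim: n p {Hn} => [|n IHn] p; first by rewrite addn0.
  by rewrite -[Alls _ _]/(All (Alls n A)) addnS -addSn; apply: IHn.
have := HM (d_ax (or_intror HT : ISigma1_TrPi1 _)) (fun x => e (n + x)).
by move/msat_Alls/(_ (mkseq e n)); rewrite size_mkseq lcons_eta; apply.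
Qed.

(** True implications between bounded statements hold in the model. *)
Lemma transfer (l : seq (seq aterm * formula)) us B :
  (forall p, List.In p l -> Delta0 p.2) -> Delta0 B ->
  (forall e, foldr (fun p Q => sat (nth 0 [seq aeval e t | t <- p.1]) p.2 -> Q)
     (sat (nth 0 [seq aeval e t | t <- us]) B) l) ->
  forall e : nat -> M, foldr (fun p Q => msat (menv [seq meval e t | t <- p.1]) p.2 -> Q)
     (msat (menv [seq meval e t | t <- us]) B) l.
Proof.
move=> Hl HB Hs e.
pose F := foldr (fun p C => Imp (fsubst (nth AZero p.1) p.2) C) (fsubst (nth AZero us) B) l.
have HF : Delta0 F.
  rewrite /F; elim: l Hl {Hs F} => [|p l IHl] Hl /=; first exact: Delta0_subst.
  constructor; first by apply: Delta0_subst; apply: Hl; left.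
  by apply: IHl => q Hq; apply: Hl; right.
have E (e' : nat -> nat) ts : (fun x => aeval e' (nth AZero ts x)) = nth 0 [seq aeval e' t | t <- ts].
  apply: functional_extensionality => x.
  by case: (ltnP x (size ts)) => [lt|le]; [rewrite (nth_map AZero)|rewrite !nth_default ?size_map].
have : msat e F.
  apply: msat_true HF _ e => e'; move: (Hs e'); rewrite /F.
  elim: l {Hl Hs F} => [|p l IHl] /=; first by rewrite sat_subst E.
  by move=> H Hp; apply: IHl; apply: H; move/sat_subst: Hp; rewrite E.
rewrite /F; elim: l {Hl Hs F HF} => [|p l IHl] /=; first by rewrite msat_subst menv_nth.
by move=> H Hp; apply: IHl; apply: H; apply/msat_subst; rewrite menv_nth.
Qed.

Lemma transfer1 ts1 A1 us B (e : nat -> M) : Delta0 A1 -> Delta0 B ->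
  (forall e, sat (nth 0 [seq aeval e t | t <- ts1]) A1 ->
     sat (nth 0 [seq aeval e t | t <- us]) B) ->
  msat (menv [seq meval e t | t <- ts1]) A1 -> msat (menv [seq meval e t | t <- us]) B.
Proof.
move=> H1 HB Hs; apply: (transfer (l := [:: (ts1, A1)])) => //.
by move=> p [<-|[]].
Qed.

Lemma transfer2 ts1 A1 ts2 A2 us B (e : nat -> M) : Delta0 A1 -> Delta0 A2 -> Delta0 B ->
  (forall e, sat (nth 0 [seq aeval e t | t <- ts1]) A1 ->
     sat (nth 0 [seq aeval e t | t <- ts2]) A2 ->
     sat (nth 0 [seq aeval e t | t <- us]) B) ->
  msat (menv [seq meval e t | t <- ts1]) A1 -> msat (menv [seq meval e t | t <- ts2]) A2 ->
  msat (menv [seq meval e t | t <- us]) B.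
Proof.
move=> H1 H2 HB Hs; apply: (transfer (l := [:: (ts1, A1); (ts2, A2)])) => //.
by move=> p [<-|[<-|[]]].
Qed.

Lemma transfer3 ts1 A1 ts2 A2 ts3 A3 us B (e : nat -> M) :
  Delta0 A1 -> Delta0 A2 -> Delta0 A3 -> Delta0 B ->
  (forall e, sat (nth 0 [seq aeval e t | t <- ts1]) A1 ->
     sat (nth 0 [seq aeval e t | t <- ts2]) A2 ->
     sat (nth 0 [seq aeval e t | t <- ts3]) A3 ->
     sat (nth 0 [seq aeval e t | t <- us]) B) ->
  msat (menv [seq meval e t | t <- ts1]) A1 -> msat (menv [seq meval e t | t <- ts2]) A2 ->
  msat (menv [seq meval e t | t <- ts3]) A3 -> msat (menv [seq meval e t | t <- us]) B.
Proof.
move=> H1 H2 H3 HB Hs.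
apply: (transfer (l := [:: (ts1, A1); (ts2, A2); (ts3, A3)])) => //.
by move=> p [<-|[<-|[<-|[]]]].
Qed.

Lemma menv_vars0 (X : seq M) ws n : size X = n ->
  [seq meval (menv (X ++ ws)) t | t <- vars 0 n] = X.
Proof. by move=> <-; apply: (menv_vars [::]). Qed.

Lemma menv_at (X : seq M) ws n x : size X = n ->
  menv (X ++ ws) (n + x) = nth (m_zero M) ws x.
Proof.
move=> <-; rewrite /menv (lcons_nth (m_zero M)) nth_cat size_cat ltn_add2l.
rewrite (_ : (size X + x < size X) = false) ?addKn; last by lia.
by case: ltnP => // le; rewrite nth_default.
Qed.

(** Sigma1 induction inside the model. *)
Lemma minduction l B (e : nat -> M) : Delta0 B ->
  (exists2 ys, size ys = l & msat (lcons ys (scons (m_zero M) e)) B) ->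
  (forall a, (exists2 ys, size ys = l & msat (lcons ys (scons a e)) B) ->
     exists2 ys, size ys = l & msat (lcons ys (scons (m_succ a) e)) B) ->
  forall a, exists2 ys, size ys = l & msat (lcons ys (scons a e)) B.
Proof.
move=> HB H0 HS a; apply/msat_Exs.
have := HM (d_ax (or_introl (ax_ind (Sigma1_Exs l HB)) : ISigma1_TrPi1 _)) e.
move=> /= H; apply: H => [|b Hb].
  rewrite /finst msat_subst; apply/msat_Exs.
  have -> // : (fun x => meval e (if x is y.+1 then AVar y else AZero)) = scons (m_zero M) e.
  by apply: functional_extensionality => -[].
rewrite msat_subst; have -> : (fun x => meval (scons b e)
    (if x is 0 then ASucc (AVar 0) else AVar x)) = scons (m_succ b) e.
  by apply: functional_extensionality => -[].
by apply/msat_Exs/HS/msat_Exs.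
Qed.

End Model.

(** * The fast growing functions are provably total *)

Lemma tm_vcode (g : (nat -> nat) -> nat -> nat) n : (forall j, tm (fun e => g e j)) ->
  tm (fun e => vcode (mkseq (g e) n)).
Proof.
move=> Hg; rewrite /mkseq; elim: n 0 => [|n IHn] a /=; first exact: tm_const.
by apply: tm_pr.
Qed.

Lemma tm_sum n : tm (fun e => \sum_(i < n) e i).
Proof.
elim: n => [|n IHn].
  suff -> : (fun e : nat -> nat => \sum_(i < 0) e i) = fun=> 0 by apply: tm_const.
  by apply: functional_extensionality => e; rewrite big_ord0.
suff -> : (fun e : nat -> nat => \sum_(i < n.+1) e i) = fun e => \sum_(i < n) e i + e n.
  by apply: tm_add => //; apply: tm_var.
by apply: functional_extensionality => e; rewrite big_ord_recr.
Qed.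

Lemma le_sum_ord (e : nat -> nat) n x : x < n -> e x <= \sum_(i < n) e i.
Proof. by move=> lt; rewrite (bigD1 (Ordinal lt)) //= leq_addr. Qed.

Lemma aeval_vars e a n : [seq aeval e t | t <- vars a n] = [seq e x | x <- iota a n].
Proof. by rewrite /vars -map_comp. Qed.

Lemma mkseq_nth_cat (A B : seq nat) n : size A = n -> mkseq (nth 0 (A ++ B)) n = A.
Proof.
move=> <-; apply: (@eq_from_nth _ 0); rewrite size_mkseq // => i lt.
by rewrite nth_mkseq // nth_cat lt.
Qed.

Lemma nth_cat_size (A B : seq nat) n x : size A = n -> nth 0 (A ++ B) (n + x) = nth 0 B x.
Proof. by move=> <-; rewrite nth_cat ltnNge leq_addr addKn. Qed.

Lemma nth_iota_cat (A B C : seq nat) :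
  [seq nth 0 (A ++ B ++ C) x | x <- iota (size A) (size B)] = B.
Proof.
apply: (@eq_from_nth _ 0); rewrite size_map size_iota // => i lt_i.
rewrite (nth_map 0) ?size_iota // nth_iota // nth_cat ltnNge leq_addr /= addKn.
by rewrite nth_cat lt_i.
Qed.

Lemma all_vec (e : nat -> nat) a n N : a + n <= N ->
  all (leq^~ (\sum_(i < N) e i).+1) [seq e x | x <- iota a n].
Proof.
move=> le; apply/allP => _ /mapP [x Hx ->]; rewrite mem_iota in Hx.
by apply/leqW/le_sum_ord; lia.
Qed.

Section Total.

Variables (K L : nat) (LK : L = K.+1).

(** Formulas for the graph of the fast growing functions, for the one step
    relation between vectors, for the existence of codes, and for the zero
    vector. Only their meaning in the standard model is known; statements about
    other models are transferred. *)
Variables FG PD RM ZR : formula.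
Hypotheses (FG0 : Delta0 FG) (PD0 : Delta0 PD) (RM0 : Delta0 RM) (ZR0 : Delta0 ZR).
Hypothesis FGb : fbounded (L + 4) FG.
Hypothesis FGs : forall e, sat e FG <->
  fg_graph L (vcode (mkseq e L)) (e (L + 0)) (e (L + 1)) (e (L + 2)) (e (L + 3)).
Hypothesis PDs : forall e, sat e PD <->
  pdc L (vcode (mkseq e L)) (e (L + 0)) (vcode (mkseq (fun x => e (L + x.+1)) L)) (e (L + (L + 0).+1)).
Hypothesis RMs : forall e, sat e RM <-> roomy (e 0) (e 1).
Hypothesis ZRs : forall e, sat e ZR <-> forall i, i < K -> e i = 0.

Variable cap : nat -> aterm.
Hypothesis capb : forall n, abounded n (cap n).
Hypothesis capE : forall n e, aeval e (cap n) = fg_cap L (\sum_(i < n) e i).+1.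

Lemma FG_at A i z y b : size A = L ->
  sat (nth 0 (A ++ [:: i; z; y; b])) FG <-> fg_graph L (vcode A) i z y b.
Proof. by move=> sA; rewrite FGs mkseq_nth_cat // !(nth_cat_size _ _ sA). Qed.

Lemma PD_at A z B i : size A = L -> size B = L ->
  sat (nth 0 (A ++ z :: B ++ [:: i])) PD <-> pdc L (vcode A) z (vcode B) i.
Proof.
move=> sA sB; rewrite PDs mkseq_nth_cat // !(nth_cat_size _ _ sA).
have -> : nth 0 (z :: B ++ [:: i]) (L + 0).+1 = i.
  by rewrite -[LHS]/(nth 0 (B ++ [:: i]) (L + 0)) (nth_cat_size _ _ sB).
have -> : mkseq (fun x => nth 0 (A ++ z :: B ++ [:: i]) (L + x.+1)) L = B.
  rewrite -[RHS](@mkseq_nth_cat B [:: i] L) //.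
  by apply: eq_mkseq => x; rewrite (nth_cat_size _ _ sA).
by [].
Qed.

Section InModel.

Variable M : model.
Hypothesis HM : forall A, derives ISigma1_TrPi1 A -> forall e : nat -> M, msat e A.

Let one := m_succ (m_zero M).

Definition mFG (X : seq M) i z y b : Prop := msat (menv (X ++ [:: i; z; y; b])) FG.
Definition mPD (X : seq M) z Y i : Prop := msat (menv (X ++ z :: Y ++ [:: i])) PD.
Definition mRM (x b : M) : Prop := msat (menv [:: x; b]) RM.

(** Codes of arbitrary size exist in the model, by Sigma1 induction: multiply
    the numbers up to [x], then the moduli. *)
Lemma mroom x : exists b, mRM x b.
Proof.
have [D1 [D10 D1s]] : exists A, Delta0 A /\
    forall e, sat e A <-> 0 < e 0 /\ forall i, i <= e 1 -> i.+1 %| e 0.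
  suff [A HA Hs] : D0 (fun e => 0 < e 0 /\ forall i, i <= e 1 -> i.+1 %| e 0) by exists A.
  by d0.
have [D2 [D20 D2s]] : exists A, Delta0 A /\
    forall e, sat e A <-> 0 < e 0 /\ forall i, i <= e 1 -> code_mem (e 2) (e 0) i.
  suff [A HA Hs] : D0 (fun e => 0 < e 0 /\ forall i, i <= e 1 -> code_mem (e 2) (e 0) i) by exists A.
  by d0.
have H1 : exists2 s, size s = 1 & msat (lcons s (scons x (fun=> m_zero M))) D1.
  apply: (minduction HM D10) => [|a [[|s []] // _ Hs]].
    exists [:: one] => //.
    apply: (transfer HM (l := [::]) (us := [:: ASucc AZero; AZero]) _ D10) => // e /=.
    by apply/D1s; split=> // -[].
  exists [:: m_mul s (m_succ (m_succ a))] => //.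
  have := transfer HM (l := [:: ([:: AVar 0; AVar 1], D1)])
    (us := [:: AMul (AVar 0) (ASucc (ASucc (AVar 1))); ASucc (AVar 1)]) _ D10.
  move/(_ _ _ (menv [:: s; a])) => /=; apply=> // [p [<-|[]] //|e].
  move=> /D1s /= [s_gt0 Hd]; apply/D1s => /=; split; first by rewrite muln_gt0 s_gt0.
  move=> i; rewrite leq_eqVlt => /orP[/eqP ->|lt]; first exact: dvdn_mull.
  exact/dvdn_mulr/Hd.
case: H1 => -[|s [] // _] // Hs.
have H2 : exists2 c, size c = 1 & msat (lcons c (scons x (menv [:: s]))) D2.
  apply: (minduction HM D20) => [|a [[|c []] // _ Hc]].
    exists [:: m_succ (m_mul one s)] => //.
    have := transfer HM (l := [::])
      (us := [:: ASucc (AMul (ASucc AZero) (AVar 0)); AZero; AVar 0]) _ D20.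
    move/(_ _ _ (menv [:: s])) => /=; apply=> // e; apply/D2s; split=> // i /=.
    by rewrite leqn0 => /eqP ->; rewrite /code_mem.
  exists [:: m_mul c (m_succ (m_mul (m_succ (m_succ a)) s))] => //.
  have := transfer HM (l := [:: ([:: AVar 0; AVar 1; AVar 2], D2)])
    (us := [:: AMul (AVar 0) (ASucc (AMul (ASucc (ASucc (AVar 1))) (AVar 2))); ASucc (AVar 1); AVar 2]) _ D20.
  move/(_ _ _ (menv [:: c; a; s])) => /=; apply=> // [p [<-|[]] //|e].
  move=> /D2s /= [c_gt0 Hd]; apply/D2s => /=; split; first by rewrite muln_gt0 c_gt0.
  move=> i; rewrite leq_eqVlt => /orP[/eqP ->|lt]; first exact: dvdn_mull.
  exact/dvdn_mulr/Hd.
case: H2 => -[|c [] // _] // Hc.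
exists (m_add x (m_add s c)).
have := transfer HM (l := [:: ([:: AVar 0; AVar 1], D1); ([:: AVar 2; AVar 1; AVar 0], D2)])
    (us := [:: AVar 1; AAdd (AVar 1) (AAdd (AVar 0) (AVar 2))]) _ RM0.
move/(_ _ _ (menv [:: s; x; c])) => /=; apply=> // [p [<-|[<-|[]]] //|e].
move=> /D1s /= [s_gt0 Hd] /D2s /= [c_gt0 Hm]; apply/RMs => /=.
exists (e 0); first by lia.
exists (e 2); first by lia.
by split=> //; [lia|move=> i le; split; [apply: Hd|apply: Hm]].
Qed.

Let vecs (e : nat -> nat) a n : size [seq e x | x <- iota a n] = n.
Proof. by rewrite size_map size_iota. Qed.

(** A bound for the codes of the computations with data [us]. *)
Definition need (us : seq M) : M := meval (menv us) (cap (size us)).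

Lemma needE us ws : need us = meval (menv (us ++ ws)) (cap (size us)).
Proof.
apply: (@meval_bounded _ (size us)) => // x lt_x.
by rewrite /menv !(lcons_nth (m_zero M)) size_cat nth_cat lt_x ltn_addr.
Qed.

Lemma mFG_zero X z b : size X = L ->
  mRM (need (X ++ [:: z])) b -> mFG X (m_zero M) z z b.
Proof.
move=> sX; rewrite (needE _ [:: b]) size_cat sX -catA /=; set e := menv _ => HR.
have := @transfer1 M HM [:: cap (L + 1); AVar (L + 1)] RM
  (vars 0 L ++ [:: AZero; AVar (L + 0); AVar (L + 0); AVar (L + 1)]) FG e RM0 FG0.
rewrite map_cat menv_vars0 // [meval e]lock /= -lock /= /e !(menv_at _ _ sX); apply=> // {HR e} e.
rewrite RMs map_cat aeval_vars => HR; apply/FG_at => //.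
apply: (@fg_graph_complete _ _ _ _ _ _ (\sum_(i < L + 1) e i).+1) => //=.
- by apply: all_vec; lia.
- by apply/leqW/le_sum_ord; lia.
- by apply/leqW/le_sum_ord; lia.
- by rewrite -capE; exact: HR.
Qed.

(** In the standard model the tables of both computations can be merged within
    the given room; the statement of this fact is bounded. *)
Lemma mFG_step X i z v w b b' b'' : size X = L ->
  mFG X i z v b -> mFG X one v w b' ->
  mRM (need (X ++ [:: i; z; v; w; b; b'])) b'' ->
  mFG X (m_succ i) z w b''.
Proof.
move=> sX; rewrite (needE _ [:: b'']) size_cat sX -catA /=; set e := menv (X ++ [:: i; z; v; w; b; b'; b'']).
have := @transfer3 M HM (vars 0 L ++ [:: AVar (L + 0); AVar (L + 1); AVar (L + 2); AVar (L + 4)]) FG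
  (vars 0 L ++ [:: ASucc AZero; AVar (L + 2); AVar (L + 3); AVar (L + 5)]) FG
  [:: cap (L + 6); AVar (L + 6)] RM
  (vars 0 L ++ [:: ASucc (AVar (L + 0)); AVar (L + 1); AVar (L + 3); AVar (L + 6)]) FG e FG0 FG0 RM0 FG0.
rewrite !map_cat menv_vars0 // [meval e]lock /= -lock /= /e !(menv_at _ _ sX).
rewrite /mFG /mRM => H H1 H2 H3; apply: (H _ H1 H2 H3) => {H H1 H2 H3} {}e.
rewrite !map_cat aeval_vars RMs => /FG_at => /(_ (vecs _ _ _)) /(fg_graph_sound (vecs _ _ _)) Ev.
move=> /FG_at => /(_ (vecs _ _ _)) /(fg_graph_sound (vecs _ _ _)) Ew HR; apply/FG_at => //.
apply: (@fg_graph_complete _ _ _ _ _ _ (\sum_(i < L + 6) e i).+1) => //=.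
- by apply: all_vec; lia.
- by apply/le_sum_ord; lia.
- by apply/leqW/le_sum_ord; lia.
- by apply/leqW/le_sum_ord; lia.
- by rewrite -capE; exact: HR.
- by rewrite /= in Ev Ew; rewrite Ew Ev.
Qed.

Lemma mFG_pred X z Y i w b b' : size X = L -> size Y = L ->
  mPD X z Y i -> mFG Y i z w b ->
  mRM (need (X ++ z :: Y ++ [:: i; w; b])) b' ->
  mFG X one z w b'.
Proof.
move=> sX sY; rewrite (needE _ [:: b']) size_cat sX /= size_cat sY -catA cat_cons -catA /=; set e := menv (X ++ z :: Y ++ [:: i; w; b; b']).
have EY : [seq meval e t | t <- vars (L + 1) L] = Y.
  have := menv_vars (X ++ [:: z]) Y [:: i; w; b; b'].
  by rewrite size_cat sX sY -catA.
have at_Y x : e (L + (L + x).+1) = nth (m_zero M) [:: i; w; b; b'] x.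
  rewrite /e (menv_at _ _ sX) -[LHS]/(nth (m_zero M) (Y ++ [:: i; w; b; b']) (L + x)).
  by rewrite nth_cat sY ltnNge leq_addr /= addKn.
have := @transfer3 M HM
  (vars 0 L ++ AVar (L + 0) :: vars (L + 1) L ++ [:: AVar (L + (L + 0).+1)]) PD
  (vars (L + 1) L ++ [:: AVar (L + (L + 0).+1); AVar (L + 0); AVar (L + (L + 1).+1); AVar (L + (L + 2).+1)]) FG
  [:: cap (L + (L + 3).+1); AVar (L + (L + 3).+1)] RM
  (vars 0 L ++ [:: ASucc AZero; AVar (L + 0); AVar (L + (L + 1).+1); AVar (L + (L + 3).+1)]) FG e PD0 FG0 RM0 FG0.
rewrite !map_cat menv_vars0 // map_cons map_cat EY [meval e]lock /= -lock /= !at_Y /e !(menv_at _ _ sX).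
rewrite /mFG /mRM /mPD => H H1 H2 H3; apply: (H _ H1 H2 H3) => {H H1 H2 H3 EY at_Y} {}e.
rewrite !map_cat map_cons map_cat !aeval_vars RMs => /PD_at.
move=> /(_ (vecs _ _ _) (vecs _ _ _)) /pdcP [xs [ys [sxs Exs Eys Hpd]]].
have {}Exs : [seq e x | x <- iota 0 L] = xs by apply: vcode_inj Exs; rewrite vecs sxs.
have [sys _ _ _ HG] := pdv_spec Hpd.
have {}Eys : [seq e x | x <- iota (L + 1) L] = ys by apply: vcode_inj Eys; rewrite vecs sys sxs.
move=> /FG_at => /(_ (vecs _ _ _)) /(fg_graph_sound (vecs _ _ _)) Ew HR; apply/FG_at => //.
apply: (@fg_graph_complete _ _ _ _ _ _ (\sum_(i < L + (L + 3).+1) e i).+1) => //=.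
- by apply: all_vec; lia.
- by apply/leqW/le_sum_ord; lia.
- by apply/leqW/le_sum_ord; lia.
- by rewrite -capE; exact: HR.
- by rewrite /= in Ew; rewrite Ew Exs Eys; rewrite HG.
Qed.

(** The function with vector [X] is total in the model; the entries of [X] may
    be nonstandard. *)
Definition tot (X : seq M) : Prop := forall z, exists y b, mFG X one z y b.

(** Sigma1 induction on the number of iterations, which may be nonstandard. *)
Lemma tot_iterate X : size X = L -> tot X -> forall i z, exists y b, mFG X i z y b.
Proof.
move=> sX HX i z.
pose us := vars 3 L ++ [:: AVar 2; AVar (L + 3); AVar 1; AVar 0].
pose B := fsubst (nth AZero us) FG.
have BE j y b : msat (lcons [:: b; y] (scons j (menv (X ++ [:: z])))) B <-> mFG X j z y b.
  rewrite /B msat_subst menv_nth /mFG.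
  have -> : lcons [:: b; y] (scons j (menv (X ++ [:: z]))) = menv ([:: b; y; j] ++ X ++ [:: z]) by [].
  rewrite map_cat -sX (menv_vars [:: b; y; j]) [meval _]lock /= -lock /=.
  have -> // : menv [:: b, y, j & X ++ [:: z]] (size X + 3) = z.
  by have := @menv_at M ([:: b; y; j] ++ X) [:: z] _ 0 erefl; rewrite size_cat /= addn0 addnC.
suff [ys] : exists2 ys, size ys = 2 & msat (lcons ys (scons i (menv (X ++ [:: z])))) B.
  by case: ys => [|b [|y []]] // _ /BE; exists y, b.
have HB : Delta0 B by apply: Delta0_subst.
apply: (minduction HM HB) => [|a [ys]].
  have [b Hb] := mroom (need (X ++ [:: z])).
  by exists [:: b; z] => //; apply/BE/mFG_zero.
case: ys => [|b [|v []]] // _ /BE Hv; have [w [b' Hw]] := HX v.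
have [b'' Hb''] := mroom (need (X ++ [:: a; z; v; w; b; b'])).
by exists [:: b''; w] => //; apply/BE; apply: mFG_step Hv Hw Hb''.
Qed.

Definition num (n : nat) : aterm := iter n ASucc AZero.

Definition mnum (n : nat) : M := iter n (@m_succ M) (m_zero M).

Arguments num : simpl never.
Arguments mnum : simpl never.

Lemma aeval_num e n : aeval e (num n) = n.
Proof. by elim: n => //= n ->. Qed.

Lemma meval_num (e : nat -> M) n : meval e (num n) = mnum n.
Proof. by elim: n => //= n ->. Qed.

Lemma tot_pred X : size X = L ->
  (forall z, exists Y i, [/\ size Y = L, mPD X z Y i & tot Y]) -> tot X.
Proof.
move=> sX H z; have [Y [i [sY Hpd HY]]] := H z.
have [w [b Hw]] := tot_iterate sY HY i z.
have [b' Hb'] := mroom (need (X ++ z :: Y ++ [:: i; w; b])).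
by exists w, b'; apply: mFG_pred Hpd Hw Hb'.
Qed.

Lemma tot_zero : tot (nseq L (m_zero M)).
Proof.
move=> z; have [b] := mroom (need [:: z]).
rewrite (needE _ [:: b]) /=; set e := menv _ => HR; exists (m_succ z), b.
have := @transfer1 M HM [:: cap 1; AVar 1] RM
  (nseq L AZero ++ [:: ASucc AZero; AVar 0; ASucc (AVar 0); AVar 1]) FG e RM0 FG0.
rewrite map_cat map_nseq [meval e]lock /= -lock /=; apply=> // {HR e} e.
rewrite map_cat map_nseq RMs => HR; apply/FG_at; first by rewrite size_nseq.
apply: (@fg_graph_complete _ _ _ _ _ _ (\sum_(i < 1) e i).+1) => //=.
- by rewrite size_nseq.
- by apply/allP => x /nseqP [->].
- by apply/leqW/le_sum_ord.
- by apply/(@le_sum_ord e 1 0).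
- by rewrite -capE; exact: HR.
- by rewrite vjump_nseq0.
Qed.

Lemma mPD_intro tX tY ti z : size tX = L -> size tY = L ->
  (forall e, pdv [seq aeval e t | t <- tX] (e 0) [seq aeval e t | t <- tY] (aeval e ti)) ->
  mPD [seq meval (menv [:: z]) t | t <- tX] z [seq meval (menv [:: z]) t | t <- tY]
    (meval (menv [:: z]) ti).
Proof.
move=> sX sY Hpd; set e := menv _.
have := @transfer M HM [::] (tX ++ AVar 0 :: tY ++ [:: ti]) PD _ PD0 _ e.
rewrite /= map_cat map_cons map_cat /=; apply=> // {}e.
rewrite map_cat map_cons map_cat /=; apply/PD_at; rewrite ?size_map //.
by apply/pdcP; exists [seq aeval e t | t <- tX], [seq aeval e t | t <- tY]; rewrite size_map.
Qed.

(** The leading coefficient decreases; the other coefficients of the smaller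
    vector are arbitrary elements of the model. *)
Lemma tot_level j : (forall xs, size xs = K -> tot (mnum j :: xs)) -> 0 < K ->
  tot (mnum j.+1 :: nseq K (m_zero M)).
Proof.
case EK : {2}K => [//|K'] Hj _; apply: tot_pred => [|z]; first by rewrite /= size_nseq LK.
exists (mnum j :: m_succ z :: nseq K' (m_zero M)), one; split.
- by rewrite /= size_nseq LK EK.
- have := @mPD_intro (num j.+1 :: nseq K AZero) (num j :: ASucc (AVar 0) :: nseq K' AZero) (ASucc AZero) z.
  rewrite [meval _]lock /= -lock !map_nseq !meval_num /=; apply; rewrite ?size_nseq ?LK ?EK //.
  move=> e; rewrite /= !map_nseq !aeval_num /=; right.
  by rewrite ?size_nseq ?EK /= ?size_nseq.
by apply: Hj; rewrite /= size_nseq EK.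
Qed.

Lemma tot_succ j n q : K = n.+1 ->
  tot (mnum j :: rcons (nseq n (m_zero M)) (mnum q)) ->
  tot (mnum j :: rcons (nseq n (m_zero M)) (mnum q.+1)).
Proof.
move=> EK Hq; apply: tot_pred => [|z]; first by rewrite /= size_rcons size_nseq LK EK.
exists (mnum j :: rcons (nseq n (m_zero M)) (mnum q)), (m_succ z); split=> //.
  by rewrite /= size_rcons size_nseq LK EK.
have := @mPD_intro (num j :: rcons (nseq n AZero) (num q.+1)) (num j :: rcons (nseq n AZero) (num q)) (ASucc (AVar 0)) z.
rewrite [meval _]lock /= -lock !map_rcons !map_nseq !meval_num /=; apply; rewrite ?size_rcons ?size_nseq ?LK ?EK //.
move=> e; rewrite /= !map_rcons !map_nseq !aeval_num /=; left; split=> //.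
elim: n {EK Hq} => [|n IHn] /=; last by left.
by rewrite ?aeval_num; right.
Qed.

Lemma fbounded_lex_lt i n : fbounded (K + (i + n)) (lex_lt K i n).
Proof.
elim: n i => [|n IHn] i //=; rewrite addnS -addSn IHn !andbT /=; apply/andP; split; first by lia.
by apply/andP; split; lia.
Qed.

(** Totality is progressive along the lexicographic order of the model: except
    for the zero vector, every vector reduces to a smaller one, and this is a
    true bounded statement. *)
Lemma tot_progressive j xs : size xs = K -> tot (mnum j :: nseq K (m_zero M)) ->
  (forall ys, size ys = K -> msat (menv (ys ++ xs)) (lex_lt K 0 K) -> tot (mnum j :: ys)) ->
  tot (mnum j :: xs).
Proof.
move=> sxs H0 Hlt; have [HZ|HZ] := classic (msat (menv xs) ZR).
  move=> z; have [y [b Hy]] := H0 z; exists y, b.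
  set e := menv (xs ++ [:: z; y; b]).
  have Exs : [seq meval e t | t <- vars 0 K] = xs by apply: menv_vars0.
  have := @transfer2 M HM (vars 0 K) ZR
    ((num j :: nseq K AZero) ++ [:: ASucc AZero; AVar (K + 0); AVar (K + 1); AVar (K + 2)]) FG
    ((num j :: vars 0 K) ++ [:: ASucc AZero; AVar (K + 0); AVar (K + 1); AVar (K + 2)]) FG e ZR0 FG0 FG0.
  rewrite !map_cat !map_cons Exs map_nseq meval_num [meval e]lock /= -lock /= /e !(menv_at _ _ sxs) /=.
  move=> H; apply: H HZ Hy => {Exs} {}e.
  rewrite !map_cat !map_cons map_nseq aeval_num aeval_vars ZRs => HZ.
  have -> // : [seq e x | x <- iota 0 K] = nseq K 0.
  apply: (@eq_from_nth _ 0); rewrite ?size_nseq ?vecs // => i lt_i.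
  by have := HZ i lt_i; rewrite nth_nseq lt_i.
apply: tot_pred => [|z]; first by rewrite /= sxs LK.
have [t Ht] := tm_sum (K + 2).
pose rho v := if v < K then AVar v else AVar v.+1.
pose us := num j :: vars (K + 1) K ++ AVar (K + (K + 0).+1) :: num j :: vars 0 K ++ [:: AVar (K + 0)].
pose C := And (fsubst rho (lex_lt K 0 K)) (fsubst (nth AZero us) PD).
have HC : Delta0 C by apply: Delta0_And; apply: Delta0_subst => //; apply: Delta0_lex_lt.
pose EX := bexs 1 (ASucc (ASucc (AVar (K + 0)))) (bexs K (ASucc (ASucc t)) C).
have HEX : Delta0 EX by do 2 apply: Delta0_bexs.
set e := menv (xs ++ [:: z]).
have Exs : [seq meval e t | t <- vars 0 K] = xs by apply: menv_vars0.
have Htr B : Delta0 B -> (forall e, ~ sat (nth 0 [seq aeval e t | t <- vars 0 K]) ZR ->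
    sat (nth 0 [seq aeval e t | t <- vars 0 K ++ [:: AVar (K + 0)]]) B) ->
    msat (menv (xs ++ [:: z])) B.
  move=> HB Hs; have HN : Delta0 (Neg ZR) by do !constructor.
  have := @transfer1 M HM (vars 0 K) (Neg ZR) (vars 0 K ++ [:: AVar (K + 0)]) B e HN HB Hs.
  by rewrite map_cat Exs [meval e]lock /= -lock /= /e (menv_at _ _ sxs) /=; apply.
have Hex : msat (menv (xs ++ [:: z])) EX.
  apply: Htr HEX _ => {Exs} {}e.
  rewrite map_cat aeval_vars; set vs := [seq e x | x <- iota 0 K] => HnZ.
  have svs : size vs = K by rewrite vecs.
  set w := e (K + 0).
  have Hne : vs <> nseq (size vs) 0.
    move=> E; apply: HnZ; apply/ZRs => i lt_i.
    by rewrite E nth_nseq svs lt_i.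
  have [ys [i Hpd]] := pdv_exists w Hne.
  have [sys lt le_i Hall _] := pdv_spec Hpd.
  have sys' : size ys = K by rewrite sys.
  apply/sat_bexs; exists [:: i]; split=> //.
    by rewrite /= andbT -[X in _ < X.+2]/(nth 0 (vs ++ [:: w]) (K + 0)) (nth_cat_size _ _ svs) /=; lia.
  apply/sat_bexs; exists ys; split=> //.
    have Hs x : x \in w :: vs -> x <= \sum_(j < K + 2) scons i (nth 0 (vs ++ [:: w])) j.
      move=> /(nthP 0) [[|n]] /= lt_n <-.
        have := @le_sum_ord (scons i (nth 0 (vs ++ [:: w]))) (K + 2) (K + 0).+1.
        by rewrite /= (nth_cat_size _ _ svs) /=; apply; lia.
      rewrite ltnS svs in lt_n.
      have := @le_sum_ord (scons i (nth 0 (vs ++ [:: w]))) (K + 2) n.+1.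
      by rewrite /= nth_cat svs lt_n; apply; lia.
    rewrite /= Ht; set S := \sum_(_ < _) _ in Hs *.
    apply: (@sub_all _ (leq^~ S.+1)); first by move=> x; rewrite ltnS.
    apply: Hall; last by rewrite ltnS; apply: Hs; rewrite inE eqxx.
    by apply/allP => x Hx; apply/leqW/Hs; rewrite inE Hx orbT.
  have sYV : size (ys ++ i :: vs) = (K + K).+1 by rewrite size_cat /= sys' svs addnS.
  have Eenv : lcons ys (lcons [:: i] (nth 0 (vs ++ [:: w]))) = nth 0 (ys ++ i :: vs ++ [:: w]).
    apply: functional_extensionality => x; rewrite (lcons_nth 0) nth_cat.
    by case: ltnP => // _; case: (x - _).
  rewrite Eenv; apply/sat_And; split; apply/sat_subst.
    rewrite sat_lex_lt; set s1 := mkseq _ _; set s2 := mkseq _ _.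
    suff [-> ->] : s1 = ys /\ s2 = vs by [].
    rewrite /s1 /s2; split; apply: (@eq_from_nth _ 0); rewrite size_mkseq ?sys' ?svs // => x lt_x;
      rewrite nth_mkseq // add0n /rho.
      by rewrite lt_x /= nth_cat sys' lt_x.
    rewrite ltnNge leq_addr /= nth_cat sys' ltnNge leqW ?leq_addr //=.
    by rewrite -addnS addKn /= nth_cat svs lt_x.
  have Eus : (fun x => aeval (nth 0 (ys ++ i :: vs ++ [:: w])) (nth AZero us x)) =
      nth 0 ((j :: vs) ++ w :: (j :: ys) ++ [:: i]).
    apply: functional_extensionality => x.
    have -> : (j :: vs) ++ w :: (j :: ys) ++ [:: i] =
        [seq aeval (nth 0 (ys ++ i :: vs ++ [:: w])) t | t <- us].
      rewrite /us map_cons map_cat map_cons map_cons map_cat !aeval_vars aeval_num.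
      have := nth_iota_cat [::] ys (i :: vs ++ [:: w]); rewrite sys' => ->.
      have := nth_iota_cat (ys ++ [:: i]) vs [:: w]; rewrite -catA size_cat sys' svs => ->.
      have := nth_iota_cat (ys ++ i :: vs) [:: w] [::].
      rewrite -catA /= size_cat /= sys' svs => -[Ew].
      by rewrite !addn0 Ew nth_cat sys' ltnn subnn.
    case: (ltnP x (size us)) => [lt_x|le_x]; first by rewrite (nth_map AZero).
    by rewrite !nth_default ?size_map.
  rewrite Eus; apply/PD_at; rewrite /= ?svs ?sys' ?LK //.
  apply/pdcP; exists (j :: vs), (j :: ys); rewrite /= svs; split=> //; by left.
have [ws [sws Hws]] := msat_bexs Hex; case: ws sws Hws => [|i [|? ?]] // _ Hws.
have [ys [sys]] := msat_bexs Hws.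
move=> /msat_And [/msat_subst Hlex /msat_subst]; rewrite menv_nth => Hpd.
have Einner : lcons ys (lcons [:: i] (menv (xs ++ [:: z]))) = menv (ys ++ i :: xs ++ [:: z]).
  by rewrite /menv [RHS]lcons_cat.
exists (mnum j :: ys), i; split; first by rewrite /= sys LK.
  move: Hpd; rewrite Einner /mPD; congr (msat (menv _) PD).
  rewrite /us map_cons map_cat map_cons map_cons map_cat !meval_num.
  have := menv_vars [::] ys (i :: xs ++ [:: z]); rewrite sys => ->.
  have := menv_vars (ys ++ [:: i]) xs [:: z]; rewrite -catA size_cat sys sxs => ->.
  by rewrite /= !(menv_at _ _ sys) /= nth_cat sxs addn0 ltnn subnn.
apply: Hlt => //; move: Hlex; rewrite Einner.
have Hb : fbounded (K + K) (lex_lt K 0 K) := fbounded_lex_lt 0 K.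
apply: (proj1 (msat_bounded Hb _)) => x lt_x; rewrite /rho /menv.
case: ltnP => [lt|le] /=; rewrite !(lcons_nth (m_zero M)) !size_cat /= size_cat /= !nth_cat sys sxs.
  by rewrite lt !ifT //; lia.
have -> : (x < K) = false by lia.
have -> : (x.+1 < K) = false by lia.
have -> : x.+1 - K = (x - K).+1 by lia.
rewrite /= nth_cat sxs !ifT //; lia.
Qed.

End InModel.
Definition total_at (j : nat) : formula :=
  All (Exs 2 (fsubst (nth AZero (num j :: vars 3 K ++
    [:: ASucc AZero; AVar 2; AVar 1; AVar 0])) FG)).

Lemma msat_total_at (M : model) j (e : nat -> M) :
  msat e (total_at j) <-> tot (mnum M j :: [seq e x | x <- iota 0 K]).
Proof.
have E z y b : msat (lcons [:: b; y] (scons z e)) (fsubst (nth AZero (num j :: vars 3 K ++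
    [:: ASucc AZero; AVar 2; AVar 1; AVar 0])) FG) <->
    mFG (mnum M j :: [seq e x | x <- iota 0 K]) (m_succ (m_zero M)) z y b.
  rewrite msat_subst menv_nth /mFG map_cons map_cat meval_num /vars -map_comp.
  by rewrite -[iota 3 K]/(iota (3 + 0) K) iotaDl -map_comp.
split=> [H z|H z].
  have [ys sys Hys] := proj1 (msat_Exs (scons z e) 2 _) (H z).
  by case: ys sys Hys => [|b [|y []]] // _ /E Hb; exists y, b.
by apply/(msat_Exs (scons z e) 2); have [y [b /E Hb]] := H z; exists [:: b; y].
Qed.

Variable k : nat.
Hypothesis Kk : K = k.+1.

Lemma base_TIR m (M : model) : (forall A, TIR k m A -> forall e : nat -> M, msat e A) ->
  forall A, derives ISigma1_TrPi1 A -> forall e : nat -> M, msat e A.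
Proof. by move=> H A HA; apply/H/TIR_base. Qed.

Lemma tot_start m (M : model) :
  (forall A, TIR k m A -> forall e : nat -> M, msat e A) ->
  (forall j, m = j.+1 -> TIR k m (Alls K (total_at j))) ->
  tot (mnum M m :: nseq K (m_zero M)).
Proof.
move=> HM HT; have HB := base_TIR HM.
case: m HM HT HB => [|j] HM HT HB.
  by have := tot_zero HB; rewrite LK.
apply: (tot_level HB) => // [xs sxs|]; last by rewrite Kk.
have := HM _ (HT j erefl) (fun=> m_zero M); move/msat_Alls/(_ xs sxs)/msat_total_at.
suff -> : [seq lcons xs (fun=> m_zero M) x | x <- iota 0 K] = xs by [].
rewrite -sxs; apply: (@eq_from_nth _ (m_zero M)); rewrite size_map size_iota // => i lt_i.
by rewrite (nth_map 0) ?size_iota // nth_iota // (lcons_nth (m_zero M)) lt_i.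
Qed.

Lemma lcons_iota (T : Type) (d : nat -> T) xs n : size xs = n ->
  [seq lcons xs d x | x <- iota 0 n] = xs.
Proof.
move=> <-; apply: (@eq_from_nth _ (d 0)); rewrite size_map size_iota // => i lt_i.
by rewrite (nth_map 0) ?size_iota // nth_iota // (lcons_nth (d 0)) lt_i.
Qed.

(** By [tot_level], totality for all vectors with leading coefficient [j] gives
    the start for [j + 1]; an application of the rule gives totality for all
    vectors with that coefficient. Thus each nesting of the rule climbs by
    omega^(1+k). *)
Lemma TIR_total_at j : TIR k j.+1 (Alls K (total_at j)).
Proof.
suff step j' (M : model) : (forall A, TIR k j' A -> forall e : nat -> M, msat e A) ->
    (forall i, j' = i.+1 -> TIR k j' (Alls K (total_at i))) ->
    forall e : nat -> M, msat e (progressive K (total_at j')).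
  have HP i : Pi2 (total_at i).
    by apply: Pi2_all; apply: Pi2_Sigma1; apply: (@Sigma1_Exs 2); apply: Delta0_subst.
  elim: j => [|j IHj]; rewrite Kk; apply: TIR_rule => //; rewrite -?Kk.
    by apply: TIR_complete => M HM; apply: step.
  by apply: TIR_complete => M HM; apply: step => // i [<-].
move=> HM HT e; have HB := base_TIR HM.
apply/msat_Alls => xs sxs Hlt; apply/msat_total_at; rewrite lcons_iota //.
apply: (tot_progressive HB) => // [|ys sys Hlex]; first exact: tot_start HM HT.
have Hlex' : msat (lcons ys (lcons xs e)) (lex_lt K 0 K).
  apply: (proj1 (msat_bounded (fbounded_lex_lt 0 K) _)) Hlex => x lt_x.
  rewrite /menv -lcons_cat !(lcons_nth (m_zero M)) size_cat sys sxs.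
  by rewrite add0n in lt_x; rewrite lt_x.
have Hy : msat (lcons ys (lcons xs e))
    (fsubst (fun x => if x < K then AVar x else AVar (K + x)) (total_at j')).
  exact: (proj1 (msat_Alls _ _ _) Hlt ys sys Hlex').
move: Hy; rewrite msat_subst msat_total_at; congr (tot (_ :: _)).
rewrite -[RHS](lcons_iota (lcons xs e) sys); apply/eq_in_map => x.
by rewrite mem_iota add0n => /andP[_ ->].
Qed.

(** The finitely many steps after the last application of the rule need no
    transfinite induction. *)
Lemma TIR_tot m (M : model) : (forall A, TIR k m A -> forall e : nat -> M, msat e A) ->
  forall q, tot (mnum M m :: rcons (nseq k (m_zero M)) (mnum M q)).
Proof.
move=> HM q; have HB := base_TIR HM; elim: q => [|q IHq]; last exact: (tot_succ HB).
have -> : rcons (nseq k (m_zero M)) (mnum M 0) = nseq K (m_zero M).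
  by rewrite Kk -cats1 -[[:: _]]/(nseq 1 (m_zero M)) -nseqD addn1.
by apply: (tot_start HM) => j ->; apply: TIR_total_at.
Qed.

End Total.

Lemma abounded_subst p t s : (forall x, abounded p (s x)) -> abounded p (asubst s t).
Proof. by move=> Hs; elim: t => //= t -> u ->. Qed.

Lemma cap_exists L n : exists t, abounded n t /\
  forall e, aeval e t = fg_cap L (\sum_(i < n) e i).+1.
Proof.
have [t Ht] : tm (fun e => fg_cap L (\sum_(i < n) e i).+1).
  exact/tm_fg_cap/tm_succ/tm_sum.
exists (asubst (fun x => if x < n then AVar x else AZero) t); split.
  by apply: abounded_subst => x; case: ifP.
move=> e; rewrite aeval_subst Ht; congr (fg_cap _ _.+1).
by apply: eq_bigr => i _; rewrite ltn_ord.
Qed.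

Lemma sumn_term n : exists t, abounded n t /\ forall e, aeval e t = sumn (mkseq e n).
Proof.
have [t Ht] : tm (fun e => sumn (mkseq e n)).
  have H (g : nat -> nat) : tm (fun e => sumn (mkseq (fun x => e (g x)) n)); last exact: (H id).
  rewrite /mkseq; elim: n 0 => [|n IHn] a /=; first exact: tm_const.
  by apply: tm_add => //; apply: tm_var.
exists (asubst (fun x => if x < n then AVar x else AZero) t); split.
  by apply: abounded_subst => x; case: ifP.
move=> e; rewrite aeval_subst Ht; congr sumn; apply/eq_in_map => x.
by rewrite mem_iota => /andP[_ ->].
Qed.

(** * Elementary functions are provably recursive *)

(** The value of the fast growing function bounds the value of [f] and a
    witness for it; that this bound suffices is a true bounded statement. *)
Theorem elementary_provably_recursive k m q n (f : n.-tuple nat -> nat) :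
  elementary_in (Fmq k m q) f -> provably_recursive (TIR k m) f.
Proof.
move=> /(elementary_bounded_graph (nice_Fmq k m q) (Fmq_bounded_graph k m q q)).
move=> [P [q1 [HP Ps Pc Ple]]]; pose K := k.+1; pose L := K.+1.
have [FG [FG0 FGb FGs]] : exists A, [/\ Delta0 A, fbounded (L + 4) A & forall e, sat e A <->
    fg_graph L (vcode (mkseq e L)) (e (L + 0)) (e (L + 1)) (e (L + 2)) (e (L + 3))].
  apply: D0_formula.
    by apply: D0_fg_graph; try (by apply: tm_var); apply: (tm_vcode (g := fun e x => e x)) => j; apply: tm_var.
  move=> e; rewrite !nth_mkseq ?ltn_add2l //.
  suff -> : mkseq (nth 0 (mkseq e (L + 4))) L = mkseq e L by [].
  apply: (@eq_from_nth _ 0); rewrite !size_mkseq // => i lt_i.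
  by rewrite !nth_mkseq //; apply: ltn_addr.
have [PD PD0 PDs] : D0 (fun e => pdc L (vcode (mkseq e L)) (e (L + 0))
    (vcode (mkseq (fun x => e (L + x.+1)) L)) (e (L + (L + 0).+1))).
  apply: D0_pdc; try (by apply: tm_var).
    by apply: (tm_vcode (g := fun e x => e x)) => j; apply: tm_var.
  by apply: (tm_vcode (g := fun e x => e (L + x.+1))) => j; apply: tm_var.
have [RM RM0 RMs] : D0 (fun e => roomy (e 0) (e 1)) by apply: D0_roomy; apply: tm_var.
have [ZR ZR0 ZRs] : D0 (fun e => forall i, i < K -> e i = 0).
  apply: D0_ext (D0_finall (I := 'I_K) (Q := fun i e => e i = 0) _) => [e|i]; last by d0.
  by split=> H; [move=> i lt_i; apply: (H (Ordinal lt_i))|move=> i; apply: H].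
pose cap i := sval (constructive_indefinite_description _ (cap_exists L i)).
have Hcap i : abounded i (cap i) /\ _ := svalP (constructive_indefinite_description _ (cap_exists L i)).
have [B [B0 Bb Bs]] : exists A, [/\ Delta0 A, fbounded n.+2 A & forall e, sat e A <->
    P (nth 0 [:: e 1, e 0 & mkseq (fun j => e j.+2) n])].
  apply: D0_formula; first by apply: D0_nth => //; tml.
  move=> e; rewrite !nth_mkseq //.
  suff -> : mkseq (fun j => nth 0 (mkseq e n.+2) j.+2) n = mkseq (fun j => e j.+2) n by [].
  by apply/eq_in_map => j; rewrite mem_iota => /andP[_ lt_j]; rewrite nth_mkseq.
have Bv b y (v : n.-tuple nat) : sat (nth 0 [:: b, y & v]) B <-> P (nth 0 [:: y, b & v]).
  rewrite Bs /= (_ : mkseq (fun j => nth 0 v j) n = v) //.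
  by rewrite -[X in mkseq _ X](size_tuple v) mkseq_nth.
exists (Ex B); split=> //.
- exact/Sigma1_ex/Sigma1_Delta0.
- by rewrite /= Bb.
- move=> v y; rewrite sat_Ex; split=> [[b]|<-].
    by rewrite -/(nth 0 (y :: v)) -nth_scons Bv => /Ps.
  exists (iter q1 (jump 0) (Fmq k m q) (sumn v).+1).
  by rewrite -/(nth 0 (f v :: v)) -nth_scons Bv; apply: Pc.
apply: TIR_complete => M HM e0; apply/msat_Alls => vs svs.
have HB := base_TIR HM.
have Ht := TIR_tot (erefl : L = K.+1) FG0 PD0 RM0 ZR0 FGb FGs PDs RMs ZRs
  (fun i => (Hcap i).1) (fun i => (Hcap i).2) (erefl : K = k.+1) HM (q1 + q).
have [t [Eb Et]] := sumn_term n.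
have [y [b Hyb]] := Ht (m_succ (meval (menv (vs ++ [::])) t)).
have Et' ws : meval (menv (vs ++ ws)) t = meval (menv (vs ++ [::])) t.
  by apply: (meval_bounded Eb) => x lt_x; rewrite /menv !(lcons_nth (m_zero M)) !size_cat
    svs addn0 ltn_addr // lt_x !nth_cat svs lt_x.
set e := menv (vs ++ [:: y; b]).
pose EX := bexs 2 (ASucc (AVar (n + 0))) B.
have Htr EX' : Delta0 EX' -> (forall e, sat (nth 0 [seq aeval e t |
      t <- (num m :: rcons (nseq k AZero) (num (q1 + q))) ++
        [:: ASucc AZero; ASucc t; AVar (n + 0); AVar (n + 1)]]) FG ->
    sat (nth 0 [seq aeval e t | t <- vars 0 n ++ [:: AVar (n + 0)]]) EX') ->
    msat (menv (vs ++ [:: y])) EX'.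
  move=> HEX Hs; have := transfer1 HB (e := e) FG0 HEX Hs.
  rewrite !map_cat map_cons map_rcons map_nseq !meval_num menv_vars0 // [meval e]lock /= -lock.
  rewrite /e /= Et' !(menv_at _ _ svs) /=; apply; exact: Hyb.
have HEX : Delta0 EX by apply: Delta0_bexs.
have : msat (menv (vs ++ [:: y])) EX.
  apply: Htr HEX _ => {e} e; rewrite map_cat map_cons map_rcons map_nseq !aeval_num.
  move=> /(FG_at FGs) HFG.
  have /HFG /(fg_graph_sound (L := L)) : size (vmq k m (q1 + q)) = L by rewrite size_vmq.
  move=> /(_ (size_vmq _ _ _)); rewrite vjump_vmq => Ey; rewrite /= in Ey.
  rewrite map_cat aeval_vars; set v := [seq e x | x <- iota 0 n].
  have sv : size v = n by rewrite size_map size_iota.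
  pose tv := Tuple (introT eqP sv).
  have Ey' : iter q1 (jump 0) (Fmq k m q) (sumn v).+1 = e (n + 0).
    by rewrite Ey Et /Fmq iterD.
  rewrite /EX; apply/sat_bexs; exists [:: e (n + 0); f tv]; split=> //.
    rewrite /= -[X in _ < X.+1]/(nth 0 (v ++ [:: e (n + 0)]) (n + 0)).
    rewrite (nth_cat_size _ _ sv) /= ltnSn ltnS andbT -Ey'; exact: (Ple tv).
  rewrite /= -!nth_scons.
  have : sat (nth 0 [:: e (n + 0), f tv & v]) B by apply/(Bv _ _ tv); apply: Pc; rewrite Ey'.
  apply: (proj1 (sat_bounded Bb _)) => -[|[|x]] //= lt_x; rewrite nth_cat sv.
  by rewrite !ltnS in lt_x; rewrite lt_x.
move/msat_bexs => [ws [sws Hws]]; case: ws sws Hws => [|b' [|y' []]] // _ Hb'.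
apply/(msat_Exs _ 2); exists [:: b'; y'] => //; move: Hb'.
apply: (proj1 (msat_bounded Bb _)) => -[|[|x]] //= lt_x.
rewrite !ltnS in lt_x.
by rewrite /menv !(lcons_nth (m_zero M)) size_cat svs nth_cat svs lt_x ltn_addr.
Qed.

(** * Derivation lengths under the lexicographic path order *)

Lemma jump_mono_ge d N G H : nice G -> nice H -> (forall y, N <= y -> G y <= H y) ->
  forall x, N <= x -> jump d G x <= jump d H x.
Proof.
elim: d G H => [|d IHd] G H nG nH le x le_x; rewrite /jump -/jump.
  suff : forall n, N <= iter n H x /\ iter n G x <= iter n H x by move/(_ x.+1) => [].
  elim=> [|n [IH1 IH2]] //=; split; first by apply: leq_trans IH1 (nice_ge _ nH).
  by apply: leq_trans (le _ IH1); apply: nG.2.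
elim: x.+1 => [|n IHn] /=; first exact: le.
suff : forall m y, N <= y -> iter m (jump d) G y <= iter m (jump d) H y.
  by move/(_ n.+1 x le_x).
elim=> [|m IHm] y le_y /=; first exact: le.
by apply: IHd => //; apply: nice_iter_jump.
Qed.

Lemma jump0_le_jump d G x : nice G -> jump 0 G x <= jump d G x.
Proof.
move=> nG; elim: d x => // d IHd x; apply: leq_trans (IHd x) _.
exact: (@iter_jump_leq 1 x.+1 d G x).
Qed.

Lemma iter_jump0_le q d G x : nice G -> q <= x -> iter q (jump 0) G x <= jump d.+1 G x.
Proof.
move=> nG le_q; apply: (@leq_trans (iter x.+1 (jump 0) G x)).
  by apply: iter_jump_leq => //; apply: leqW.
suff : forall n y, iter n (jump 0) G y <= iter n (jump d) G y by move/(_ x.+1 x).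
elim=> // n IHn y /=.
apply: leq_trans (jump0_le_jump d _ (nice_iter_jump n 0 nG)) _.
by apply: jump_mono => //; apply: nice_iter_jump.
Qed.

(** q + omega^(d+1) = omega^(d+1): finitely many iterations are absorbed by an
    argument that exceeds their number. *)
Lemma jump_absorb d q G x : nice G -> q <= x ->
  jump d.+1 (iter q (jump 0) G) x <= jump d.+1 G (x + q).+1.
Proof.
move=> nG le_q; have nGq := nice_iter_jump q 0 nG.
apply: (@leq_trans (iter (x + q).+2 (jump d) G x)); last first.
  exact: (nice_iter_jump _ _ nG).2 _ _ (leqW (leq_addr q x)).
rewrite -[jump d.+1 _ x]/(iter x.+1 (jump d) (iter q (jump 0) G) x).
case: d => [|d].
  by rewrite -iterD; apply: iter_jump_leq => //; lia.
apply: (@leq_trans (iter x.+1 (jump d.+1) (jump d.+1 G) x)); last first.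
  by rewrite -iterSr; apply: iter_jump_leq => //; lia.
have nJ := nice_jump d.+1 nG.
suff : forall n y, q <= y -> iter n (jump d.+1) (iter q (jump 0) G) y <=
    iter n (jump d.+1) (jump d.+1 G) y by apply.
elim=> [|n IHn] y le_y /=; first exact: iter_jump0_le.
by apply: jump_mono_ge le_y => //; apply: nice_iter_jump.
Qed.

Definition lmax (xs : seq nat) : nat := foldr maxn 0 xs.

Lemma lmax_leP xs w : (lmax xs <= w) = all (leq^~ w) xs.
Proof. by elim: xs => //= x xs IH; rewrite geq_max IH. Qed.

Lemma lexlt_rcons a z b y : size b = size a ->
  lexlt (rcons b y) (rcons a z) = lexlt b a || (b == a) && (y < z).
Proof.
elim: a b => [|x a IHa] [|u b] //= => [_|[sb]]; first by rewrite andbF orbF.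
by rewrite IHa // eqseq_cons; case: (ltngtP u x).
Qed.

Section Phi.

Variables (k N : nat) (N_gt0 : 0 < N).

(** The interpretation of a function symbol: [H] bounds the smaller symbols, the
    arguments before the last, padded with zeros to length [k + 1], form the
    vector [a], and the last argument [z] counts iterations. Thus symbols of
    arity at most [k + 2] stay below H iterated to omega^(1+k). *)
Definition phi (H : nat -> nat) (a : seq nat) (z : nat) : nat :=
  iter (N * z.+1) (vjump a H) (lmax (rcons a z) + N).

Lemma phi_le H a z w : nice H -> lmax (rcons a z) <= w ->
  phi H a z <= jump 0 (vjump a H) (N * w.+1).
Proof.
move=> nH le_w; have nv := nice_vjump a nH.
have le_z : z <= w by move: le_w; rewrite lmax_leP all_rcons => /andP[].
rewrite /phi -[jump 0 _ _]/(iter (N * w.+1).+1 (vjump a H) (N * w.+1)).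
apply: (@leq_trans (iter (N * z.+1) (vjump a H) (N * w.+1))).
  by apply: iter_homo => //; rewrite mulnS addnC leq_add2l; nia.
by apply: iter_leq => //; nia.
Qed.

(** Lowering the arguments lexicographically lowers the value by far: either
    [z] decreases, which costs [N] iterations, or [a] decreases, and then the
    iterations needed are bounded by the argument [w]. *)
Lemma phi_lex H b y a z w : nice H -> size b = k.+1 -> size a = k.+1 ->
  lexlt (rcons b y) (rcons a z) -> lmax (rcons b y) <= w ->
  iter (N * z) (vjump a H) (lmax (rcons a z) + N) <= w -> N * w.+1 <= H w ->
  phi H b y <= iter 2 (vjump a H) w.
Proof.
move=> nH sb sa; rewrite lexlt_rcons ?sb ?sa // => lt le_w le_w0 HN.
have nv := nice_vjump a nH.
case/orP: lt => [lt|/andP[/eqP -> lt_yz]]; last first.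
  apply: leq_trans (iter_ge 2 _ nv); apply: leq_trans le_w0; rewrite /phi.
  apply: leq_trans (iter_leq _ nv (_ : N * y.+1 <= N * z)) _; first by rewrite leq_mul2l lt_yz orbT.
  apply: iter_homo => //; rewrite leq_add2r; set M := lmax (rcons a z).
  have : M <= M by []; rewrite {1}/M lmax_leP all_rcons => /andP[le_z Ha].
  by rewrite lmax_leP all_rcons /= Ha (leq_trans (ltnW lt_yz) le_z).
apply: leq_trans (phi_le nH le_w) _.
have sb0 : 0 < size b by rewrite sb.
have E : jump 0 (vjump b H) = vjump (scale 1 1 b) H.
  have := @vjump_scale 1 0 1 b H sb0; rewrite add0n => ->.
  by rewrite (_ : scale 1 0 b = b) //; elim: (b) => //= x [|u c] /=; rewrite ?mul1n ?addn0 // => ->.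
have Ea : scale 1 0 a = a.
  by elim: (a) => //= x [|u c] /=; rewrite ?mul1n ?addn0 // => ->.
have le_n : all (leq^~ (N * w.+1)) (scale 1 1 b).
  move: le_w; rewrite lmax_leP all_rcons => /andP[_ Hb].
  by apply: sub_all (@all_scale 1 1 _ _ isT Hb) => x /=; nia.
have sbx : size b = size a by rewrite sb sa.
have lt' := scale_lexlt 1 sbx lt; rewrite Ea in lt'.
apply: (@leq_trans (vjump a H (N * w.+1))).
  rewrite E; case: lt' => [lt'|-> //].
  by apply: vjump_lexlt => //; rewrite size_scale.
apply: nv.2; apply: leq_trans HN _; exact: vjump_ge.
Qed.

End Phi.

Lemma term_nested_ind (F : vocabulary) (P : term F -> Prop) :
  (forall x, P (Var x)) ->
  (forall g (ts : {ffun 'I_(ar g) -> term F}), (forall i, P (ts i)) -> P (App g ts)) ->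
  forall t, P t.
Proof.
move=> HV HA; exact: (fix IH t := match t return P t with
  | Var x => HV x | App g ts => HA g ts (fun i => IH (ts i)) end).
Qed.

Section LPO.

Variables (F : vocabulary) (k m : nat) (HF : of_type k m F) (Kb C : nat) (C_ge : 4 <= C).

Definition below (g : F) : nat := #|[pred h | prec h g]|.

Lemma below_lt (h g : F) : prec h g -> below h < below g.
Proof.
move=> lt; apply: proper_card; apply/properP; split.
  by apply/subsetP => x; rewrite !inE => lt_xh; apply: prec_trans lt_xh lt.
by exists h; rewrite inE // prec_irr.
Qed.

Lemma below_le g : below g <= #|F|.
Proof. exact: max_card. Qed.

Lemma rk2_lt (h g : F) : prec h g -> 1 < ar h -> rk2 h < rk2 g.
Proof.
move=> lt ah; rewrite [rk2 g]rk2E.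
by apply: (@leq_bigmax_cond _ (fun h => prec h g && (1 < ar h)) (fun h => (rk2 h).+1)); rewrite lt.
Qed.

Lemma rk2_le (h g : F) : prec h g -> rk2 h <= rk2 g.
Proof.
move=> lt; rewrite [rk2 h]rk2E; apply/bigmax_leqP => i /andP[lt_i ai].
by apply: rk2_lt ai; apply: prec_trans lt_i lt.
Qed.

Lemma rk2_type (g : F) : 1 < ar g -> rk2 g < m.
Proof.
move=> ag; case: HF => _ <-.
exact: (@leq_bigmax_cond _ (fun g : F => 1 < ar g) (fun g => (rk2 g).+1)).
Qed.

Lemma rk2_type_le (g : F) : rk2 g <= m.
Proof. by rewrite rk2E; apply/bigmax_leqP => h /andP[_ /rk2_type]. Qed.

Lemma ar_type (g : F) : ar g <= k.+2.
Proof. by case: HF => [E _]; apply: leq_trans (leq_bigmax g) _; rewrite E. Qed.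

(** The symbols of arity greater than 1 below [g] account for the steps by
    omega^(1+k), all symbols below [g] for finitely many more. *)
Definition base (g : F) : nat -> nat := Fmq k (rk2 g) (C * (below g).+1).

Let Q := C * (#|F|).+2.
(** Large enough for two iterations per symbol of a right-hand side, with some
    room for the arguments. *)
Definition iters : nat := 2 * (Kb + 2 + Q).
Let N := iters.

Let nB g : nice (base g).
Proof. exact: nice_Fmq. Qed.

Definition args (g : F) (x : {ffun 'I_(ar g) -> nat}) : seq nat :=
  nseq (k.+2 - ar g) 0 ++ [seq x i | i <- enum 'I_(ar g)].

Lemma size_args (g : F) (x : {ffun 'I_(ar g) -> nat}) : size (args x) = k.+2.
Proof. by rewrite size_cat size_nseq size_map size_enum_ord subnK // ar_type. Qed.

Definition value (g : F) (x : {ffun 'I_(ar g) -> nat}) : nat :=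
  phi N (base g) (take k.+1 (args x)) (nth 0 (args x) k.+1).

Lemma args_rcons (g : F) (x : {ffun 'I_(ar g) -> nat}) :
  args x = rcons (take k.+1 (args x)) (nth 0 (args x) k.+1).
Proof. by rewrite -take_nth ?take_oversize ?size_args. Qed.

Lemma size_take_args (g : F) (x : {ffun 'I_(ar g) -> nat}) : size (take k.+1 (args x)) = k.+1.
Proof. by rewrite size_takel // size_args. Qed.

Lemma lmax_args (g : F) (x : {ffun 'I_(ar g) -> nat}) w :
  lmax (args x) <= w <-> forall i, x i <= w.
Proof.
rewrite lmax_leP all_cat; have -> : all (leq^~ w) (nseq (k.+2 - ar g) 0).
  by apply/allP => y /nseqP [->].
split=> [/allP H i|H]; first by apply: H; apply: map_f; rewrite mem_enum.
by apply/allP => y /mapP [i _ ->].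
Qed.

Lemma lexlt_cat (s b a : seq nat) : lexlt (s ++ b) (s ++ a) = lexlt b a.
Proof. by elim: s => //= x s ->; rewrite ltnn eqxx. Qed.

Lemma lexlt_args (g : F) (y x : {ffun 'I_(ar g) -> nat}) (i : 'I_(ar g)) :
  (forall j : 'I_(ar g), j < i -> y j = x j) -> y i < x i -> lexlt (args y) (args x).
Proof.
move=> eq lt; rewrite /args lexlt_cat.
have Ei : i \in enum 'I_(ar g) by rewrite mem_enum.
have [s [t Es]] : exists s t, enum 'I_(ar g) = s ++ i :: t.
  by case/splitPr: Ei => s t; exists s, t.
rewrite Es !map_cat /=.
have -> : [seq y j | j <- s] = [seq x j | j <- s].
  apply/eq_in_map => j js; apply: eq.
  have /(_ (index j s)) : forall n, n < size s -> nth i (s ++ i :: t) n = n :> nat.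
    move=> n lt_n; rewrite -Es nth_enum_ord //.
    by have := size_enum_ord (ar g); rewrite Es size_cat /=; lia.
  rewrite index_mem js nth_cat index_mem js nth_index // => /(_ isT) Ej.
  have : nth i (s ++ i :: t) (size s) = size s :> nat.
    rewrite -Es nth_enum_ord //; have := size_enum_ord (ar g); rewrite Es size_cat /=; lia.
  by rewrite nth_cat ltnn subnn /= => Ei'; rewrite Ej Ei' index_mem.
by rewrite lexlt_cat /= lt.
Qed.

Lemma base_big (g : F) w : N <= w -> (N * 2) * w.+1 <= base g w.
Proof.
move=> le_w; have w_gt0 : 0 < w by move: le_w; rewrite /N /iters; lia.
apply: leq_trans (iter_jump_mul _ _ nice_succ) _.
apply: (@leq_trans (Fmq k 0 4 w)); last first.
  by apply: Fmq_leq => //; rewrite /base; nia.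
have lt_w : maxn (N * 2) w.+1 <= iter 2 (jump 0) succn w.
  apply: leq_trans (@iter_jump_comp succn 1 0 2 w nice_succ w_gt0 isT isT).
  have := iter_ge_add w.+2 w.+1 nice_succ; rewrite -/(jump 0 succn w.+1) => H.
  by apply: leq_trans H; lia.
apply: leq_trans ((nice_iter_jump 2 0 nice_succ).2 _ _ lt_w) _.
exact: (@iter_jump_comp succn 2 2 4 w nice_succ).
Qed.

(** The inner application of [G] absorbs the number of iterations, the outer
    one the function that is iterated. *)
Lemma value_le (g : F) (x : {ffun 'I_(ar g) -> nat}) G w : nice G ->
  (ar g <= 1 -> forall y, jump 0 (base g) y <= G y) ->
  (1 < ar g -> forall y, Fmq k (rk2 g).+1 0 y <= G y) ->
  (N <= w -> (N * 2) * w.+1 <= G w) ->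
  N <= w -> (forall i, x i <= w) -> value x <= G (G w).
Proof.
move=> nG G1 G2 G3 le_w Hx.
have HN : N * w.+1 <= G w by apply: leq_trans (G3 le_w); nia.
have Hl : lmax (rcons (take k.+1 (args x)) (nth 0 (args x) k.+1)) <= w.
  by rewrite -args_rcons; apply/lmax_args.
have N0 : 0 < N by rewrite /N /iters; lia.
apply: leq_trans (phi_le N0 (nB g) Hl) _.
have [ag|ag] := leqP (ar g) 1.
  have -> : take k.+1 (args x) = nseq k.+1 0.
    rewrite /args take_cat size_nseq; case: ltnP => H.
      by rewrite take_nseq //; lia.
    by rewrite (_ : k.+2 - ar g = k.+1) ?subnn ?take0 ?cats0 //; lia.
  rewrite vjump_nseq0; apply: leq_trans (G1 ag _) _; exact: nG.2.
have sT := size_take_args x.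
have Ht : all (leq^~ (N * w.+1)) (scale 1 1 (take k.+1 (args x))).
  move: Hl; rewrite lmax_leP all_rcons => /andP[_ Hb].
  by apply: sub_all (@all_scale 1 1 _ _ isT Hb) => u /=; nia.
have E (b : seq nat) H : 0 < size b -> jump 0 (vjump b H) = vjump (scale 1 1 b) H.
  move=> sb; have := @vjump_scale 1 0 1 b H sb; rewrite add0n => ->.
  by rewrite (_ : scale 1 0 b = b) //; elim: (b) => //= u [|v c] /=; rewrite ?mul1n ?addn0 // => ->.
rewrite E ?sT //; apply: leq_trans (vjump_le_jump (nB g) Ht) _; rewrite size_scale sT.
have leQ : C * (below g).+1 <= N * w.+1.
  have := below_le g; rewrite /N /iters /Q => ?; nia.
apply: leq_trans (jump_absorb k (nice_Fmq k (rk2 g) 0) leQ) _.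
apply: leq_trans (G2 ag _) _; apply: nG.2; apply: leq_trans (G3 le_w).
have : C * (below g).+1 < N.
  have := below_le g; rewrite /N /iters /Q => ?; nia.
nia.
Qed.

Definition top : nat -> nat := Fmq k m (C * (#|F|).+2).

Lemma value_top (g : F) (x : {ffun 'I_(ar g) -> nat}) w :
  N <= w -> (forall i, x i <= w) -> value x <= top (top w).
Proof.
apply: value_le => [|ag y|ag y|le_w].
- exact: nice_Fmq.
- rewrite -[jump 0 _ y]/(Fmq k (rk2 g) (C * (below g).+1).+1 y); apply: Fmq_leq.
    exact: rk2_type_le.
  by have := below_le g; nia.
- by apply: Fmq_leq => //; apply: rk2_type.
- apply: leq_trans (base_big g le_w) _; apply: Fmq_leq; first exact: rk2_type_le.
  by rewrite leq_mul2l ltnS (leq_trans (below_le g)) ?orbT.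
Qed.

Lemma value_prec (h g : F) (x : {ffun 'I_(ar h) -> nat}) w : prec h g ->
  N <= w -> (forall i, x i <= w) -> value x <= base g (base g w).
Proof.
move=> lt; apply: value_le => [|ah y|ah y|le_w] //.
- rewrite -[jump 0 _ y]/(Fmq k (rk2 h) (C * (below h).+1).+1 y); apply: Fmq_leq.
    exact: rk2_le.
  by have := below_lt lt; nia.
- by apply: Fmq_leq => //; apply: rk2_lt.
- exact: base_big.
Qed.

(** ** Reduction steps decrease the value *)

Fixpoint term_value (rho : nat -> nat) (t : term F) : nat :=
  match t with
  | Var x => rho x
  | App g ts => value [ffun i => term_value rho (ts i)]
  end.

Lemma term_value_subst rho s t : term_value rho (term_subst s t) = term_value (fun x => term_value rho (s x)) t.
Proof.
elim/term_nested_ind: t => //= g ts IH; congr (value _); apply/ffunP => i.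
by rewrite !ffunE IH.
Qed.

(** Bounds for the values of terms of size [j] that are below the term with
    symbol [g] and argument values [x]. *)
Definition stage (g : F) (x : {ffun 'I_(ar g) -> nat}) (j : nat) : nat :=
  iter (2 * j) (vjump (take k.+1 (args x)) (base g))
    (iter (N * nth 0 (args x) k.+1) (vjump (take k.+1 (args x)) (base g)) (lmax (args x) + N)).

Lemma stage_homo (g : F) (x : {ffun 'I_(ar g) -> nat}) i j : i <= j -> stage x i <= stage x j.
Proof. by move=> le; apply: iter_leq; [apply/nice_vjump/nB|rewrite leq_mul2l le orbT]. Qed.

Lemma stageS (g : F) (x : {ffun 'I_(ar g) -> nat}) j :
  stage x j.+1 = iter 2 (vjump (take k.+1 (args x)) (base g)) (stage x j).
Proof. by rewrite /stage mulnS iterD. Qed.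

Lemma stage_ge_args (g : F) (x : {ffun 'I_(ar g) -> nat}) j :
  (forall i, x i <= stage x j) /\ N <= stage x j.
Proof.
have H : lmax (args x) + N <= stage x j.
  rewrite /stage; set u := iter (N * _) _ _; have nv := nice_vjump (take k.+1 (args x)) (nB g).
  by apply: leq_trans (iter_ge _ u nv); apply: iter_ge.
split; last by apply: leq_trans H; apply: leq_addl.
move=> i; have /lmax_args : lmax (args x) <= lmax (args x) by [].
by move=> /(_ i) le; apply: leq_trans le _; apply: leq_trans H; apply: leq_addr.
Qed.

Lemma stage_lt_value (g : F) (x : {ffun 'I_(ar g) -> nat}) j : j <= Kb.+1 -> stage x j < value x.
Proof.
move=> le_j; have nv := nice_vjump (take k.+1 (args x)) (nB g).
rewrite /value /phi /stage -args_rcons -iterD.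
set u := lmax _ + N; set V := vjump _ _.
have -> : N * (nth 0 (args x) k.+1).+1 =
    (N * (nth 0 (args x) k.+1).+1 - (2 * j + N * nth 0 (args x) k.+1)) + (2 * j + N * nth 0 (args x) k.+1).
  by rewrite subnK // mulnS leq_add2r /N /iters; lia.
rewrite [X in _ < X]iterD; set u' := iter (2 * j + _) _ _.
have : 0 < N * (nth 0 (args x) k.+1).+1 - (2 * j + N * nth 0 (args x) k.+1).
  by rewrite subn_gt0 mulnS ltn_add2r /N /iters; lia.
by case: (_ - _) => // n _ /=; apply: leq_ltn_trans (iter_ge n u' nv) (nv.1 _).
Qed.

Lemma value_lex (g : F) (y x : {ffun 'I_(ar g) -> nat}) (i : 'I_(ar g)) j :
  (forall l : 'I_(ar g), l < i -> y l = x l) -> y i < x i ->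
  (forall l, y l <= stage x j) -> value y <= stage x j.+1.
Proof.
move=> eq lt Hy; rewrite stageS.
have [_ HN] := stage_ge_args x j.
have lt' := lexlt_args eq lt; rewrite (args_rcons y) (args_rcons x) in lt'.
have N0 : 0 < N by rewrite /N /iters; lia.
apply: (phi_lex N0 (nB g) (size_take_args y) (size_take_args x) lt').
- by rewrite -args_rcons; apply/lmax_args.
- rewrite -args_rcons /stage; apply: iter_ge; exact/nice_vjump/nB.
- by apply: leq_trans (base_big g HN); nia.
Qed.

(** By induction on the path order: each symbol of [r] costs one stage, and
    there are enough stages below the value of [l] for terms of size at most
    [Kb]. *)
Lemma lpo_value r l : lpo r l -> forall rho, term_size r <= Kb ->
  match l with
  | App g ts => term_value rho r <= stage [ffun i => term_value rho (ts i)] (term_size r)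
  | Var _ => False
  end.
Proof.
elim=> {r l} [g ts i|g ts s i H IH|h g ss ts lt _ IH|g ss ts i _ IH eq _ IHi] rho le_s.
- have [H _] := stage_ge_args [ffun i => term_value rho (ts i)] (term_size (ts i)).
  by have := H i; rewrite ffunE.
- have := IH rho le_s; case E : (ts i) => [//|h us] Hs.
  apply: leq_trans Hs _; have [H' _] := stage_ge_args [ffun i => term_value rho (ts i)] (term_size s).
  apply: leq_trans (H' i); rewrite ffunE E /=; apply/ltnW/stage_lt_value.
  exact: leqW.
- rewrite [term_size _]/= in le_s *.
  have Hj j : term_value rho (ss j) <= stage [ffun i => term_value rho (ts i)] (\sum_(i < ar h) term_size (ss i)).
    have le_j : term_size (ss j) <= \sum_(i < ar h) term_size (ss i) by rewrite (bigD1 j) //= leq_addr.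
    by apply: leq_trans (IH j rho _) (stage_homo _ le_j); apply: leq_trans le_j _; apply: ltnW.
  rewrite stageS /=; have [_ HN] := stage_ge_args [ffun i => term_value rho (ts i)] (\sum_(i < ar h) term_size (ss i)).
  apply: leq_trans (value_prec lt HN _) _; first by move=> j; rewrite ffunE; apply: Hj.
  set u := stage _ _; have nv := nice_vjump (take k.+1 (args [ffun i => term_value rho (ts i)])) (nB g).
  apply: leq_trans ((nB g).2 _ _ (vjump_ge _ u (nB g))) _; exact: vjump_ge.
- rewrite [term_size _]/= in le_s *.
  have Hj j : term_value rho (ss j) <= stage [ffun i => term_value rho (ts i)] (\sum_(i < ar g) term_size (ss i)).
    have le_j : term_size (ss j) <= \sum_(i < ar g) term_size (ss i) by rewrite (bigD1 j) //= leq_addr.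
    by apply: leq_trans (IH j rho _) (stage_homo _ le_j); apply: leq_trans le_j _; apply: ltnW.
  apply: (@value_lex g _ _ i) => [j lt_j||j]; last by rewrite ffunE.
    by rewrite !ffunE eq.
  rewrite !ffunE.
  have le_i : term_size (ss i) <= Kb.
    by apply: leq_trans le_s; rewrite (bigD1 i) //=; lia.
  have := IHi rho le_i; case E : (ts i) => [//|h us] Hs.
  apply: leq_ltn_trans Hs _; apply: stage_lt_value; exact: leqW.
Qed.

Lemma rewrites_value (R : rules F) : (forall l r, List.In (l, r) R -> lpo r l /\ term_size r <= Kb) ->
  forall s t, rewrites R s t -> forall rho, term_value rho t < term_value rho s.
Proof.
move=> HR s t; elim=> {s t} [l r sg /HR [Hlpo le_r] rho|g ss ts i _ IH eq rho].
  rewrite !term_value_subst; have := lpo_value Hlpo (fun x => term_value rho (sg x)) le_r.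
  case: l {Hlpo} => [//|g ts] H; apply: leq_ltn_trans H _; apply: stage_lt_value.
  exact: leqW.
rewrite /=; apply: leq_ltn_trans (_ : _ <= stage [ffun i => term_value rho (ss i)] 1) _; last exact: stage_lt_value.
have Hi : [ffun i => term_value rho (ts i)] i < [ffun i => term_value rho (ss i)] i by rewrite !ffunE.
have Hl j : j != i -> [ffun i => term_value rho (ts i)] j = [ffun i => term_value rho (ss i)] j.
  by move=> /eq; rewrite !ffunE => ->.
apply: (@value_lex g _ _ i 0) => // [j lt_j|j].
  by apply: Hl; apply: contraTneq lt_j => ->; rewrite ltnn.
have [H _] := stage_ge_args [ffun i => term_value rho (ss i)] 0; apply: leq_trans (H j).
by have [->|/Hl ->//] := eqVneq j i; apply: ltnW.
Qed.

(** Iterating beyond all symbols bounds closed terms by their size. *)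
Lemma term_value_top rho t : closed_term t -> term_value rho t <= iter (2 * term_size t) top N.
Proof.
have nT : nice top by apply: nice_Fmq.
elim/term_nested_ind: t => [x Hc|g ts IH Hc]; first by case: (Hc x).
rewrite [term_value _ _]/= [term_size (App _ _)]/=.
set S := \sum_(i < _) _; apply: (@leq_trans (iter 2 top (iter (2 * S) top N))); last first.
  by rewrite -iterD; apply: iter_leq => //; rewrite mulnS.
apply: value_top; first exact: iter_ge.
move=> i; rewrite ffunE; apply: leq_trans (IH i _) _; first by move=> x Hx; apply: (Hc x); exists i.
apply: iter_leq => //.
by rewrite leq_mul2l /S (bigD1 i) //= leq_addr.
Qed.

Lemma value_base (g : F) (x : {ffun 'I_(ar g) -> nat}) w : (forall i, x i <= w) ->
  (exists i, x i = w) \/ w = 0 -> iter C (jump 0) succn (w + N) <= value x.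
Proof.
move=> Hx Hw; have nv := nice_vjump (take k.+1 (args x)) (nB g).
apply: (@leq_trans (stage x 1)); last by apply/ltnW/stage_lt_value.
have le_w : w + N <= stage x 0.
  have [H1 H2] := stage_ge_args x 0; rewrite /stage.
  set u := lmax _ + N; apply: (@leq_trans u); last by apply: leq_trans (iter_ge _ _ nv); apply: iter_ge.
  rewrite /u leq_add2r; case: Hw => [[i <-]|-> //].
  by have /lmax_args : lmax (args x) <= lmax (args x) by [].
rewrite stageS /=; apply: leq_trans (nice_ge _ nv).
apply: leq_trans (vjump_ge _ _ (nB g)).
apply: leq_trans ((nice_iter_jump C 0 nice_succ).2 _ _ le_w) _.
by apply: (@Fmq_leq k 0 _ C); rewrite // leq_pmulr.
Qed.

End LPO.

(** * Derivation lengths are elementary in the fast growing functions *)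

Lemma vcode_ge xs : all (leq^~ (vcode xs)) xs.
Proof.
elim: xs => //= x xs IH; rewrite pr_gel /=.
by apply: sub_all IH => y /leq_trans; apply; apply: pr_ger.
Qed.

Lemma vcode_nseq_leq M p q : p <= q -> vcode (nseq p M) <= vcode (nseq q M).
Proof.
move=> /subnKC <-; elim: (q - p) => [|r IH]; first by rewrite addn0.
by rewrite addnS /=; apply: leq_trans IH (pr_ger _ _).
Qed.

Lemma tm_vcode_map (T : Type) (s : seq T) (f : T -> (nat -> nat) -> nat) :
  (forall i, tm (f i)) -> tm (fun e => vcode [seq f i e | i <- s]).
Proof. by move=> Hf; elim: s => [|i s IH]; [apply: tm_const|apply: tm_pr]. Qed.

Lemma tm_bigsum n (f : 'I_n -> (nat -> nat) -> nat) :
  (forall i, tm (f i)) -> tm (fun e => \sum_(i < n) f i e).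
Proof.
elim: n f => [|n IH] f Hf.
  suff -> : (fun e => \sum_(i < 0) f i e) = (fun=> 0) by apply: tm_const.
  by apply: functional_extensionality => e; rewrite big_ord0.
suff -> : (fun e => \sum_(i < n.+1) f i e) =
    (fun e => \sum_(i < n) f (widen_ord (leqnSn n) i) e + f ord_max e).
  by apply: tm_add => //; apply: (IH (fun i => f (widen_ord (leqnSn n) i))).
by apply: functional_extensionality => e; rewrite big_ord_recr.
Qed.

Section TermCodes.

Variable F : vocabulary.

Definition app_code (g : F) (c : 'I_(ar g) -> nat) : nat :=
  pr (enum_rank g).+1 (vcode [seq c i | i <- enum 'I_(ar g)]).

(** The code of the instances of the pattern [t], as a function of the codes
    [r x] of the terms substituted. *)
Fixpoint pcode (r : nat -> nat) (t : term F) : nat :=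
  match t with
  | Var x => r x
  | App g ts => app_code (fun i => pcode r (ts i))
  end.

Definition code : term F -> nat := pcode (pr 0).

Lemma app_code_lt (g : F) (c : 'I_(ar g) -> nat) i : c i < app_code c.
Proof.
have := vcode_ge [seq c i | i <- enum 'I_(ar g)]; rewrite /app_code.
set v := vcode _ => /allP /(_ (c i)) H.
have {}H : c i <= v by apply: H; apply: map_f; rewrite mem_enum.
by rewrite /pr; nia.
Qed.

Lemma app_code_eq (g : F) (c c' : 'I_(ar g) -> nat) : app_code c = app_code c' -> c =1 c'.
Proof.
move=> /pr_inj [_ /vcode_inj E] i; have {}E := E _.
have /eq_in_map : [seq c i | i <- enum 'I_(ar g)] = [seq c' i | i <- enum 'I_(ar g)].
  by apply: E; rewrite !size_map.
by apply; rewrite mem_enum.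
Qed.

Lemma app_code_sym (g h : F) (c : 'I_(ar g) -> nat) (c' : 'I_(ar h) -> nat) :
  app_code c = app_code c' -> g = h.
Proof. by move=> /pr_inj [[/ord_inj /enum_rank_inj]]. Qed.

Lemma code_Var_App x (g : F) (c : 'I_(ar g) -> nat) : pr 0 x <> app_code c.
Proof. by move=> /pr_inj []. Qed.

Lemma pcode_subst r s t : pcode r (term_subst s t) = pcode (fun x => pcode r (s x)) t.
Proof.
elim/term_nested_ind: t => //= g ts IH; congr app_code; apply: functional_extensionality => i.
by rewrite ffunE IH.
Qed.

Lemma eq_pcode r r' t : (forall x, occurs x t -> r x = r' x) -> pcode r t = pcode r' t.
Proof.
elim/term_nested_ind: t => [x|g ts IH] /= H; first exact: H.
congr app_code; apply: functional_extensionality => i; apply: IH => x Hx.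
by apply: H; exists i.
Qed.

Lemma code_inj s t : code s = code t -> s = t.
Proof.
elim/term_nested_ind: s t => [x|g ss IH] [y|h ts]; rewrite /code /=.
- by move=> /pr_inj [_ ->].
- by move=> /code_Var_App.
- by move=> /esym /code_Var_App.
- move=> E; have Eg := app_code_sym E; subst h.
  congr App; apply/ffunP => i; apply: IH; exact: (app_code_eq E i).
Qed.

Definition term_of_code (c : nat) : term F := epsilon (inhabits (Var 0)) (fun t => code t = c).

Lemma term_of_codeK t : term_of_code (code t) = t.
Proof. by apply: code_inj; apply: (epsilon_spec _ (fun s => code s = code t)); exists t. Qed.

(** Codes are injective, so matching a term with a pattern is comparing codes;
    substitutions need not be coded. *)
Lemma code_match r l t : code t = pcode r l ->
  t = term_subst (fun x => term_of_code (r x)) l /\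
  forall x, occurs x l -> code (term_of_code (r x)) = r x.
Proof.
elim/term_nested_ind: l t => [x|g ls IH] [y|h ts] /=.
- by move=> E; rewrite -E term_of_codeK; split=> // ? ->; rewrite -E term_of_codeK.
- by move=> E; rewrite -E term_of_codeK; split=> // ? ->; rewrite -E term_of_codeK.
- by move=> /code_Var_App.
- rewrite {1}/code /= => E; have Eg := app_code_sym E; subst h.
  have Ei i := IH i _ (app_code_eq E i).
  split; last by move=> x [i Hx]; apply: (proj2 (Ei i)).
  by congr App; apply/ffunP => i; rewrite ffunE -(proj1 (Ei i)).
Qed.

Lemma pcode_occurs r x t : occurs x t -> r x <= pcode r t.
Proof.
elim/term_nested_ind: t => [y ->|g ts IH [i Hx]] //=.
by apply: leq_trans (IH i Hx) _; apply/ltnW/(@app_code_lt _ (fun i => pcode r (ts i))).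
Qed.

Lemma tm_app_code (g : F) (c : (nat -> nat) -> 'I_(ar g) -> nat) :
  (forall i, tm (fun e => c e i)) -> tm (fun e => app_code (c e)).
Proof.
move=> Hc; apply: tm_pr; first exact: tm_const.
exact: (@tm_vcode_map _ (enum 'I_(ar g)) (fun i e => c e i)).
Qed.

Lemma tm_pcode (r : (nat -> nat) -> nat -> nat) t :
  (forall x, tm (fun e => r e x)) -> tm (fun e => pcode (r e) t).
Proof.
move=> Hr; elim/term_nested_ind: t => //= g ts IH.
exact: (@tm_app_code g (fun e i => pcode (r e) (ts i))).
Qed.

Fixpoint var_bound (t : term F) : nat :=
  match t with
  | Var x => x.+1
  | App g ts => \max_(i < ar g) var_bound (ts i)
  end.

Lemma occurs_lt x t : occurs x t -> x < var_bound t.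
Proof.
elim/term_nested_ind: t => [y ->|g ts IH [i /IH le]] //=.
by apply: leq_trans le _; apply: (@leq_bigmax _ (fun i => var_bound (ts i))).
Qed.

End TermCodes.

Section Derivations.

Variables (F : vocabulary) (R : rules F).
Hypothesis R_trs : is_trs R.

Lemma D0_exrule P : (forall lr, D0 (P lr)) -> D0 (fun e => exists2 lr, List.In lr R & P lr e).
Proof.
move=> HP; elim: (R) => [|lr s IH]; first by apply: D0_ext (D0_const False) => e; split=> // -[].
apply: D0_ext (D0_or (HP lr) IH) => e; split=> [[H|[x Hx H]]|[x [<-|Hx] H]].
- by exists lr => //; left.
- by exists x => //; right.
- by left.
- by right; exists x.
Qed.

Lemma D0_finex (I : finType) (Q : I -> (nat -> nat) -> Prop) :
  (forall i, D0 (Q i)) -> D0 (fun e => exists i, Q i e).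
Proof.
move=> HQ; apply: D0_ext (D0_not (D0_finall (fun i => D0_not (HQ i)))) => e.
split=> [H|[i Hi] /(_ i)//]; by apply: NNPP => Hn; apply: H => i Hi; apply: Hn; exists i.
Qed.

(** Justifications of the facts that [a] codes a closed term of size [c], that
    [a] codes a term that rewrites to the one coded by [c], and that a
    derivation of length [c] starts from the term coded by [a]. *)
Definition size_step (b : nat) (S : nat -> Prop) (a c : nat) : Prop :=
  exists g : F, exists cs, [/\ size cs = ar g + ar g, all (leq^~ b) cs &
    [/\ a = app_code (fun i : 'I_(ar g) => nth 0 cs i),
        c = (\sum_(i < ar g) nth 0 cs (ar g + i)).+1 &
        forall i : 'I_(ar g), S (pr 0 (pr (nth 0 cs i) (nth 0 cs (ar g + i))))]].

Definition rule_step (b a c : nat) : Prop :=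
  exists2 lr, List.In lr R & exists cs,
    [/\ size cs = var_bound lr.1, all (leq^~ b) cs &
        a = pcode (nth 0 cs) lr.1 /\ c = pcode (nth 0 cs) lr.2].

Definition ctx_step (b : nat) (S : nat -> Prop) (a c : nat) : Prop :=
  exists g : F, exists i : 'I_(ar g), exists cs, [/\ size cs = (ar g).+1, all (leq^~ b) cs &
    [/\ a = app_code (fun j : 'I_(ar g) => nth 0 cs j),
        c = app_code (fun j : 'I_(ar g) => nth 0 cs (if j == i then ar g else j)) &
        S (pr 1 (pr (nth 0 cs i) (nth 0 cs (ar g))))]].

Definition derivation_step (b : nat) (S : nat -> Prop) (a c : nat) : Prop :=
  c = 0 \/ exists2 c', c' < c & exists2 u, u <= b &
    [/\ c = c'.+1, S (pr 1 (pr a u)) & S (pr 2 (pr u c'))].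

Definition trs_step (b : nat) (S : nat -> Prop) (t : nat) : Prop :=
  exists2 a, a <= t & exists2 c, c <= t &
    [\/ t = pr 0 (pr a c) /\ size_step b S a c,
        t = pr 1 (pr a c) /\ (rule_step b a c \/ ctx_step b S a c)
      | t = pr 2 (pr a c) /\ derivation_step b S a c].

Definition starts (t : term F) (N : nat) : Prop :=
  exists u : nat -> term F, u 0 = t /\ forall i, i < N -> rewrites R (u i) (u i.+1).

Lemma startsS t N : starts t N.+1 <-> exists2 t', rewrites R t t' & starts t' N.
Proof.
split=> [[u [<- Hu]]|[t' Ht [u [Eu Hu]]]].
  by exists (u 1); [apply: Hu|exists (fun i => u i.+1); split=> // i lt_i; apply: Hu].
exists (fun i => if i is j.+1 then u j else t); split=> // -[|i] lt_i; first by rewrite Eu.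
exact: Hu.
Qed.

Section Sound.

Variables (b : nat) (S : nat -> Prop) (HS : forall t, S t -> trs_step b S t).

Lemma size_sound a c : S (pr 0 (pr a c)) -> exists t : term F, [/\ closed_term t, code t = a & term_size t = c].
Proof.
elim/ltn_ind: a c => a IH c /HS [a' _ [c' _ [[/pr_inj [_ /pr_inj [<- <-]] H]|[/pr_inj []]|[/pr_inj []]]]] //.
case: H => g [cs [_ _ [Ea -> HSi]]].
have Hi (i : 'I_(ar g)) : exists t : term F, [/\ closed_term t, code t = nth 0 cs i & term_size t = nth 0 cs (ar g + i)].
  by apply: IH (HSi i); rewrite Ea; apply: (@app_code_lt _ _ (fun i : 'I_(ar g) => nth 0 cs i)).
have [ts Hts] := choice _ Hi.
exists (App g [ffun i => ts i]); split.
- by move=> x [i]; rewrite ffunE; have [Hc _ _] := Hts i; apply: Hc.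
- rewrite /code /= Ea; congr app_code; apply: functional_extensionality => i.
  by rewrite ffunE; have [_ <- _] := Hts i.
- by rewrite /=; congr _.+1; apply: eq_bigr => i _; rewrite ffunE; have [_ _ ->] := Hts i.
Qed.

Lemma step_sound a c : S (pr 1 (pr a c)) -> forall t : term F, code t = a ->
  exists2 t', code t' = c & rewrites R t t'.
Proof.
elim/ltn_ind: a c => a IH c /HS [a' _ [c' _ [[/pr_inj []]|[/pr_inj [_ /pr_inj [<- <-]] H]|[/pr_inj []]]]] // t Et.
case: H => [[[l r] Hlr [cs [_ _ [Ea Ec]]]]|[g [i [cs [_ _ [Ea Ec HSi]]]]]].
  rewrite Ea in Et; have [-> Hx] := code_match Et.
  exists (term_subst (fun x => term_of_code F (nth 0 cs x)) r); last exact: rewrites_rule Hlr.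
  rewrite /code pcode_subst Ec; apply: eq_pcode => x Hr.
  by apply: Hx; apply: (proj2 (R_trs Hlr)).
case: t Et => [x|h ts]; rewrite Ea /code /= => Et; first by case: (code_Var_App Et).
have Eg := app_code_sym Et; subst h.
have Ei := app_code_eq Et.
have lt_i : nth 0 cs i < a by rewrite Ea; apply: (@app_code_lt _ _ (fun i : 'I_(ar g) => nth 0 cs i)).
have [t' Et' Ht'] := IH _ lt_i _ HSi (ts i) (Ei i).
exists (App g [ffun j => if j == i then t' else ts j]).
  rewrite /code /= Ec; congr app_code; apply: functional_extensionality => j.
  by rewrite ffunE; case: (j == i); [rewrite -Et'|rewrite -Ei].
apply: (@rewrites_ctx _ _ g _ _ i); first by rewrite ffunE eqxx.
by move=> j ne; rewrite ffunE (negbTE ne).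
Qed.

Lemma derivation_sound a c : S (pr 2 (pr a c)) -> forall t : term F, code t = a -> starts t c.
Proof.
elim: c a => [|c IH] a; first by move=> _ t _; exists (fun=> t).
move=> /HS [a' _ [c' _ [[/pr_inj []]|[/pr_inj []]|[/pr_inj [_ /pr_inj [<- <-]] H]]]] // t Et.
case: H => [//|[c'' _ [u _ [[<-] S1 S2]]]].
by have [t' Et' Ht'] := step_sound S1 Et; apply/startsS; exists t' => //; apply: IH S2 _ Et'.
Qed.

End Sound.

Section Complete.

(** Any measure that decreases along reductions and exceeds the codes makes
    the facts about terms of small measure justify each other. *)
Variables (mu : term F -> nat) (M b : nat).
Hypothesis mu_step : forall s t, rewrites R s t -> mu t < mu s.
Hypothesis mu_code : forall t, code t <= mu t.

Definition trs_fact (y : nat) : Prop :=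
  [\/ exists t : term F, [/\ closed_term t, code t <= M, term_size t <= M &
        y = pr 0 (pr (code t) (term_size t))],
      exists s t, [/\ rewrites R s t, code s <= M, code t <= M & y = pr 1 (pr (code s) (code t))]
    | exists t N, [/\ starts t N, mu t <= M, N <= M & y = pr 2 (pr (code t) N)]].

Definition trs_cap : nat := pr 2 (pr M M).

Lemma trs_fact_le y : trs_fact y -> y <= trs_cap.
Proof.
case=> [[t [_ ? ? ->]]|[s [t [_ ? ? ->]]]|[t [N [_ le_t ? ->]]]]; do ! apply: pr_mono => //.
exact: leq_trans (mu_code t) le_t.
Qed.

Hypothesis Hb : roomy trs_cap b.

Let le_Mb : M <= b.
Proof.
have le : trs_cap <= b by case: Hb => ? _ [? _ []].
by apply: leq_trans le; apply: leq_trans (pr_ger _ _); apply: pr_gel.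
Qed.

Lemma trs_fact_step y : trs_fact y -> trs_step b (fun z => z <= trs_cap /\ trs_fact z) y.
Proof.
have Hin z : trs_fact z -> z <= trs_cap /\ trs_fact z by move=> Hz; split=> //; apply: trs_fact_le.
have pr_le a c n : a <= pr n (pr a c) /\ c <= pr n (pr a c).
  by split; apply: leq_trans (pr_ger _ _); [apply: pr_gel|apply: pr_ger].
case=> [[t [Hc le_c le_s ->]]|[s [t [Hst le_s le_t ->]]]|[t [N [Ht le_t le_N ->]]]].
- have [La Lc] := pr_le (code t) (term_size t) 0.
  exists (code t) => //; exists (term_size t) => //; constructor 1; split=> //.
  case: t Hc le_c le_s {La Lc} => [x|g ts] Hc le_c le_s; first by case: (Hc x).
  have code_lt i : code (ts i) <= M.
    by apply: leq_trans le_c; apply/ltnW/(@app_code_lt _ _ (fun i => code (ts i))).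
  have size_le i : term_size (ts i) <= M.
    by apply: leq_trans le_s; rewrite /= (bigD1 i) //=; apply: leqW; apply: leq_addr.
  set l := ar g; set cs := [seq code (ts i) | i <- enum 'I_l].
  set ss := [seq term_size (ts i) | i <- enum 'I_l].
  have Ecs : size cs = l by rewrite size_map size_enum_ord.
  have csE (i : 'I_l) : nth 0 (cs ++ ss) i = code (ts i).
    by rewrite nth_cat Ecs ltn_ord (nth_map i) ?size_enum_ord // nth_ord_enum.
  have ssE (i : 'I_l) : nth 0 (cs ++ ss) (l + i) = term_size (ts i).
    by rewrite nth_cat Ecs ltnNge leq_addr /= addKn (nth_map i) ?size_enum_ord // nth_ord_enum.
  exists g, (cs ++ ss); split.
  + by rewrite size_cat Ecs size_map size_enum_ord.
  + by rewrite all_cat; apply/andP; split; apply/allP => x /mapP [i _ ->]; apply: leq_trans le_Mb.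
  split.
  + by rewrite /code /=; congr app_code; apply: functional_extensionality => i; rewrite csE.
  + by rewrite /=; congr _.+1; apply: eq_bigr => i _; rewrite ssE.
  move=> i; rewrite csE ssE; apply: Hin.
  by constructor 1; exists (ts i); split=> // x Hx; apply: (Hc x); exists i.
- have [La Lc] := pr_le (code s) (code t) 1.
  exists (code s) => //; exists (code t) => //; constructor 2; split=> //.
  case: Hst le_s le_t => [l r sg Hlr|g ss ts i Hst eq] le_s le_t.
    left; exists (l, r) => //; pose c x := if excluded_middle_informative (occurs x l) is left _ then code (sg x) else 0.
    have cE x : occurs x l -> c x = code (sg x) by rewrite /c; case: excluded_middle_informative.
    exists (mkseq c (var_bound l)); split; first by rewrite size_mkseq.
      apply/allP => _ /mapP [x _ ->]; rewrite /c; case: excluded_middle_informative => //= Hx.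
      apply: leq_trans le_Mb; apply: leq_trans le_s; rewrite /code pcode_subst.
      exact: (@pcode_occurs _ (fun x => code (sg x))).
    split; rewrite /code pcode_subst; apply: eq_pcode => x Hx.
      by rewrite nth_mkseq ?cE //; apply: occurs_lt.
    have Hl := proj2 (R_trs Hlr) x Hx.
    by rewrite nth_mkseq ?cE //; apply: occurs_lt.
  have lt_s j : code (ss j) <= M.
    by apply: leq_trans le_s; apply/ltnW/(@app_code_lt _ _ (fun i => code (ss i))).
  have lt_t j : code (ts j) <= M.
    by apply: leq_trans le_t; apply/ltnW/(@app_code_lt _ _ (fun i => code (ts i))).
  right; set l := ar g; set cs := [seq code (ss i) | i <- enum 'I_l].
  have Ecs : size cs = l by rewrite size_map size_enum_ord.
  have csE (j : 'I_l) : nth 0 (rcons cs (code (ts i))) j = code (ss j).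
    by rewrite nth_rcons Ecs ltn_ord (nth_map j) ?size_enum_ord // nth_ord_enum.
  have csl : nth 0 (rcons cs (code (ts i))) l = code (ts i) by rewrite nth_rcons Ecs ltnn eqxx.
  exists g, i, (rcons cs (code (ts i))); split.
  + by rewrite size_rcons Ecs.
  + rewrite all_rcons (leq_trans (lt_t i) le_Mb).
    by apply/allP => x /mapP [j _ ->]; apply: leq_trans le_Mb.
  split.
  + by rewrite /code /=; congr app_code; apply: functional_extensionality => j; rewrite csE.
  + rewrite {1}/code /=; congr app_code; apply: functional_extensionality => j.
    by have [->|/eq <-] := eqVneq j i; rewrite ?csl ?csE.
  by rewrite csE csl; apply: Hin; constructor 2; exists (ss i), (ts i).
- have [La Lc] := pr_le (code t) N 2.
  exists (code t) => //; exists N => //; constructor 3; split=> //.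
  case: N Ht le_N {La Lc} => [|N] Ht le_N; first by left.
  have /startsS [t' Ht' Hs] := Ht.
  have le_t' : mu t' <= M by apply: leq_trans le_t; apply/ltnW/mu_step.
  have le_c s : mu s <= M -> code s <= M by apply: leq_trans.
  right; exists N => //; exists (code t'); first by apply: leq_trans le_Mb; apply: le_c.
  split=> //; apply: Hin.
    by constructor 2; exists t, t'; split=> //; apply: le_c.
  by constructor 3; exists t', N; split=> //; apply: ltnW.
Qed.

End Complete.

Definition derivation_graph (n N b : nat) : Prop :=
  exists2 c, c <= b & exists2 s, s <= n &
    table (trs_step b) b (pr 0 (pr c s)) /\ table (trs_step b) b (pr 2 (pr c N)).

Lemma starts_le (mu : term F -> nat) t N :
  (forall s t, rewrites R s t -> mu t < mu s) -> starts t N -> N <= mu t.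
Proof.
move=> Hmu; elim: N t => // N IH t /startsS [t' /Hmu lt /IH le].
exact: leq_ltn_trans le lt.
Qed.

Lemma derivation_graphP (mu : term F -> nat) (M n N b : nat) :
  (forall s t, rewrites R s t -> mu t < mu s) -> (forall t, code t <= mu t) ->
  (forall t, closed_term t -> term_size t <= n -> mu t <= M) -> n <= M ->
  roomy (trs_cap M) b -> derivation_graph n N b <-> derivation R n N.
Proof.
move=> mu_step mu_code mu_le le_n Hb; split=> [[c _ [s le_s [H0 H2]]]|[u [Hc le_s Hu]]].
  have [t [Hc Ec Es]] : exists t : term F, [/\ closed_term t, code t = c & term_size t = s].
    pose P y := forall c s, y = pr 0 (pr c s) ->
      exists t : term F, [/\ closed_term t, code t = c & term_size t = s].
    apply: (table_sound (P := P) _ H0) => // S HS y Sy a d Ey.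
    by rewrite Ey in Sy; apply: size_sound HS _ _ Sy.
  have [u [Eu Hu]] : starts t N.
    pose P y := forall c N, y = pr 2 (pr c N) -> forall t : term F, code t = c -> starts t N.
    apply: (table_sound (P := P) _ H2) Ec => // S HS y Sy a d Ey.
    by rewrite Ey in Sy; apply: derivation_sound HS _ _ Sy.
  by exists u; split; rewrite ?Eu ?Es.
have le_mu := mu_le _ Hc le_s; have le_c := leq_trans (mu_code (u 0)) le_mu.
have Hs : starts (u 0) N by exists u.
have le_N : N <= M by apply: leq_trans (starts_le mu_step Hs) le_mu.
have le_b : trs_cap M <= b by case: Hb => ? _ [? _ []].
have Hstep y : y <= trs_cap M -> trs_fact mu M y ->
    trs_step b (fun z => z <= trs_cap M /\ trs_fact mu M z) y.
  by move=> _; apply: trs_fact_step.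
exists (code (u 0)).
  apply: leq_trans le_b; apply: leq_trans (pr_ger _ _); exact: leq_trans le_c (pr_gel _ _).
exists (term_size (u 0)) => //; split.
- have H : trs_fact mu M (pr 0 (pr (code (u 0)) (term_size (u 0)))).
    by constructor 1; exists (u 0); split=> //; apply: leq_trans le_n.
  by apply: (table_complete Hb (trs_fact_le mu_code H) H).
- have H : trs_fact mu M (pr 2 (pr (code (u 0)) N)) by constructor 3; exists (u 0), N.
  by apply: (table_complete Hb (trs_fact_le mu_code H) H).
Qed.

Lemma lcons_lt (ys : seq nat) (e : nat -> nat) i : i < size ys -> lcons ys e i = nth 0 ys i.
Proof. by move=> lt; rewrite (lcons_nth 0) lt. Qed.

Lemma lcons_add (ys : seq nat) (e : nat -> nat) n j : size ys = n -> lcons ys e (n + j) = e j.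
Proof. by move=> <-; rewrite (lcons_nth 0) ltnNge leq_addr addKn. Qed.

Let memS (e : nat -> nat) z := z <= e 1 /\ code_mem (e 2) (e 3) z.

Lemma D0_size_step : D0 (fun e => size_step (e 0) (memS e) (e 4) (e 5)).
Proof.
apply: D0_finex => g; set l := ar g.
pose Q (e : nat -> nat) := [/\ e (l + l + 4) = app_code (fun i : 'I_l => e i),
  e (l + l + 5) = (\sum_(i < l) e (l + i)).+1 &
  forall i : 'I_l, pr 0 (pr (e i) (e (l + i))) <= e (l + l + 1) /\
    code_mem (e (l + l + 2)) (e (l + l + 3)) (pr 0 (pr (e i) (e (l + i))))].
have HQ : D0 Q.
  apply: D0_and3.
  - apply: D0_eq; first by d0.
    by apply: (@tm_app_code F g (fun e i => e i)) => i; d0.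
  - by apply: D0_eq; [d0|apply/tm_succ/(@tm_bigsum l (fun i e => e (l + i))) => i; d0].
  - by apply: D0_finall => i; d0.
apply: D0_ext (D0_bexs (l + l) (tm_var 0) HQ) => e.
have H ys : size ys = l + l -> Q (lcons ys e) <->
    [/\ e 4 = app_code (fun i : 'I_l => nth 0 ys i), e 5 = (\sum_(i < l) nth 0 ys (l + i)).+1 &
       forall i : 'I_l, memS e (pr 0 (pr (nth 0 ys i) (nth 0 ys (l + i))))].
  move=> sy; rewrite /Q /memS !(lcons_add _ _ sy).
  have E1 (i : 'I_l) : lcons ys e i = nth 0 ys i.
    by rewrite lcons_lt // sy; apply: leq_trans (ltn_ord i) (leq_addr _ _).
  have E2 (i : 'I_l) : lcons ys e (l + i) = nth 0 ys (l + i).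
    by rewrite lcons_lt // sy ltn_add2l.
  have -> : (fun i : 'I_l => lcons ys e i) = (fun i : 'I_l => nth 0 ys i).
    exact: functional_extensionality.
  rewrite (eq_bigr (fun i : 'I_l => nth 0 ys (l + i))); last by move=> i _; apply: E2.
  by split=> -[-> -> h]; split=> // i; move: (h i); rewrite E1 E2.
by split=> -[ys [sy Hy /(H _ sy) h]]; exists ys.
Qed.

Lemma D0_rule_step : D0 (fun e => rule_step (e 0) (e 4) (e 5)).
Proof.
apply: D0_exrule => -[l r] /=; set n := var_bound l.
pose c (e : nat -> nat) x := if x < n then e x else 0.
pose Q e := e (n + 4) = pcode (c e) l /\ e (n + 5) = pcode (c e) r.
have Hc x : tm (fun e => c e x) by rewrite /c; case: (x < n); d0.
have HQ : D0 Q by apply: D0_and; apply: D0_eq; try exact: tm_pcode; d0.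
apply: D0_ext (D0_bexs n (tm_var 0) HQ) => e.
have H ys : size ys = n -> Q (lcons ys e) <-> e 4 = pcode (nth 0 ys) l /\ e 5 = pcode (nth 0 ys) r.
  move=> sy; rewrite /Q !(lcons_add _ _ sy).
  suff -> : c (lcons ys e) = nth 0 ys by [].
  apply: functional_extensionality => x; rewrite /c; case: ltnP => le; first by rewrite lcons_lt ?sy.
  by rewrite nth_default ?sy.
by split=> -[ys [sy Hy /(H _ sy) h]]; exists ys.
Qed.

Lemma D0_ctx_step : D0 (fun e => ctx_step (e 0) (memS e) (e 4) (e 5)).
Proof.
apply: D0_finex => g; apply: D0_finex => i; set l := ar g.
pose Q (e : nat -> nat) := [/\ e (l.+1 + 4) = app_code (fun j : 'I_l => e j),
  e (l.+1 + 5) = app_code (fun j : 'I_l => e (if j == i then l else j)) &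
  pr 1 (pr (e i) (e l)) <= e (l.+1 + 1) /\
    code_mem (e (l.+1 + 2)) (e (l.+1 + 3)) (pr 1 (pr (e i) (e l)))].
have HQ : D0 Q.
  apply: D0_and3; last by d0.
  - apply: D0_eq; first by d0.
    by apply: (@tm_app_code F g (fun e i => e i)) => j; d0.
  - apply: D0_eq; first by d0.
    by apply: (@tm_app_code F g (fun e j => e (if j == i then l else j))) => j; d0.
apply: D0_ext (D0_bexs l.+1 (tm_var 0) HQ) => e.
have H ys : size ys = l.+1 -> Q (lcons ys e) <->
    [/\ e 4 = app_code (fun j : 'I_l => nth 0 ys j),
       e 5 = app_code (fun j : 'I_l => nth 0 ys (if j == i then l else j)) &
       memS e (pr 1 (pr (nth 0 ys i) (nth 0 ys l)))].
  move=> sy; rewrite /Q /memS !(lcons_add _ _ sy).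
  have E1 (j : nat) : j <= l -> lcons ys e j = nth 0 ys j by move=> le; rewrite lcons_lt // sy.
  have -> : (fun j : 'I_l => lcons ys e j) = (fun j : 'I_l => nth 0 ys j).
    by apply: functional_extensionality => j; apply/E1/ltnW.
  have -> : (fun j : 'I_l => lcons ys e (if j == i then l else j)) =
      (fun j : 'I_l => nth 0 ys (if j == i then l else j)).
    by apply: functional_extensionality => j; apply/E1; case: (j == i) => //; apply: ltnW.
  by rewrite !E1 // ltnW.
by split=> -[ys [sy Hy /(H _ sy) h]]; exists ys.
Qed.

Lemma D0_derivation_graph : D0 (fun e => derivation_graph (e 0) (e 1) (e 2)).
Proof.
have sub P : D0 (fun e => P (e 0) (memS e) (e 4) (e 5)) -> forall b N s c a d,
    D0 (fun e => P (e b) (fun z => z <= e N /\ code_mem (e s) (e c) z) (e a) (e d)).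
  move=> HP b N s c a d.
  have H := D0_sub (ts := [:: (fun e => e b); (fun e => e N); (fun e => e s); (fun e => e c);
    (fun e => e a); (fun e => e d)]) HP.
  by apply: H; d0_in.
have Hs := sub _ D0_size_step; have Hc := sub _ D0_ctx_step.
have Hr := sub (fun b _ a c => rule_step b a c) D0_rule_step.
have Hstep b N s c t :
    D0 (fun e => trs_step (e b) (fun z => z <= e N /\ code_mem (e s) (e c) z) (e t)).
  have or3 P Q P' : D0 P -> D0 Q -> D0 P' -> D0 (fun e => [\/ P e, Q e | P' e]).
    move=> HP HQ HP'; apply: D0_ext (D0_or HP (D0_or HQ HP')) => e.
    by split=> [[h|[h|h]]|[h|h|h]]; [constructor 1|constructor 2|constructor 3|left|right; left|right; right].
  rewrite /trs_step /derivation_step.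
  by repeat (first [apply Hs | apply Hc | apply Hr | apply or3 | d0_step]; cbv beta).
have Ht : D0 (fun e => table (trs_step (e 0)) (e 0) (e 1)).
  by apply: (@D0_table (fun _ b => trs_step b) (fun e => e 0) (fun e => e 1)); [d0|d0|apply: Hstep].
have Ht' b t : tm b -> tm t -> D0 (fun e => table (trs_step (b e)) (b e) (t e)).
  move=> Hb Ht'; have H := D0_sub (ts := [:: b; t]) Ht; by apply: H; d0_in.
rewrite /derivation_graph.
by repeat (first [apply Ht' | d0_step]; cbv beta).
Qed.

End Derivations.

(** ** The derivation complexity function *)

Section DerivationComplexity.

Variables (k m : nat) (F : vocabulary) (HF : of_type k m F) (R : rules F).
Hypotheses (R_trs : is_trs R) (R_lpo : reduces_lpo R).

Let Kb := \max_(lr <- R) term_size lr.2.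

Let rhs_size l r : List.In (l, r) R -> lpo r l /\ term_size r <= Kb.
Proof.
move=> H; split; first exact: R_lpo.
rewrite /Kb; elim: (R) H => //= lr s IH [->|/IH le]; rewrite big_cons leq_max ?leqnn // le orbT //.
Qed.

Let cap w := pr #|F| (vcode (nseq k.+2 w)).

Let cap_dominated : exists q, forall w, cap w <= iter q (jump 0) succn w.+1.
Proof.
apply: dominated_pr; first exact: nice_succ.
  exact/dominated_const/nice_succ.
elim: k.+2 => [|n IH]; first exact/dominated_const/nice_succ.
apply: dominated_pr => //; [exact: nice_succ|exact/dominated_id/nice_succ].
Qed.

(** The values of the previous part exceed the codes, because the constant [C]
    is chosen to bound the growth of codes. *)
Lemma lpo_measure : exists (mu : term F -> nat) q N, let G := Fmq k m q in
  [/\ forall s t, rewrites R s t -> mu t < mu s, forall t, code t <= mu t &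
      forall t, closed_term t -> mu t <= iter (2 * term_size t) G N].
Proof.
have [q Hq] := cap_dominated; pose C := maxn 4 q; have C_ge : 4 <= C by apply: leq_maxl.
exists (term_value k Kb C (pr 0)), (C * (#|F|).+2), (iters F Kb C); split.
- by move=> s t /(rewrites_value HF C_ge rhs_size).
- elim/term_nested_ind => [x|g ts IH] //; rewrite [term_value _ _ _ _ _]/=.
  set x := [ffun i => _]; pose w := \max_i x i.
  have Hx i : x i <= w by apply: leq_bigmax.
  have Hw : (exists i, x i = w) \/ w = 0.
    have [[i _]|none] := classic (exists i : 'I_(ar g), True).
      have ar_gt0 : 0 < #|'I_(ar g)| by apply/card_gt0P; exists i.
      by have [j Hj] := @eq_bigmax _ x ar_gt0; left; exists j.
    by right; rewrite /w big1 // => i; case: none; exists i.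
  apply: leq_trans (value_base HF Kb C_ge Hx Hw).
  apply: (@leq_trans (cap w)).
    rewrite /code [pcode _ _]/= /app_code; apply: pr_mono; first exact: ltn_ord.
    apply: leq_trans (vcode_nseq_leq w (ar_type HF g)).
    have := @vcode_mono w [seq pcode (pr 0) (ts i) | i <- enum 'I_(ar g)].
    rewrite size_map size_enum_ord; apply; apply/allP => y /mapP [i _ ->].
    by apply: leq_trans (IH i) _; have := Hx i; rewrite /x ffunE.
  apply: leq_trans (Hq w) _; apply: (@leq_trans (iter C (jump 0) succn w.+1)).
    by apply: iter_jump_leq; rewrite ?leq_maxr //; apply: nice_succ.
  apply: (nice_iter_jump _ _ nice_succ).2; rewrite /iters; lia.
- by move=> t; apply: (term_value_top HF Kb C_ge).
Qed.

Lemma dh_exists : exists d, is_dh R d.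
Proof.
have [mu [q [N0 [mu_step _ mu_top]]]] := lpo_measure.
have nG := nice_Fmq k m q.
have bound n N : derivation R n N -> N <= iter (2 * n) (Fmq k m q) N0.
  move=> [u [Hc le_s Hu]]; apply: leq_trans (starts_le mu_step (_ : starts R (u 0) N)) _.
    by exists u.
  apply: leq_trans (mu_top _ Hc) _; apply: iter_leq => //; by rewrite leq_mul2l.
have H n : exists y, (derivation R n y /\ forall N, derivation R n N -> N <= y) \/
    ((forall N, ~ derivation R n N) /\ y = 0).
  have [[N1 HN1]|none] := classic (exists N, derivation R n N); last first.
    by exists 0; right; split=> // N HN; apply: none; exists N.
  pose p N : bool := if excluded_middle_informative (derivation R n N) is left _ then true else false.
  have pP N : p N <-> derivation R n N by rewrite /p; case: excluded_middle_informative.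
  have exp : exists N, p N by exists N1; apply/pP.
  have maxp N : p N -> N <= iter (2 * n) (Fmq k m q) N0 by move/pP; apply: bound.
  case: (ex_maxnP exp maxp) => y /pP Hy Hmax; exists y; left; split=> // N /pP; apply: Hmax.
have [d Hd] := choice _ H; exists d => n; exact: Hd.
Qed.

(** All terms of a derivation have codes below the value of its first term, so
    the derivations from terms of size [n] are described by bounded tables. *)
Theorem elementary_dh d : is_dh R d ->
  exists q, elementary_in (Fmq k m q) (fun v : 1.-tuple nat => d (thead v)).
Proof.
move=> Hd; have [mu [q [N0 [mu_step mu_code mu_top]]]] := lpo_measure.
set G := Fmq k m q in mu_top; have nG : nice G := nice_Fmq k m q.
pose M n := iter (2 * n + N0) G (2 * n + N0).
have DM : dominated G M.
  apply: dominated_iterate => //; first exact: dominated_self.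
  apply: dominated_add => //; last exact: dominated_const.
  by apply: dominated_mul => //; [apply: dominated_const|apply: dominated_id].
have [q' Hq'] : dominated G (fun n => room (trs_cap (M n))).
  apply: dominated_room => //; do ! apply: dominated_pr => //; exact: dominated_const.
exists (q' + q); have EG : Fmq k m (q' + q) = iter q' (jump 0) G by rewrite /G /Fmq iterD.
have mu_le n t : closed_term t -> term_size t <= n -> mu t <= M n.
  move=> Hc le_s; apply: leq_trans (mu_top t Hc) _; rewrite /M.
  apply: leq_trans (iter_leq _ nG (_ : 2 * term_size t <= 2 * n + N0)) _; first by lia.
  by apply: iter_homo => //; apply: leq_addl.
have le_M n : n <= M n.
  by rewrite /M; apply: leq_trans (iter_ge _ _ nG); lia.
have HD n N b : iter q' (jump 0) G n.+1 <= b -> derivation_graph R n N b <-> derivation R n N.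
  move=> le_b; refine (derivation_graphP R_trs N mu_step mu_code (mu_le n) (le_M n) _).
  exact: roomy_leq (leqnn _) (leq_trans (Hq' n) le_b) (roomy_room _).
have le_d n N : derivation R n N -> N <= M n.
  move=> [u [Hc le_s Hu]]; apply: leq_trans (starts_le mu_step (_ : starts R (u 0) N)) _.
    by exists u.
  exact: mu_le.
pose P (e : nat -> nat) :=
  (derivation_graph R (e 2) (e 0) (e 1) /\ ~ derivation_graph R (e 2) (e 0).+1 (e 1)) \/
  (~ derivation_graph R (e 2) 0 (e 1) /\ e 0 = 0).
have HP : D0 P.
  have H b N : tm b -> tm N -> D0 (fun e => derivation_graph R (e 2) (N e) (b e)).
    move=> Hb HN; have H := D0_sub (ts := [:: (fun e => e 2); N; b]) (D0_derivation_graph R).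
    by apply: H; d0_in.
  by repeat (first [apply H | d0_step]; cbv beta).
apply: (elementary_of_graph (bd := fun s => Fmq k m (q' + q) (nth 0 s 0).+1) HP).
- exact/elemf_oracle/elemf_succ/elemf_nth.
- move=> v; case/tupleP: v => n u; rewrite theadE /= EG.
  have le1 : M n <= iter q' (jump 0) G n.+1.
    apply: leq_trans (Hq' n); apply: leq_trans (pr_gel _ (M n)) _.
    apply: leq_trans (pr_ger 2 _) _; rewrite -/(trs_cap (M n)).
    by case: (roomy_room (trs_cap (M n))) => ? _ [? _ []].
  by apply: leq_trans le1; case: (Hd n) => [[/le_d]|[_ ->]].
move=> v y; case/tupleP: v => n u; rewrite theadE /P /= EG.
have le n' := HD n n' _ (leqnn _).
split.
  case=> [[/le Hy /le Hy1]|[/le H0 ->]].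
    case: (Hd n) => [[Hdn Hmax]|[none _]]; last by case: (none y).
    have := Hmax _ Hy; rewrite leq_eqVlt => /orP[/eqP //|lt]; case: Hy1.
    case: Hdn => t [Hc Hs Ht]; exists t; split=> // i lt_i; apply: Ht; exact: leq_trans lt_i lt.
  case: (Hd n) => [[[t [Hc Hs Ht]] _]|[_ ->]] //; case: H0.
  by exists t.
move=> ->; case: (Hd n) => [[Hdn Hmax]|[none ->]]; [left|right]; split=> //.
- exact/le.
- by move/le => /Hmax; rewrite ltnn.
- by move/le; apply: none.
Qed.

End DerivationComplexity.

(** * Term rewriting systems computing the fast growing functions *)

Lemma lpo_occurs (F : vocabulary) (s t : term F) : lpo s t -> forall x, occurs x s -> occurs x t.
Proof.
elim=> {s t} [g ts i x H|g ts s i _ IH x H|h g ss ts _ _ IH x [i]|g ss ts i _ IH _ _ _ x [j]].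
- by exists i.
- by exists i; apply: IH.
- exact: IH.
- exact: IH.
Qed.

Lemma reduces_lpo_trs (F : vocabulary) (R : rules F) : reduces_lpo R -> is_trs R.
Proof.
move=> HR l r /HR H; split; last exact: lpo_occurs H.
by move=> x El; move: H; rewrite El => H; inversion H.
Qed.

Inductive reduces (F : vocabulary) (R : rules F) : term F -> term F -> Prop :=
| reduces_refl t : reduces R t t
| reduces_step s t u : rewrites R s t -> reduces R t u -> reduces R s u.

Lemma reduces_trans (F : vocabulary) (R : rules F) s t u :
  reduces R s t -> reduces R t u -> reduces R s u.
Proof. by elim=> {s t} // s t v Hs _ IH /IH; apply: reduces_step. Qed.

Lemma reduces_starts (F : vocabulary) (R : rules F) s t N :
  reduces R s t -> starts R t N -> exists2 N', N <= N' & starts R s N'.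
Proof.
elim=> {s t} [t|s t u Hs _ IH] H; first by exists N.
by have [N' le H'] := IH H; exists N'.+1; [apply: leqW|apply/startsS; exists t].
Qed.

Section Every.

Variables (T : Type) (P : T -> Prop).

Definition every (s : seq T) : Prop := foldr (fun x Q => P x /\ Q) True s.

Lemma every_cat s t : every (s ++ t) <-> every s /\ every t.
Proof. by elim: s => /= [|x s ->]; intuition. Qed.

Lemma every_rcons s x : every (rcons s x) <-> every s /\ P x.
Proof. by rewrite -cats1 every_cat /=; intuition. Qed.

Lemma every_nth x0 s i : every s -> i < size s -> P (nth x0 s i).
Proof. by elim: s i => //= x s IH [|i] [Hx Hs] //= lt; apply: IH. Qed.

Lemma every_nseq n x : P x -> every (nseq n x).
Proof. by move=> Hx; elim: n => //= n IH; split. Qed.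

End Every.

Section TRS.

Variables (k m q : nat) (m_gt0 : 0 < m).

(** Symbol 0 is zero, symbol 1 the successor; symbols [2j+2], [j < m], of arity
    [k+2] compute [vjump a H z] from a vector [a] and an argument [z], for the
    function [H] of symbol [2j+1]; all other symbols are unary. *)
Definition last_sym : nat := (2 * m + q).+1.

Definition arity (n : nat) : nat :=
  if n == 0 then 0 else if (n <= 2 * m) && ~~ odd n then k.+2 else 1.

Lemma arity_main j : j < m -> arity (2 * j).+2 = k.+2.
Proof. by move=> lt; rewrite /arity /= negbK oddM /= (_ : _ < _); last lia. Qed.

Lemma arity_odd j : arity (2 * j).+1 = 1.
Proof. by rewrite /arity /= oddM /= andbF. Qed.

Lemma arity_high n : 2 * m < n -> arity n = 1.
Proof. by move=> lt; rewrite /arity; case: eqP => [E|_]; [lia|rewrite leqNgt lt]. Qed.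

Lemma arity_gt1 n : 1 < arity n -> exists2 j, j < m & n = (2 * j).+2.
Proof.
rewrite /arity; case: eqP => // ne; case: ifP => // /andP[le ev] _.
have E := odd_double_half n; rewrite (negbTE ev) -muln2 in E.
by exists n./2.-1; lia.
Qed.

Definition sym := 'I_last_sym.+1.
Definition sym_ar (g : sym) : nat := arity g.
Definition sym_prec : rel sym := fun h g => h < g.

Lemma sym_prec_irr : irreflexive sym_prec. Proof. by move=> g; apply: ltnn. Qed.
Lemma sym_prec_trans : transitive sym_prec.
Proof. by move=> h g i; apply: ltn_trans. Qed.

Lemma sym_ar_gt1 : exists g, 1 < sym_ar g.
Proof.
have lt : 2 < last_sym.+1 by rewrite /last_sym; lia.
by exists (Ordinal lt); rewrite /sym_ar /= (arity_main m_gt0).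
Qed.

Definition voc : vocabulary := Vocabulary sym_prec_irr sym_prec_trans sym_ar_gt1.

Lemma rk2_voc j (g : voc) : j < m -> nat_of_ord g = (2 * j).+2 -> rk2 g = j.
Proof.
elim/ltn_ind: j g => j IH g lt_j Eg; rewrite rk2E; apply/eqP; rewrite eqn_leq; apply/andP; split.
  apply/bigmax_leqP => h /andP[lt_h /arity_gt1 [i lt_i Eh]].
  have lt_hg : h < g := lt_h.
  by rewrite (IH i _ h) //; lia.
case: j IH lt_j Eg => // j IH lt_j Eg.
have lt : (2 * j).+2 < last_sym.+1 by rewrite /last_sym; lia.
pose h : voc := Ordinal lt.
rewrite -{1}(IH j (ltnSn j) h (ltnW lt_j) erefl).
apply: (@leq_bigmax_cond _ (fun h : voc => prec h g && (1 < ar h)) (fun h => (rk2 h).+1) h).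
apply/andP; split; last by rewrite -[ar h]/(arity (2 * j).+2) arity_main //; apply: ltnW.
by rewrite -[prec h g]/((2 * j).+2 < g) Eg; lia.
Qed.

Lemma voc_type : of_type k m voc.
Proof.
have lt j : j < m -> (2 * j).+2 < last_sym.+1 by rewrite /last_sym; lia.
split; apply/eqP; rewrite eqn_leq; apply/andP; split.
- apply/bigmax_leqP => g _; rewrite -[ar g]/(arity g) /arity.
  by case: (_ == 0) => //; case: (_ && _).
- rewrite -[2 + k]/k.+2 -(arity_main m_gt0).
  exact: (@leq_bigmax_cond _ predT (fun g : voc => ar g) (Ordinal (lt 0 m_gt0))).
- apply/bigmax_leqP => g /arity_gt1 [j lt_j Eg]; by rewrite (rk2_voc lt_j Eg).
- have lt1 : m.-1 < m by rewrite prednK.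
  pose g : voc := Ordinal (lt _ lt1).
  rewrite -{1}(prednK m_gt0) -(@rk2_voc m.-1 g lt1 erefl).
  apply: (@leq_bigmax_cond _ (fun g : voc => 1 < ar g) (fun g => (rk2 g).+1) g).
  by rewrite -[ar g]/(arity (2 * m.-1).+2) arity_main.
Qed.

Definition mk (n : nat) (ts : seq (term voc)) : term voc :=
  @App voc (inord n : sym) [ffun i : 'I_(@ar voc (inord n : sym)) => nth (Var 0) ts i].

Lemma ar_inord n : n <= last_sym -> @ar voc (inord n : sym) = arity n.
Proof. by move=> le; rewrite -[ar _]/(arity (inord n : sym)) inordK. Qed.

Lemma subst_mk s n ts : n <= last_sym -> size ts = arity n ->
  term_subst s (mk n ts) = mk n (map (term_subst s) ts).
Proof.
move=> le sz; rewrite /mk /=; congr App; apply/ffunP => i; rewrite !ffunE.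
by rewrite (nth_map (Var 0)) // sz -ar_inord.
Qed.

Lemma lpo_arg_nth n ts i : n <= last_sym -> i < arity n -> lpo (nth (Var 0) ts i) (mk n ts).
Proof.
move=> le lt; rewrite -ar_inord // in lt.
by have := lpo_arg [ffun i : 'I_(@ar voc (inord n : sym)) => nth (Var 0) ts i] (Ordinal lt); rewrite ffunE.
Qed.

Lemma lpo_sub_nth n ts i s : n <= last_sym -> i < arity n -> lpo s (nth (Var 0) ts i) ->
  lpo s (mk n ts).
Proof.
move=> le lt H; rewrite -ar_inord // in lt.
apply: (@lpo_sub _ _ [ffun i : 'I_(@ar voc (inord n : sym)) => nth (Var 0) ts i] _ (Ordinal lt)).
by rewrite ffunE.
Qed.

Lemma lpo_args n ts : n <= last_sym -> size ts = arity n -> every ((@lpo voc)^~ (mk n ts)) ts.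
Proof.
move=> le sz; suff H i : i <= size ts -> every ((@lpo voc)^~ (mk n ts)) (drop i ts).
  by rewrite -[ts in every _ ts]drop0; apply: H.
move=> le_i; rewrite -(subKn le_i); elim: (size ts - i) (leq_subr i (size ts)) => [|r IH] le_r.
  by rewrite subn0 drop_size.
have lt : size ts - r.+1 < size ts by lia.
rewrite (drop_nth (Var 0) lt) /= -subSn //= subSS; split; last by apply: IH; lia.
by apply: lpo_arg_nth; rewrite // -sz.
Qed.

Lemma lpo_mk_prec n' n ss ts : n' < n -> n <= last_sym -> size ss = arity n' ->
  every ((@lpo voc)^~ (mk n ts)) ss -> lpo (mk n' ss) (mk n ts).
Proof.
move=> lt le sz H; have le' : n' <= last_sym by apply: leq_trans le; apply: ltnW.
apply: lpo_prec => [|j].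
  by rewrite -[prec _ _]/((inord n' : sym) < (inord n : sym)) !inordK // ltnS.
by rewrite ffunE; apply: every_nth H _; rewrite sz -ar_inord.
Qed.

Lemma lpo_mk_lex n l a b r r' : n <= last_sym -> size (l ++ a :: r) = arity n ->
  every ((@lpo voc)^~ (mk n (l ++ b :: r'))) (l ++ a :: r) -> lpo a b ->
  lpo (mk n (l ++ a :: r)) (mk n (l ++ b :: r')).
Proof.
move=> le sz H Hab; have lt : size l < @ar voc (inord n : sym).
  by rewrite ar_inord // -sz size_cat /=; lia.
apply: (@lpo_lex _ _ _ _ (Ordinal lt)) => [j|j lt_j|].
- by rewrite ffunE; apply: every_nth H _; rewrite sz -ar_inord.
- by rewrite !ffunE !nth_cat (_ : (j < size l)).
- by rewrite !ffunE !nth_cat /= ltnn subnn.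
Qed.

Definition zero := mk 0 [::].
Definition succ t := mk 1 [:: t].
Definition numeral n := iter n succ zero.
Definition pattern_vars p : seq (term voc) := map Var (iota 0 p).

Notation main j := ((2 * j).+2).
Notation unary j := ((2 * j).+1).

(** Rules for symbol [2j+2], which follow the recursion of [vjump] on the vector
    of the arguments before the last one, and the rule by which symbol [2j+3]
    starts it at the limit omega^(1+k). *)
Definition main_rules (j : nat) : rules voc :=
  [:: (mk (main j) (rcons (nseq k.+1 zero) (Var 0)), mk (unary j) [:: Var 0]);
      (mk (main j) (pattern_vars k ++ [:: succ (Var k); zero]),
       mk (main j) (pattern_vars k ++ [:: Var k; succ zero]));
      (mk (main j) (pattern_vars k ++ [:: succ (Var k); succ (Var k.+1)]),
       mk (main j) (pattern_vars k ++ [:: Var k;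
         mk (main j) (pattern_vars k ++ [:: Var k;
           mk (main j) (pattern_vars k ++ [:: succ (Var k); Var k.+1])])]));
      (mk (unary j.+1) [:: Var 0],
       mk (main j) (succ (Var 0) :: rcons (nseq k zero) (Var 0)))].

(** A positive entry followed by zeros decreases in favour of the next one. *)
Definition limit_rule (j i : nat) : term voc * term voc :=
  (mk (main j) (pattern_vars i ++ succ (Var i) :: rcons (nseq (k - i) zero) (Var i.+1)),
   mk (main j) (pattern_vars i ++ Var i :: succ (Var i.+1) :: rcons (nseq (k - i).-1 zero) (Var i.+1))).

(** Unary symbols beyond [2m+1] add 1 to the ordinal. *)
Definition succ_rules (n : nat) : rules voc :=
  [:: (mk n.+1 [:: zero], mk n [:: succ zero]);
      (mk n.+1 [:: succ (Var 0)], mk n [:: mk n [:: mk n.+1 [:: Var 0]]])].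

(** The first rule makes numerals shrink: it lets computed values be replaced by
    smaller ones, and turns a large value into a long derivation. *)
Definition trs : rules voc :=
  [:: (succ (Var 0), Var 0)] ++
  flatten [seq main_rules j ++ [seq limit_rule j i | i <- iota 0 k] | j <- iota 0 m] ++
  flatten [seq succ_rules (2 * m + i).+1 | i <- iota 0 q].

Lemma In_cat (T : Type) (x : T) s t : List.In x (s ++ t) <-> List.In x s \/ List.In x t.
Proof. by elim: s => /= [|y s ->]; intuition. Qed.

Lemma In_mapP (T : Type) (U : eqType) (x : T) (f : U -> T) s :
  List.In x (map f s) <-> exists2 y, y \in s & x = f y.
Proof.
elim: s => /= [|y s ->]; first by split=> // -[].
split=> [[<-|[z Hz ->]]|[z]]; first by exists y; rewrite ?mem_head.
  by exists z; rewrite // inE Hz orbT.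
by rewrite inE => /predU1P [->|Hz] ->; [left|right; exists z].
Qed.

Lemma In_flatten_map (T : Type) (U : eqType) (x : T) (f : U -> seq T) s :
  List.In x (flatten (map f s)) <-> exists2 y, y \in s & List.In x (f y).
Proof.
elim: s => /= [|y s IH]; first by split=> // -[].
rewrite In_cat IH; split=> [[H|[z Hz H]]|[z]].
- by exists y; rewrite ?mem_head.
- by exists z; rewrite // inE Hz orbT.
by rewrite inE => /predU1P [->|Hz] H; [left|right; exists z].
Qed.

Lemma trsP lr : List.In lr trs <->
  [\/ lr = (succ (Var 0), Var 0),
      exists2 j, j < m & List.In lr (main_rules j),
      exists2 j, j < m & exists2 i, i < k & lr = limit_rule j i
    | exists2 i, i < q & List.In lr (succ_rules (2 * m + i).+1)].
Proof.
rewrite /trs !In_cat !In_flatten_map.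
split=> [[[<-|//]|[[j]|[i]]]|[->|[j lt_j H]|[j lt_j [i lt_i ->]]|[i lt_i H]]].
- by constructor 1.
- rewrite mem_iota => lt_j /In_cat [H|/In_mapP [i]]; first by constructor 2; exists j.
  by rewrite mem_iota => lt_i ->; constructor 3; exists j => //; exists i.
- by rewrite mem_iota => lt_i H; constructor 4; exists i.
- by left; left.
- by right; left; exists j; rewrite ?mem_iota //; apply/In_cat; left.
- right; left; exists j; rewrite ?mem_iota //; apply/In_cat; right; apply/In_mapP.
  by exists i; rewrite ?mem_iota.
- by right; right; exists i; rewrite ?mem_iota.
Qed.

Lemma le_main j : j < m -> main j <= last_sym.
Proof. by rewrite /last_sym; lia. Qed.

Lemma le_unary j : j <= m -> unary j <= last_sym.
Proof. by rewrite /last_sym; lia. Qed.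

Lemma lpo_succ t : lpo t (succ t).
Proof. by apply: (@lpo_arg_nth 1 [:: t] 0); rewrite // /arity /= andbF. Qed.

Lemma lpo_zero n ts : 0 < n -> n <= last_sym -> lpo zero (mk n ts).
Proof. by move=> n0 le; apply: lpo_mk_prec. Qed.

Lemma lpo_succ_mk n t ts : 1 < n -> n <= last_sym -> lpo t (mk n ts) -> lpo (succ t) (mk n ts).
Proof. by move=> n1 le H; apply: lpo_mk_prec => //; rewrite /arity /= andbF. Qed.

Lemma trs_lpo : reduces_lpo trs.
Proof.
move=> l r /trsP [[-> ->]|[j lt_j]|[j lt_j [i lt_i [-> ->]]]|[i lt_i]].
- exact: lpo_succ.
- have leM := le_main lt_j; have leU := le_unary (ltnW lt_j); have leU' : unary j.+1 <= last_sym.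
    exact: le_unary.
  have sz u v : size (pattern_vars k ++ [:: u; v]) = arity (main j).
    by rewrite arity_main // size_cat size_map size_iota /=; lia.
  case=> [[<- <-]|[[<- <-]|[[<- <-]|[[<- <-]|//]]]].
  + apply: lpo_mk_prec => //; first by rewrite arity_odd.
    split=> //; have := @lpo_args (main j) (rcons (nseq k.+1 zero) (Var 0)) leM.
    rewrite size_rcons size_nseq arity_main // => /(_ erefl).
    by case/every_rcons.
  + apply: lpo_mk_lex; [exact: leM|exact: sz| |exact: lpo_succ].
    have /every_cat [H1 [H2 [H3 _]]] := lpo_args leM (sz (succ (Var k)) zero).
    apply/every_cat; split=> //; split; last by split=> //; apply: lpo_succ_mk.
    apply: (lpo_sub_nth (i := k)) => //; first by rewrite arity_main.
    by rewrite nth_cat size_map size_iota ltnn subnn /=; apply: lpo_succ.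
  + have /every_cat [H1 [H2 [H3 _]]] := lpo_args leM (sz (succ (Var k)) (succ (Var k.+1))).
    have Hk : lpo (Var k) (mk (main j) (pattern_vars k ++ [:: succ (Var k); succ (Var k.+1)])).
      apply: (lpo_sub_nth (i := k)) => //; first by rewrite arity_main.
      by rewrite nth_cat size_map size_iota ltnn subnn /=; apply: lpo_succ.
    have Hk1 : lpo (Var k.+1) (mk (main j) (pattern_vars k ++ [:: succ (Var k); succ (Var k.+1)])).
      apply: (lpo_sub_nth (i := k.+1)) => //; first by rewrite arity_main.
      by rewrite nth_cat size_map size_iota ltnNge leqnSn /= subSnn /=; apply: lpo_succ.
    have step u : lpo u (mk (main j) (pattern_vars k ++ [:: succ (Var k); succ (Var k.+1)])) ->
        lpo (mk (main j) (pattern_vars k ++ [:: Var k; u]))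
            (mk (main j) (pattern_vars k ++ [:: succ (Var k); succ (Var k.+1)])).
      move=> Hu; apply: lpo_mk_lex; [exact: leM|exact: sz| |exact: lpo_succ].
      by apply/every_cat; split.
    apply: (step _ (step _ _)).
    have := @lpo_mk_lex (main j) (pattern_vars k ++ [:: succ (Var k)]) (Var k.+1) (succ (Var k.+1)) [::] [::].
    rewrite -!catA /=; apply; [exact: leM|exact: sz| |exact: lpo_succ].
    by apply/every_cat; split.
  + have sz' : size [:: Var 0 : term voc] = arity (unary j.+1) by rewrite arity_odd.
    have [H _] := lpo_args leU' sz'.
    apply: lpo_mk_prec; [lia|by []|by rewrite /= size_rcons size_nseq arity_main| ].
    split; first by apply: lpo_succ_mk.
    apply/every_rcons; split=> //.
    by apply/every_nseq/lpo_zero.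
- have leM := le_main lt_j.
  have sz u r0 : size r0 = (k - i).+1 -> size (pattern_vars i ++ u :: r0) = arity (main j).
    by move=> sr; rewrite arity_main // size_cat size_map size_iota /= sr; lia.
  have sr : size (rcons (nseq (k - i) zero) (Var i.+1)) = (k - i).+1 by rewrite size_rcons size_nseq.
  have /every_cat [H1 [H2 /every_rcons [H3 H4]]] := lpo_args leM (sz (succ (Var i)) _ sr).
  apply: lpo_mk_lex; [exact: leM| | |exact: lpo_succ].
    by apply: sz; rewrite /= size_rcons size_nseq; lia.
  apply/every_cat; split=> //; split.
    apply: (lpo_sub_nth (i := i)) => //; first by rewrite arity_main //; lia.
    by rewrite nth_cat size_map size_iota ltnn subnn /=; apply: lpo_succ.
  split; first exact: lpo_succ_mk.
  apply/every_rcons; split=> //.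
  by apply/every_nseq/lpo_zero.
- set n := (2 * m + i).+1; have le : n.+1 <= last_sym by rewrite /n /last_sym; lia.
  have A1 : arity n = 1 by apply: arity_high; rewrite /n; lia.
  have A2 : arity n.+1 = 1 by apply: arity_high; rewrite /n; lia.
  have n1 : 1 < n.+1 by rewrite /n.
  case=> [[<- <-]|[[<- <-]|//]].
  + by apply: lpo_mk_prec => //; split=> //; apply: lpo_succ_mk => //; apply: lpo_zero.
  + have Hu : lpo (mk n.+1 [:: Var 0]) (mk n.+1 [:: succ (Var 0)]).
      apply: (@lpo_mk_lex n.+1 [::] (Var 0) (succ (Var 0)) [::] [::]) => //; last exact: lpo_succ.
      split=> //; apply: (@lpo_sub_nth _ _ 0) => //; first by rewrite A2.
      exact: lpo_succ.
    by do 2 (apply: lpo_mk_prec => //; split=> //).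
Qed.


(** ** Evaluation *)

Notation "s ->> t" := (reduces trs s t) (at level 70).

Lemma reduces_mk n l r s t : n <= last_sym -> size (l ++ s :: r) = arity n -> s ->> t ->
  mk n (l ++ s :: r) ->> mk n (l ++ t :: r).
Proof.
move=> le sz H; elim: H sz => {s t} [t|s t u Hs _ IH] sz; first exact: reduces_refl.
apply: reduces_step (IH _); last by move: sz; rewrite !size_cat.
have lt : size l < @ar voc (inord n : sym) by rewrite ar_inord // -sz size_cat /=; lia.
apply: (@rewrites_ctx _ _ _ _ _ (Ordinal lt)).
  by rewrite !ffunE !nth_cat /= ltnn subnn.
move=> j ne; have {}ne : j != size l :> nat by apply: contraNneq ne => E; apply/eqP/val_inj.
rewrite !ffunE !nth_cat; case: ltnP => // le_j.
by case E : (j - size l) => [|d] //=; case/eqP: ne; lia.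
Qed.

Lemma reduces_mk1 n s t : n <= last_sym -> arity n = 1 -> s ->> t -> mk n [:: s] ->> mk n [:: t].
Proof. by move=> le E; apply: (@reduces_mk n [::] [::]); rewrite ?E. Qed.

Lemma arity1 : arity 1 = 1. Proof. by rewrite /arity /= andbF. Qed.

Lemma reduces_numeral a b : b <= a -> numeral a ->> numeral b.
Proof.
move=> /subnK <-; elim: (a - b) => [|d IH]; first exact: reduces_refl.
rewrite addSn; apply: reduces_step IH.
have := @rewrites_rule _ trs (succ (Var 0)) (Var 0) (fun=> numeral (d + b)) (or_introl erefl).
by rewrite subst_mk // arity1.
Qed.

Lemma starts_numeral a : starts trs (numeral a) a.
Proof.
exists (fun i => numeral (a - i)); split=> [|i lt_i]; first by rewrite subn0.
have -> : a - i = (a - i.+1).+1 by lia.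
have := @rewrites_rule _ trs (succ (Var 0)) (Var 0) (fun=> numeral (a - i.+1)) (or_introl erefl).
by rewrite subst_mk // arity1.
Qed.

(** Iterating [z + 1] times at [z] uses the argument twice, as a counter and as
    a start. The rules A 0 -> B 1 and A (z+1) -> B (B (A z)) need it only once:
    they iterate [h] more often, [2z + 1] times at 1, and a numeral that is too
    large can be reduced afterwards. *)
Lemma eval_jump0 (A B : term voc -> term voc) h : nice h ->
  (forall s t, s ->> t -> B s ->> B t) -> (forall z, B (numeral z) ->> numeral (h z)) ->
  A zero ->> B (succ zero) -> (forall z, A (succ (numeral z)) ->> B (B (A (numeral z)))) ->
  forall z, A (numeral z) ->> numeral (jump 0 h z).
Proof.
move=> nh HB Bh A0 AS z; apply: (@reduces_trans _ _ _ (numeral (iter (2 * z).+1 h 1))).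
  elim: z => [|z IH]; first exact: reduces_trans A0 (Bh 1).
  apply: reduces_trans (AS z) _.
  apply: reduces_trans (HB _ _ (HB _ _ IH)) _.
  apply: reduces_trans (HB _ _ (Bh _)) _; rewrite mulnS; exact: Bh.
apply: reduces_numeral; rewrite -[jump 0 h z]/(iter z.+1 h z).
rewrite (_ : (2 * z).+1 = z.+1 + z); last by lia.
rewrite iterD; apply: iter_homo => //; apply: leq_trans (iter_ge_add z 1 nh); lia.
Qed.

Lemma subst_pattern_vars l p : p <= size l -> map (term_subst (nth zero l)) (pattern_vars p) = take p l.
Proof.
move=> le; apply: (@eq_from_nth _ zero); rewrite !size_map size_iota ?size_takel // => i lt.
by rewrite -map_comp (nth_map 0) ?size_iota //= nth_iota // add0n nth_take.
Qed.

Lemma reduces_rule l r s : List.In (l, r) trs -> term_subst s l ->> term_subst s r.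
Proof. by move=> H; apply: reduces_step (reduces_refl _ _); apply: rewrites_rule. Qed.

Lemma subst_zero s : term_subst s zero = zero.
Proof. by rewrite /zero subst_mk. Qed.

Lemma subst_succ s t : term_subst s (succ t) = succ (term_subst s t).
Proof. by rewrite /succ subst_mk // arity1. Qed.

Lemma subst_Var (s : nat -> term voc) x : term_subst s (Var x) = s x.
Proof. by []. Qed.

Let substE := (subst_succ, subst_zero, subst_Var).

Definition numerals : seq nat -> seq (term voc) := map numeral.

Section Main.

Variables (j : nat) (lt_j : j < m) (H : nat -> nat) (nH : nice H).
Hypothesis HU : forall z, mk (unary j) [:: numeral z] ->> numeral (H z).

Let leM : main j <= last_sym := le_main lt_j.

Let Main (a : seq (term voc)) (t : term voc) : term voc := mk (main j) (rcons a t).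

Lemma eval_base z : Main (nseq k.+1 zero) (numeral z) ->> numeral (H z).
Proof.
have leU := le_unary (ltnW lt_j).
have HR : List.In (mk (main j) (rcons (nseq k.+1 zero) (Var 0)), mk (unary j) [:: Var 0]) trs.
  by apply/trsP; constructor 2; exists j => //; left.
have := reduces_rule (fun=> numeral z) HR.
rewrite !subst_mk ?arity_odd ?arity_main ?size_rcons ?size_nseq // map_rcons map_nseq subst_zero.
by move=> H1; apply: reduces_trans H1 (HU z).
Qed.

Lemma eval_last b x : size b = k ->
  (forall z, Main (rcons (numerals b) (numeral x)) (numeral z) ->> numeral (vjump (rcons b x) H z)) ->
  forall z, Main (rcons (numerals b) (numeral x.+1)) (numeral z) ->> numeral (vjump (rcons b x.+1) H z).
Proof.
move=> sb Hx; have -> : vjump (rcons b x.+1) H = jump 0 (vjump (rcons b x) H).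
  by rewrite vjump_rcons iterS -vjump_rcons.
have sn : size (numerals b) = k by rewrite size_map.
have sz u v : size (numerals b ++ [:: u; v]) = arity (main j).
  by rewrite size_cat sn arity_main //= addn2.
have szv u v : size (pattern_vars k ++ [:: u; v]) = arity (main j).
  by rewrite size_cat size_map size_iota arity_main //= addn2.
have E u v : Main (rcons (numerals b) u) v = mk (main j) (numerals b ++ [:: u; v]).
  by rewrite /Main -!cats1 -catA.
pose B t := Main (rcons (numerals b) (numeral x)) t.
have HB s t : s ->> t -> B s ->> B t.
  rewrite /B /Main -!cats1; apply: reduces_mk => //.
  by rewrite !size_cat sn arity_main //= !addn1.
apply: (@eval_jump0 (Main (rcons (numerals b) (numeral x.+1))) B) => //; first exact: nice_vjump.
- have HR : List.In (mk (main j) (pattern_vars k ++ [:: succ (Var k); zero]),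
       mk (main j) (pattern_vars k ++ [:: Var k; succ zero])) trs.
    by apply/trsP; constructor 2; exists j => //; right; left.
  have := reduces_rule (nth zero (rcons (numerals b) (numeral x))) HR.
  rewrite !subst_mk // !map_cat !map_cons !substE subst_pattern_vars ?size_rcons ?sn //.
  rewrite -cats1 take_cat sn ltnn subnn take0 cats0 /= nth_cat sn ltnn subnn /=.
  by rewrite /B !E.
- move=> z; have HR : List.In (mk (main j) (pattern_vars k ++ [:: succ (Var k); succ (Var k.+1)]),
       mk (main j) (pattern_vars k ++ [:: Var k;
         mk (main j) (pattern_vars k ++ [:: Var k;
           mk (main j) (pattern_vars k ++ [:: succ (Var k); Var k.+1])])])) trs.
    by apply/trsP; constructor 2; exists j => //; right; right; left.
  have := reduces_rule (nth zero (numerals b ++ [:: numeral x; numeral z])) HR.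
  do ! rewrite subst_mk // map_cat !map_cons.
  rewrite !substE subst_pattern_vars ?size_cat ?sn /= ?leq_addr //.
  rewrite take_cat sn ltnn subnn take0 cats0 !nth_cat sn ltnn subnn ltnNge leqnSn subSnn /=.
  by rewrite /B !E.
Qed.

Lemma vjump_limit b x r G z :
  vjump (b ++ x.+1 :: nseq r.+1 0) G z = vjump (b ++ x :: z.+1 :: nseq r 0) G z.
Proof.
elim: b G => [|y b IH] G; last first.
  by rewrite !cat_cons /= !size_cat /= !size_nseq IH.
rewrite !cat0s -[nseq r.+1 0]/(0 :: nseq r 0) /= !size_nseq !vjump_nseq0; reflexivity.
Qed.

Lemma eval_limit b x r : size b + r.+2 = k.+1 ->
  forall z, Main (numerals (b ++ x.+1 :: nseq r.+1 0)) (numeral z) ->>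
            Main (numerals (b ++ x :: z.+1 :: nseq r 0)) (numeral z).
Proof.
move=> sb z; set i := size b; have lt_i : i < k by rewrite /i; lia.
have Er : k - i = r.+1 by rewrite /i; lia.
have sn : size (numerals b) = i by rewrite size_map.
have HR : List.In (limit_rule j i) trs by apply/trsP; constructor 3; exists j => //; exists i.
have := reduces_rule (nth zero (numerals b ++ [:: numeral x; numeral z])) HR.
rewrite Er [r.+1.-1]/= !subst_mk //; try by rewrite !size_cat !size_map !size_iota /= !size_rcons !size_nseq arity_main //; lia.
rewrite !map_cat !map_cons !map_rcons !map_nseq !substE.
rewrite subst_pattern_vars ?size_cat ?sn /= ?leq_addr //.
rewrite take_cat sn ltnn subnn take0 cats0 !nth_cat sn ltnn subnn ltnNge leqnSn subSnn /=.
by rewrite /Main /numerals !map_cat /= !map_nseq !rcons_cat /=.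
Qed.

Lemma last_nonzero a : a = nseq (size a) 0 \/ exists b x r, a = b ++ x.+1 :: nseq r 0.
Proof.
elim: a => [|x a [->|[b [y [r ->]]]]]; first by left.
  case: x => [|x]; [by left; rewrite /= size_nseq|right].
  by exists [::], x, (size a).
by right; exists (x :: b), y, r.
Qed.

(** Induction along the lexicographic order of the vectors. *)
Lemma eval_main a z : size a = k.+1 -> Main (numerals a) (numeral z) ->> numeral (vjump a H z).
Proof.
move=> sa; move: a sa z; apply: lexlt_wf => a sa IH z.
have [E|[b [x [r E]]]] := last_nonzero a.
  rewrite E sa vjump_nseq0; have -> : numerals (nseq k.+1 0) = nseq k.+1 zero by rewrite /numerals map_nseq.
  exact: eval_base.
case: r E => [|r] E; rewrite E.
  rewrite cats1 /numerals map_rcons; have sb : size b = k by move: sa; rewrite E size_cat /=; lia.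
  apply: eval_last => // z'; have := IH (rcons b x) _ _ z'; rewrite /numerals map_rcons; apply.
    by rewrite size_rcons sb.
  by rewrite E -cats1 lexlt_cat /= ltnSn.
have sb : size b + r.+2 = k.+1 by move: sa; rewrite E size_cat /= size_nseq.
apply: reduces_trans (eval_limit x sb z) _; rewrite vjump_limit; apply: IH.
  by rewrite size_cat /= size_nseq.
by rewrite E lexlt_cat /= ltnSn.
Qed.

Lemma eval_unaryS z : mk (unary j.+1) [:: numeral z] ->> numeral (jump k.+1 H z).
Proof.
have leU : unary j.+1 <= last_sym by apply: le_unary.
have HR : List.In (mk (unary j.+1) [:: Var 0],
       mk (main j) (succ (Var 0) :: rcons (nseq k zero) (Var 0))) trs.
  by apply/trsP; constructor 2; exists j => //; do 3 right; left.
have := reduces_rule (fun=> numeral z) HR.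
rewrite !subst_mk ?arity_odd //; last by rewrite /= size_rcons size_nseq arity_main.
rewrite !map_cons map_rcons map_nseq !substE => H1; apply: reduces_trans H1 _.
have := @eval_main (z.+1 :: nseq k 0) z; rewrite /= size_nseq vjump_nseq0 => /(_ erefl).
by rewrite /Main /numerals /= map_nseq.
Qed.

End Main.

Lemma eval_unary j : j <= m -> forall z, mk (unary j) [:: numeral z] ->> numeral (Fmq k j 0 z).
Proof.
elim: j => [|j IH] lt_j z; first exact: (reduces_refl _ (numeral z.+1)).
exact: (eval_unaryS lt_j (nice_Fmq k j 0) (IH (ltnW lt_j))).
Qed.

Lemma eval_succ i : i <= q -> forall z, mk (2 * m + i).+1 [:: numeral z] ->> numeral (Fmq k m i z).
Proof.
elim: i => [|i IH] lt_i; first by rewrite addn0; apply: eval_unary.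
rewrite addnS; set n := (2 * m + i).+1.
have leS : n.+1 <= last_sym by rewrite /n /last_sym; lia.
have le : n <= last_sym by apply: ltnW.
have A1 : arity n = 1 by apply: arity_high; rewrite /n; lia.
have A2 : arity n.+1 = 1 by apply: arity_high; rewrite /n; lia.
have HR lr : List.In lr (succ_rules n) -> List.In lr trs.
  by move=> h; apply/trsP; constructor 4; exists i.
apply: (@eval_jump0 (fun t => mk n.+1 [:: t]) (fun t => mk n [:: t])).
- exact: nice_Fmq.
- by move=> s t; apply: reduces_mk1.
- exact/IH/ltnW.
- have := reduces_rule (fun=> zero) (HR _ (or_introl erefl)).
  by rewrite !subst_mk ?A1 ?A2 // !map_cons !substE.
- move=> z; have := reduces_rule (fun=> numeral z) (HR _ (or_intror (or_introl erefl))).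
  by do ! rewrite subst_mk ?A1 ?A2 // !map_cons; rewrite !substE.
Qed.

Lemma size_mk n ts : n <= last_sym -> term_size (mk n ts) = (\sum_(0 <= i < arity n) term_size (nth (Var 0) ts i)).+1.
Proof.
move=> le; rewrite /mk /= -ar_inord // big_mkord; congr _.+1.
by apply: eq_bigr => i _; rewrite ffunE.
Qed.

Lemma closed_mk n ts : n <= last_sym ->
  (forall i, i < arity n -> closed_term (nth (Var 0) ts i)) -> closed_term (mk n ts).
Proof.
move=> le H x [i]; rewrite ffunE; apply: H.
by rewrite -ar_inord //; apply: ltn_ord.
Qed.

Lemma unary_numeral n z : n <= last_sym -> arity n = 1 ->
  closed_term (mk n [:: numeral z]) /\ term_size (mk n [:: numeral z]) = z.+2.
Proof.
move=> le E; have [H1 H2] : closed_term (numeral z) /\ term_size (numeral z) = z.+1.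
  elim: z => [|z [IH1 IH2]]; first by split; [apply: closed_mk|rewrite size_mk // big_geq].
  split; first by apply: closed_mk => // -[|i]; rewrite // arity1.
  by rewrite -[numeral z.+1]/(mk 1 [:: numeral z]) size_mk // arity1 big_nat1 IH2.
split; first by apply: closed_mk => // -[|i]; rewrite // E.
by rewrite size_mk // E big_nat1 H2.
Qed.

(** A numeral starts a derivation as long as its value. *)
Lemma trs_dh_lower d : is_dh trs d -> forall z, Fmq k m q z <= d z.+2.
Proof.
move=> Hd z; have leq_sym : (2 * m + q).+1 <= last_sym by [].
have A1 : arity (2 * m + q).+1 = 1.
  by case: (q) => [|i]; [rewrite addn0 arity_odd|apply: arity_high; lia].
have [Hc Hs] := unary_numeral z leq_sym A1.
have [N leN [u [Eu Hu]]] := reduces_starts (eval_succ (leqnn q) z) (starts_numeral _).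
have HD : derivation trs z.+2 N by exists u; split; rewrite ?Eu // Hs.
case: (Hd z.+2) => [[_ /(_ _ HD)]|[/(_ _ HD)]] //; exact: leq_trans.
Qed.

End TRS.

(** Bounded search for the value needs a bound for the witnesses of the bounded
    graph, which grows like a later function of the hierarchy. Hence the
    rewrite system has [r] unary symbols more than would compute [Fmq k m q]. *)
Theorem elementary_in_dh k m q : 0 < m -> exists (F : vocabulary) (R : rules F) (d : nat -> nat),
  [/\ of_type k m F, is_trs R, reduces_lpo R, is_dh R d &
      elementary_in d (fun v : 1.-tuple nat => Fmq k m q (thead v))].
Proof.
move=> m_gt0; have [P [r [HP Ps Pc Ple]]] := Fmq_bounded_graph k m q q.
have HT := voc_type k (r + q) m_gt0; have HL := @trs_lpo k m (r + q) m_gt0.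
have HR := reduces_lpo_trs HL.
have [d Hd] := dh_exists HT HL.
exists (voc k (r + q) m_gt0), (trs k (r + q) m_gt0), d; split=> //.
have bd x : iter r (jump 0) (Fmq k m q) x.+1 <= d x.+3.
  by rewrite /Fmq -iterD; apply: (trs_dh_lower Hd).
apply: (elementary_of_graph (P := P) (bd := fun s => d (nth 0 s 0).+3)) => //.
- apply: elemf_oracle; do 3 apply: elemf_succ; exact: elemf_nth.
- by move=> v; apply: leq_trans (Ple v) _; case/tupleP: v => x u; rewrite (tuple0 u) /= addn0; apply: bd.
- move=> v y; rewrite -!nth_scons; split; first exact: Ps.
  move=> ->; apply: Pc; case/tupleP: v => x u; rewrite (tuple0 u) /= addn0; exact: bd.
Qed.

Theorem theorem1 (k m : nat) (hm : 1 <= m)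
    (n : nat) (f : n.-tuple nat -> nat) (hf : computable f) :
  [<-> provably_recursive (TIR k m) f;
       exists (q : nat) (G : nat -> nat),
         fast_growing (omega_pow_mul_add (1 + k) m q) G /\
         elementary_in G f;
       exists (F : vocabulary) (R : rules F) (d : nat -> nat),
         [/\ of_type k m F, is_trs R, reduces_lpo R,
             is_dh R d & elementary_in d f]].
Proof.
tfae.
- exact: provably_recursive_elementary.
- move=> [q [G [HG Hf]]].
  have [F [R [d [HF HR HL Hd Hq]]]] := elementary_in_dh k q hm.
  exists F, R, d; split=> //; apply: elementary_in_trans Hf.
  by apply: elem_ext Hq => v; rewrite Fmq_jumps (fast_growing_uniq HG).
- move=> [F [R [d [HF HR HL Hd Hf]]]].
  have [q Hq] := elementary_dh HF HR HL Hd.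
  by apply: elementary_provably_recursive; apply: elementary_in_trans Hq _ _ Hf.
Qed.
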